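(* Let $d\ge1$ and $1<p\le \infty$. Then $$b^{1/p}_{p,\infty}(\mathbb{R}^d) \subsetneq \overline{\operatorname{span}(\mathscr{H}_d)}^{B^{1/p}_{p,\infty}},$$ where the closure is taken in $B^{1/p}_{p,\infty}(\mathbb{R}^d)$.
   Context: $B^s_{p,q}(\mathbb{R}^d)$ is the usual inhomogeneous Besov space, and $b^s_{p,q}(\mathbb{R}^d)$ denotes the closure of the Schwartz class $\mathcal{S}(\mathbb{R}^d)$ in $B^s_{p,q}(\mathbb{R}^d)$. For $p=\infty$, $1/p=0$. Haar system: let $h^{(0)}=\mathbf{1}_{[0,1)}$ and $h^{(1)}=\mathbf{1}_{[0,1/2)}-\mathbf{1}_{[1/2,1)}$ on $\mathbb{R}$. For $\epsilon\in\{0,1\}^d$, $k\in\mathbb{N}_0$, $\mu\in\mathbb{Z}^d$ put $h^{\epsilon}_{k,\mu}(x)=\prod_{i=1}^d h^{(\epsilon_i)}(2^kx_i-\mu_i)$. With $\Upsilon=\{0,1\}^d\setminus\{\vec 0\}$, $\mathscr{H}_d=\{h^{\vec 0}_{0,\mu}\}_{\mu\in\mathbb{Z}^d}\cup\{h^{\epsilon}_{k,\mu}: k\in\mathbb{N}_0,\mu\in\mathbb{Z}^d,\epsilon\in\Upsilon\}$. $\operatorname{span}\mathscr{H}_d$ is the vector space of all finite linear combinations of Haar functions. *)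

(* Defs.v *)
From HB Require Import structures.
From mathcomp Require Import all_boot all_order all_algebra.
From mathcomp Require Import complex.
From mathcomp Require Import all_classical all_reals all_analysis.

Set Implicit Arguments.
Unset Strict Implicit.
Unset Printing Implicit Defensive.

Import Order.TTheory GRing.Theory Num.Theory.
Import numFieldNormedType.Exports.

Local Open Scope classical_set_scope.
Local Open Scope ring_scope.

(* Not found by instance inference for two sigma-finite factors *)
Lemma sigma_finite_product d1 d2 (T1 : measurableType d1)
  (T2 : measurableType d2) (R : realType)
  (m1 : {sigma_finite_measure set T1 -> \bar R})
  (m2 : {sigma_finite_measure set T2 -> \bar R}) :
  sigma_finite setT (m1 \x m2)%E.
Proof.
have /sigma_finiteP[F [TF ndF Foo]] := sigma_finiteT m1.
have /sigma_finiteP[G [TG ndG Goo]] := sigma_finiteT m2.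
exists (fun n => F n `*` G n).
  rewrite -setXTT TF TG predeqE => -[x y]; split.
    move=> [/= [n _ Fnx] [k _ Gky]]; exists (maxn n k) => //; split.
    - by move: x Fnx; exact/subsetPset/ndF/leq_maxl.
    - by move: y Gky; exact/subsetPset/ndG/leq_maxr.
  by move=> [n _ []/= ? ?]; split; exists n.
move=> k; have [? ?] := Foo k; have [? ?] := Goo k.
split; first exact: measurableX.
by rewrite product_measure1E// lte_mul_pinfty// ge0_fin_numE.
Qed.

Section LebesgueMeasure.
Context {R : realType}.

Local Notation mR := (measurableTypeR R).

Definition cons_pair n (x : mR * n.-tuple mR) : n.+1.-tuple mR :=
  [tuple of x.1 :: x.2].

Definition uncons n (t : n.+1.-tuple mR) : mR * n.-tuple mR :=
  (thead t, [tuple of behead t]).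

Lemma measurable_cons_pair n : measurable_fun setT (@cons_pair n).
Proof. exact: measurable_cons. Qed.

Lemma cons_pairK n : cancel (@cons_pair n) (@uncons n).
Proof. by case=> x t; congr pair => //; apply/val_inj. Qed.

Lemma measurable_uncons n : measurable_fun setT (@uncons n).
Proof.
apply/measurable_fun_pair; first exact: (measurable_tnth ord0).
exact: measurable_behead.
Qed.

Section Step.
Variables (n : nat) (m : {sigma_finite_measure set (n.-tuple mR) -> \bar R}).

Definition leb_cons : set (n.+1.-tuple mR) -> \bar R :=
  pushforward (@lebesgue_measure R \x m)%E (@cons_pair n).

Let mcons (A : set (n.+1.-tuple mR)) :
  measurable A -> measurable (@cons_pair n @^-1` A).
Proof. by move=> mA; rewrite -[X in measurable X]setTI; exact: measurable_cons_pair. Qed.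

Let leb_cons0 : leb_cons set0 = 0%E.
Proof. by rewrite /leb_cons /pushforward preimage_set0 measure0. Qed.

Let leb_cons_ge0 A : (0 <= leb_cons A)%E.
Proof. by rewrite /leb_cons /pushforward; exact: measure_ge0. Qed.

Let leb_cons_sigma_additive : semi_sigma_additive leb_cons.
Proof.
move=> F mF tF mUF; rewrite /leb_cons /pushforward preimage_bigcup.
apply: measure_semi_sigma_additive.
- by move=> i; exact: mcons.
- apply/trivIsetP => i j _ _ ij; rewrite -preimage_setI.
  by move/trivIsetP : tF => /(_ _ _ _ _ ij) ->//; rewrite preimage_set0.
- by rewrite -preimage_bigcup; exact: mcons.
Qed.

HB.instance Definition _ := isMeasure.Build _ _ _ leb_cons
  leb_cons0 leb_cons_ge0 leb_cons_sigma_additive.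

Let leb_cons_sigma_finite : sigma_finite setT leb_cons.
Proof.
have [F UF mF] := sigma_finite_product (@lebesgue_measure R) m.
exists (fun i => @uncons n @^-1` F i).
  by rewrite -preimage_bigcup -UF preimage_setT.
move=> i; have [mFi Fi] := mF i; split.
  by rewrite -[X in measurable X]setTI; exact: measurable_uncons.
rewrite /leb_cons /pushforward.
rewrite (_ : _ @^-1` _ = F i)//; apply/funext => x /=.
by rewrite /preimage /= cons_pairK.
Qed.

HB.instance Definition _ := Measure_isSigmaFinite.Build _ _ _ leb_cons
  leb_cons_sigma_finite.

End Step.

(* d-fold product of the one-dimensional Lebesgue measure; the base case is the
   unit mass on the one-point space R^0 *)
Fixpoint lebesgue_tuple d : {sigma_finite_measure set (d.-tuple mR) -> \bar R} :=
  if d is n.+1 then leb_cons (lebesgue_tuple n) else \d_[tuple].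

End LebesgueMeasure.

Section EuclideanSpace.
Context {R : realType} {d : nat}.
Local Notation E := 'rV[R]_d.
Local Notation C := R[i].

(* Row vectors carry the normed structure, tuples the measurable one *)
Definition row_of_tuple (t : d.-tuple (measurableTypeR R)) : E :=
  \row_(i < d) tnth t i.

Definition cintegral (f : E -> C) : C :=
  Complex (\int[lebesgue_tuple d]_t complex.Re (f (row_of_tuple t)))
          (\int[lebesgue_tuple d]_t complex.Im (f (row_of_tuple t))).

Definition cLnorm (p : \bar R) (f : E -> C) : \bar R :=
  Lnorm (lebesgue_tuple d) p (fun t => (Normc.normc (f (row_of_tuple t)))%:E).

Definition dot (x y : E) : R := \sum_(i < d) x ord0 i * y ord0 i.

Definition eucl_norm (x : E) : R := Num.sqrt (dot x x).

Definition partial (i : 'I_d) (f : E -> R) : E -> R :=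
  fun x => 'D_(delta_mx ord0 i) f x.

Definition partials (s : seq 'I_d) (f : E -> R) : E -> R := foldr partial f s.

Definition smooth (f : E -> R) := forall s x, differentiable (partials s f) x.

Definition cpartials (s : seq 'I_d) (f : E -> C) : E -> C := fun x =>
  Complex (partials s (fun y => complex.Re (f y)) x)
          (partials s (fun y => complex.Im (f y)) x).

(* (1 + |x|)^N |D^s f(x)|; here |x| is the max norm, which is equivalent to the
   Euclidean one *)
Definition schwartz_weight (N : nat) (s : seq 'I_d) (f : E -> C) (x : E) : R :=
  (1 + `|x|) ^+ N * Normc.normc (cpartials s f x).

Definition schwartz : set (E -> C) := [set f |
  [/\ smooth (fun x => complex.Re (f x)), smooth (fun x => complex.Im (f x)) &
      forall N s, exists M, forall x, schwartz_weight N s f x <= M]].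

Definition schwartz_seminorm (N : nat) (f : E -> C) : R :=
  sup [set y | exists s x, (size s <= N)%N /\ y = schwartz_weight N s f x].

(* Tempered distributions: continuous linear functionals on the Schwartz class.
   They are represented by total functions vanishing outside the Schwartz class,
   so that Leibniz equality is equality of distributions. *)
Definition tempered : set ((E -> C) -> C) := [set T |
  [/\ forall (a : C) f g, schwartz f -> schwartz g ->
        T (fun x => a * f x + g x) = a * T f + T g,
      exists N M, forall f, schwartz f ->
        Normc.normc (T f) <= M * schwartz_seminorm N f &
      forall f, ~ schwartz f -> T f = 0]].

Definition dist_of (g : E -> C) : (E -> C) -> C := fun f =>
  if `[< schwartz f >] then cintegral (fun x => g x * f x) else 0.

Definition expi (t : R) : C := Complex (cos t) (sin t).

(* inverse Fourier transform, with the normalization e^{2 pi i <x, xi>} *)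
Definition inv_fourier (f : E -> C) : E -> C := fun x =>
  cintegral (fun xi => f xi * expi (2 * pi * dot x xi)).

(* Besov spaces do not depend, up to equivalence of norms, on the generator phi
   of the dyadic resolution of unity; results are stated for an arbitrary one *)
Definition lp_generator (phi : E -> C) :=
  [/\ schwartz phi,
      forall xi, eucl_norm xi <= 1 -> phi xi = 1 &
      forall xi, 2 <= eucl_norm xi -> phi xi = 0].

(* phi_0 = phi, phi_k = phi (2^-k xi) - phi (2^-(k-1) xi) for k >= 1 *)
Definition lp_multiplier (phi : E -> C) (k : nat) : E -> C := fun xi =>
  if k is j.+1 then phi (2 ^- j.+1 *: xi) - phi (2 ^- j *: xi) else phi xi.

(* The function F^-1 [phi_k F T], i.e. the convolution of the tempered
   distribution T with the Schwartz function F^-1 phi_k, in the usual pointwise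
   form x |-> <T, (F^-1 phi_k)(x - .)> *)
Definition lp_block (phi : E -> C) (k : nat) (T : (E -> C) -> C) : E -> C :=
  fun x => T (fun y => inv_fourier (lp_multiplier phi k) (x - y)).

(* the l^q norm over k of 2^(k s) || F^-1 [phi_k F T] ||_{L^p} *)
Definition besov_norm (phi : E -> C) (s : R) (p q : \bar R)
    (T : (E -> C) -> C) : \bar R :=
  Lnorm (@counting nat R) q
    (fun k => (2 `^ (k%:R * s))%:E * cLnorm p (lp_block phi k T))%E.

Definition besov (phi : E -> C) (s : R) (p q : \bar R) : set ((E -> C) -> C) :=
  [set T | tempered T /\ (besov_norm phi s p q T < +oo)%E].

(* Norm closure in B^s_{p,q}; only the elements of A that lie in B^s_{p,q} are
   taken into account *)
Definition besov_closure (phi : E -> C) (s : R) (p q : \bar R)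
    (A : set ((E -> C) -> C)) : set ((E -> C) -> C) :=
  [set T | besov phi s p q T /\ forall e : R, 0 < e ->
     exists U, [/\ A U, besov phi s p q U &
                   (besov_norm phi s p q (T \- U)%R < e%:E)%E]].

Definition little_besov (phi : E -> C) (s : R) (p q : \bar R) :
    set ((E -> C) -> C) :=
  besov_closure phi s p q (dist_of @` schwartz).

(* h^(0) for false, h^(1) for true *)
Definition haar1 (b : bool) : R -> R :=
  if b then \1_`[0, 2^-1[ \- \1_`[2^-1, 1[ else \1_`[0, 1[.

Definition haar (eps : 'I_d -> bool) (k : nat) (mu : 'I_d -> int) : E -> C :=
  fun x => (\prod_(i < d) haar1 (eps i) (2 ^+ k * x ord0 i - (mu i)%:~R))%:C%C.

Definition haar_system : set (E -> C) := [set g |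
  (exists mu, g = haar (fun=> false) 0 mu) \/
  (exists eps k mu, eps <> (fun=> false) /\ g = haar eps k mu)].

Definition lin_span (A : set (E -> C)) : set (E -> C) := [set g |
  exists (n : nat) (c : 'I_n -> C) (h : 'I_n -> E -> C),
    (forall j, A (h j)) /\ g = (fun x => \sum_(j < n) c j * h j x)].

End EuclideanSpace.

(* Main.v *)
Require Import Defs.
From HB Require Import structures.
From mathcomp Require Import all_boot all_order all_algebra.
From mathcomp Require finmap.
From mathcomp Require Import complex.
From mathcomp Require Import all_classical all_reals all_analysis.
From mathcomp Require Import measurable_realfun ess_sup_inf zify ring lra.

Set Implicit Arguments.
Unset Strict Implicit.
Unset Printing Implicit Defensive.

Import Order.TTheory GRing.Theory Num.Theory.
Import numFieldNormedType.Exports.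

Local Open Scope classical_set_scope.
Local Open Scope ring_scope.

(** Both spaces are closures, so the inclusion follows once every distribution
given by a Schwartz function [g] is approximated by finite combinations of
Haar functions, and strictness once a single Haar function stays away from all
Schwartz functions.

The Littlewood-Paley block of index [k] of a function [F] is the difference of
two averages of [F] at the scales [2^-k] and [2^-(k-1)] against the integrable
kernel [K], the inverse Fourier transform of [phi] ([lp_blockE]).  Two bounds
follow: the blocks are bounded by a multiple of [sup |F|], and by Tonelli their
L^1 norm is at most a multiple of [2^-k V] when [V] controls the L^1 modulus of
continuity, [int |F(x+v) - F(x)| dx <= V |v|] ([block_L1]).  Interpolating,
[|G|^p <= a^(p-1) |G|], the norm of [F] in [B^(1/p)_(p,oo)] is at most a multiple
of [sup|F|^(1-1/p) V^(1/p)] ([besov_norm_bound]).  As [p > 1], functions that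
tend to [0] uniformly while [V] stays bounded tend to [0] in the Besov space.

Inclusion.  Let [g] be a Schwartz function and [h_N] the step function that takes
on each dyadic cube of side [2^-N] the value of [g] at the corner.  Then
[g - h_N] is uniformly of size [2^-N], and [V] stays bounded because a step
function jumps in proportion to the mesh, [2^N] times per unit length
([wlip_step]).  Soft thresholding of [g] at height [2^-N] makes [h_N] compactly
supported without spoiling either estimate, and a finite combination of
indicators of dyadic cubes is a finite combination of Haar functions
([step_span]).

Strictness.  Let [u] be the indicator of the unit cube, itself a Haar function.
Near a face of the cube the real part of its block of index [k] is, up to
[O(2^-k)], equal to [Gamma(t) - Gamma(t/2)], where [t] is the signed distance to
the face times [2^k] and [Gamma(t)] is the integral of the real part of [K] over
the half space [z_0 <= t] ([block_cube]).  If this difference vanished identically, [Gamma]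
would take the same value at [t] and [t/2^n] for all [n]; its continuity at [0]
and its limits at infinity would then give [int Re K = 0] ([halfmass_jump]).
But [int Re K] is positive: tested against wide tent functions, [Re K] gives the
integral of [Re phi] against a Fejer kernel concentrating at the origin, where
[phi = 1], and a Fejer kernel is nonnegative with positive mass
([kernel_mass_gt0]).  So the blocks of [u] are bounded below on a slab of measure
comparable to [2^-k], and [2^(k/p) (2^-k)^(1/p) = 1] leaves a bound from below
independent of [k]; the blocks of a Schwartz function are [O(2^-k)] uniformly, so
they cannot compensate it ([cube_far_from_schwartz]). *)

(** * Affine changes of variables and product integrals *)

Section Affine1.
Context {R : realType}.
Local Notation mR := (measurableTypeR R).
Local Notation leb := (@lebesgue_measure R).

Definition affine1 (a b : R) (x : mR) : mR := a * x + b.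

Lemma measurable_affine1 a b : measurable_fun setT (affine1 a b).
Proof. by apply: measurable_funD => //; apply: measurable_funM. Qed.

Let affm a b : {measure set mR -> \bar R} :=
  mscale (NngNum (normr_ge0 a))
    (measure_function.measure_function_pushforward__canonical__measure_function_Measure
       leb (measurable_affine1 a b)).

(** Both sides are measures, so it is enough to compare them on half-open
intervals; a reflection turns those around, which is why the sign of [a] matters. *)
Lemma lebesgue_affine1 (a b : R) (A : set mR) : a != 0 -> measurable A ->
  leb A = (`|a|%:E * pushforward leb (affine1 a b) A)%E.
Proof.
move=> a0 mA.
rewrite (@lebesgue_measure_unique R (affm a b))// => _ [[u v] _ <-].
rewrite lebesgue_measure_itv /= lte_fin.
change (mscale _ _ `]u, v]%classic) with
  (`|a|%:E * leb (affine1 a b @^-1` `]u, v]%classic))%E.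
have [a_gt0|a_lt0|] := ltgtP 0 a; last by move/esym/eqP; rewrite (negbTE a0).
- have -> : affine1 a b @^-1` `]u, v] = `](u - b) / a, (v - b) / a]%classic.
    apply/seteqP; split=> x; rewrite /preimage /affine1 /= !in_itv /=;
    by rewrite ltr_pdivrMr// ler_pdivlMr// ltrBlDr lerBrDr (mulrC x).
  rewrite lebesgue_measure_itv /= lte_fin ltr_pM2r ?invr_gt0// ltrD2r.
  case: ifP => _; last by rewrite mule0.
  by rewrite -!EFinB -EFinM -mulrBl; congr _%:E; rewrite gtr0_norm//; field.
- have -> : affine1 a b @^-1` `]u, v] = `[(v - b) / a, (u - b) / a[%classic.
    apply/seteqP; split=> x; rewrite /preimage /affine1 /= !in_itv /=;
    by rewrite ltr_ndivlMr// ler_ndivrMr// ltrBlDr lerBrDr (mulrC x) andbC.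
  rewrite lebesgue_measure_itv /= lte_fin ltr_nM2r ?invr_lt0// ltrD2r.
  case: ifP => _; last by rewrite mule0.
  by rewrite -!EFinB -EFinM -mulrBl; congr _%:E; rewrite ltr0_norm//; field.
Qed.

Lemma integral_affine1 (a b : R) (f : mR -> \bar R) : a != 0 ->
  measurable_fun setT f -> (forall x, 0 <= f x)%E ->
  (\int[leb]_x f x = `|a|%:E * \int[leb]_x f (a * x + b)%R)%E.
Proof.
move=> a0 mf f0.
rewrite (eq_measure_integral (affm a b)); last first.
  by move=> A mA _; exact: (lebesgue_affine1 b a0 mA).
rewrite ge0_integral_mscale//=; congr (_ * _)%E.
by rewrite (ge0_integral_pushforward (measurable_affine1 a b)).
Qed.

(** The integral over [R^(n+1)] as an iterated integral, the form in which all
inductions on the dimension below use the product measure. *)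
Lemma leb_cons_tonelli n (F : n.+1.-tuple mR -> \bar R) :
  measurable_fun setT F -> (forall t, 0 <= F t)%E ->
  (\int[lebesgue_tuple n.+1]_t F t =
   \int[leb]_x \int[lebesgue_tuple n]_t F [tuple of x :: t])%E.
Proof.
move=> mF F0 /=.
rewrite /leb_cons.
have mc := @measurable_cons_pair R n.
rewrite (@ge0_integral_pushforward _ _ _ _ _ _ mc)//.
rewrite preimage_setT.
rewrite fubini_tonelli1//=.
exact: measurableT_comp mF mc.
Qed.
End Affine1.

Section Tuples.
Context {R : realType}.
Local Notation mR := (measurableTypeR R).
Local Notation leb := (@lebesgue_measure R).

Definition affine_tuple n (a : R) (b : 'I_n -> R) (t : n.-tuple mR) : n.-tuple mR :=
  [tuple (a * tnth t i + b i : mR) | i < n].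

Lemma measurable_affine_tuple n a b : measurable_fun setT (@affine_tuple n a b).
Proof.
apply/measurable_fun_tnthP => i.
rewrite (_ : _ \o _ = fun t : n.-tuple mR => a * tnth t i + b i); last first.
  by apply/funext => t /=; rewrite tnth_mktuple.
by apply: measurable_funD => //; apply: measurable_funM => //;
   exact: measurable_tnth.
Qed.

Lemma measurable_consE n (F : n.+1.-tuple mR -> \bar R) :
  measurable_fun setT F ->
  measurable_fun setT (fun z : mR * n.-tuple mR => F [tuple of z.1 :: z.2]).
Proof. by move=> mF; exact: measurableT_comp mF (@measurable_cons_pair R n). Qed.

Lemma integral_affine_tuple n (a : R) (b : 'I_n -> R) (F : n.-tuple mR -> \bar R) :
  a != 0 -> measurable_fun setT F -> (forall t, 0 <= F t)%E ->
  (\int[lebesgue_tuple n]_t F t =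
   (`|a| ^+ n)%:E * \int[lebesgue_tuple n]_t F (affine_tuple a b t))%E.
Proof.
move=> a0; elim: n b F => [|n IH] b F mF F0.
  rewrite expr0 mul1e; apply: eq_integral => t _; congr F.
  by rewrite tuple0 [RHS]tuple0.
rewrite leb_cons_tonelli//.
rewrite (integral_affine1 (b ord0) a0); last 2 first.
- exact: (measurable_fun_fubini_tonelli_F (m2 := lebesgue_tuple n)
    (fun z => F [tuple of z.1 :: z.2]) (measurable_consE mF) (fun z => F0 _)).
- by move=> x; exact: integral_ge0.
rewrite leb_cons_tonelli//=; last exact: measurableT_comp mF (measurable_affine_tuple a b).
rewrite exprS EFinM -muleA; congr (_ * _)%E.
rewrite -ge0_integralZl//; last 2 first.
- have mFa := measurableT_comp mF (measurable_affine_tuple a b).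
  exact: (measurable_fun_fubini_tonelli_F (m2 := lebesgue_tuple n)
    (fun z => F (affine_tuple a b [tuple of z.1 :: z.2])) (measurable_consE mFa)
    (fun z => F0 _)).
- by move=> x _; exact: integral_ge0.
apply: eq_integral => x _.
rewrite (IH (fun i => b (lift ord0 i))) //; last first.
  apply: measurableT_comp mF _.
  by apply: measurable_cons => //; exact: measurable_cst.
congr (_ * _)%E; apply: eq_integral => t _; congr F.
apply/eq_from_tnth => i; rewrite tnth_mktuple.
case: (unliftP ord0 i) => [j|] ->.
  by rewrite !tnthS tnth_mktuple.
by rewrite !tnth0.
Qed.

Lemma integral_prod n (f : 'I_n -> R -> R) (c : 'I_n -> R) :
  (forall i, measurable_fun setT (f i)) -> (forall i x, 0 <= f i x) ->
  (forall i, \int[leb]_x (f i x)%:E = (c i)%:E)%E ->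
  (\int[lebesgue_tuple n]_t (\prod_(i < n) f i (tnth t i))%:E =
   (\prod_(i < n) c i)%:E)%E.
Proof.
elim: n f c => [|n IH] f c mf f0 fc.
  rewrite big_ord0.
  under eq_integral do rewrite big_ord0.
  by rewrite /= integral_dirac// diracT mul1e.
have mp m (g : 'I_m -> R -> R) : (forall i, measurable_fun setT (g i)) ->
    measurable_fun setT (fun t : m.-tuple mR => \prod_(i < m) g i (tnth t i)).
  move=> mg; apply: measurable_prod => i _.
  by apply: measurableT_comp (mg i) _; exact: measurable_tnth.
rewrite leb_cons_tonelli; last 2 first.
- by apply/measurable_EFinP; exact: mp.
- by move=> t; rewrite lee_fin prodr_ge0.
pose g i := f (lift ord0 i); pose C := \prod_(i < n) c (lift ord0 i).
have IHg : (\int[lebesgue_tuple n]_t (\prod_(i < n) g i (tnth t i))%:E = C%:E)%E.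
  by apply: IH => [i|i x|i]; [exact: mf|exact: f0|exact: fc].
have C0 : (0 <= C%:E)%E.
  by rewrite -IHg; apply: integral_ge0 => t _; rewrite lee_fin prodr_ge0// /g.
transitivity (\int[leb]_x ((f ord0 x)%:E * C%:E))%E; last first.
  rewrite ge0_integralZr//; last 2 first.
  - by apply/measurable_EFinP; exact: mf.
  - by move=> x _; rewrite lee_fin.
  by rewrite fc -EFinM big_ord_recl.
apply: eq_integral => x _; rewrite -IHg -ge0_integralZl//; last 3 first.
- by apply/measurable_EFinP; apply: mp => i; exact: mf.
- by move=> t _; rewrite lee_fin prodr_ge0// /g.
- by rewrite lee_fin.
apply: eq_integral => t _; rewrite big_ord_recl tnth0 -EFinM.
by congr (_ * _)%:E; apply: eq_bigr => i _; rewrite tnthS.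
Qed.

End Tuples.

(** * Measurable and integrable functions of a row vector *)

Section Space.
Context {R : realType} {d : nat}.
Local Notation mR := (measurableTypeR R).
Local Notation E := 'rV[R]_d.
Local Notation T := (d.-tuple mR).
Local Notation lam := (@lebesgue_tuple R d).
Local Notation rt := (@row_of_tuple R d).

Definition meas (f : E -> R) := measurable_fun setT (fun t : T => f (rt t)).

Definition summ (f : E -> R) := lam.-integrable setT (fun t => (f (rt t))%:E).

Definition eint (f : E -> R) : \bar R := (\int[lam]_t (f (rt t))%:E)%E.

(** The corner of the dyadic cube of side [2^-N] that contains [x]. *)
Definition grid (N : nat) (x : E) : E :=
  \row_i ((Num.floor (2 ^+ N * x ord0 i))%:~R / 2 ^+ N).

Lemma row_of_tupleE (t : T) i : rt t ord0 i = tnth t i.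
Proof. by rewrite mxE. Qed.

Lemma row_of_affine_tuple a (b : E) t :
  rt (affine_tuple a (fun i => b ord0 i) t) = a *: rt t + b.
Proof. by apply/rowP => i; rewrite !mxE tnth_mktuple. Qed.

Lemma grid_dist N (x : E) (i : 'I_d) : 0 <= x ord0 i - grid N x ord0 i < 2 ^- N.
Proof.
rewrite mxE; have p : 0 < 2 ^+ N :> R by rewrite exprn_gt0.
set y := 2 ^+ N * x ord0 i; have /andP[h1 h2] := floor_itv y.
have -> : x ord0 i = y / 2 ^+ N by rewrite /y [2 ^+ N * _]mulrC mulfK// gt_eqF.
rewrite -mulrBl mulr_ge0 ?subr_ge0 ?invr_ge0 ?(ltW p)//=.
by rewrite ltr_pdivrMr// mulVf ?gt_eqF// ltrBlDl -intrD1.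
Qed.

Lemma coord_le_norm (x : E) i : `|x ord0 i| <= `|x|.
Proof.
rewrite [leRHS]mx_normrE.
exact: (le_bigmax _ (fun i : 'I_1 * 'I_d => `|x i.1 i.2|) (ord0, i)).
Qed.

Lemma norm_le_row (x : E) r : 0 <= r ->
  (forall i, `|x ord0 i| <= r) -> `|x| <= r.
Proof.
move=> r0 h; rewrite [leLHS]mx_normrE; apply: bigmax_le => //= -[i j] _ /=.
by rewrite ord1 h.
Qed.

Lemma grid_norm N (x : E) : `|x - grid N x| <= 2 ^- N.
Proof.
apply: norm_le_row => [|i]; first by rewrite invr_ge0 exprn_ge0.
have /andP[h1 h2] := grid_dist N x i.
by rewrite !mxE in h1 h2 *; rewrite ger0_norm// ltW.
Qed.

(** A function of the cube containing [x] takes countably many values, each on a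
union of cubes, whatever [f] is. *)
Lemma meas_grid (f : E -> R) N : meas (f \o grid N).
Proof.
move=> _ Y mY; rewrite setTI.
pose cell (mu : 'rV[int]_d) : set T :=
  [set t | forall i, Num.floor (2 ^+ N * tnth t i) = mu ord0 i].
pose val (mu : 'rV[int]_d) : E := \row_i ((mu ord0 i)%:~R / 2 ^+ N).
have -> : (fun t => (f \o grid N) (rt t)) @^-1` Y =
    \bigcup_(mu in [set mu | Y (f (val mu))]) cell mu.
  apply/seteqP; split=> t /=.
    move=> Yt; exists (\row_i Num.floor (2 ^+ N * tnth t i)) => /=.
      rewrite (_ : val _ = grid N (rt t))//.
      by apply/rowP => i; rewrite !mxE.
    by move=> i; rewrite mxE.
  move=> [mu /= Ymu tmu]; rewrite /preimage /=.
  rewrite (_ : grid N (rt t) = val mu)//.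
  by apply/rowP => i; rewrite !mxE tmu.
rewrite bigcup_mkcond; apply: countable_bigcupT_measurable => // mu.
case: ifPn => // _.
rewrite (_ : cell mu = \bigcap_(i in [set: 'I_d])
    ((fun t : T => tnth t i) @^-1`
      `[(mu ord0 i)%:~R / 2 ^+ N, (mu ord0 i + 1)%:~R / 2 ^+ N[)); last first.
  have p : 0 < 2 ^+ N :> R by rewrite exprn_gt0.
  apply/seteqP; split=> t /=.
    move=> h i _ /=; rewrite in_itv /=.
    have := floor_itv (2 ^+ N * tnth t i); rewrite h.
    by rewrite ler_pdivrMr// ltr_pdivlMr// mulrC.
  move=> h i; have := h i Logic.I; rewrite /= in_itv /=.
  rewrite ler_pdivrMr// ltr_pdivlMr// mulrC => hh.
  exact: floor_def.
apply: fin_bigcap_measurable => // i _.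
rewrite -[X in measurable X]setTI.
exact: (measurable_tnth i).
Qed.

Lemma grid_cvg (x : E) : grid N x @[N --> \oo] --> x.
Proof.
apply/cvgrPdist_le => e e0.
have q : `|2^-1 : R| < 1.
  by rewrite ger0_norm ?invr_ge0// invf_lt1// ltr1n.
have /cvgrPdist_le /(_ _ e0) := cvg_geometric 1 q; apply: filterS => N.
rewrite sub0r normrN /geometric /= mul1r exprVn ger0_norm ?invr_ge0 ?exprn_ge0//.
exact: le_trans (grid_norm N x).
Qed.

(** The Borel structure on tuples is a product structure, unrelated to the
topology of row vectors by definition; a continuous function is the limit of the
step functions [f \o grid N], which are measurable. *)
Lemma meas_continuous (f : E -> R) : continuous f -> meas f.
Proof.
move=> cf; apply: (measurable_fun_cvg (h := fun N t => f (grid N (rt t)))).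
  by move=> N; exact: (@meas_grid f N).
by move=> t _; apply: (cvg_comp (grid^~ (rt t)) f); [exact: grid_cvg|exact: cf].
Qed.

Lemma eint_affine (f : E -> R) (a : R) (b : E) : a != 0 -> meas f ->
  (forall x, 0 <= f x) ->
  (eint f = (`|a| ^+ d)%:E * eint (fun x => f (a *: x + b)%R))%E.
Proof.
move=> a0 mf f0; rewrite /eint.
rewrite (integral_affine_tuple (a := a) (fun i => b ord0 i))//; last 2 first.
- by apply/measurable_EFinP.
- by move=> t; rewrite lee_fin.
by congr (_ * _)%E; apply: eq_integral => t _; rewrite row_of_affine_tuple.
Qed.

Lemma measurable_lin2 (a b : R) (c : E) : measurable_fun setT
  (fun z : T * T => [tuple (a * tnth z.1 i + b * tnth z.2 i + c ord0 i : mR) | i < d]).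
Proof.
apply/measurable_fun_tnthP => i.
rewrite (_ : _ \o _ = fun z : T * T => a * tnth z.1 i + b * tnth z.2 i + c ord0 i); last first.
  by apply/funext => t /=; rewrite tnth_mktuple.
apply: measurable_funD => //; apply: measurable_funD => //;
   apply: measurable_funM => //.
  by apply: (measurableT_comp (measurable_tnth i)) => //.
by apply: (measurableT_comp (measurable_tnth i)) => //.
Qed.

Lemma meas_lin2 f (a b : R) (c : E) : meas f ->
  measurable_fun setT (fun z : T * T => f (a *: rt z.1 + b *: rt z.2 + c)).
Proof.
move=> mf; have := measurableT_comp mf (measurable_lin2 a b c).
congr measurable_fun; apply/funext => z /=; congr f.
by apply/rowP => i; rewrite !mxE tnth_mktuple.
Qed.

Lemma meas_affine f (a : R) (c : E) : meas f -> meas (fun x => f (a *: x + c)).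
Proof.
move=> mf; have := measurableT_comp mf (measurable_affine_tuple a (fun i => c ord0 i)).
by congr measurable_fun; apply/funext => z /=; rewrite row_of_affine_tuple.
Qed.

End Space.

Section Integrals.
Context {R : realType} {d : nat}.
Local Notation mR := (measurableTypeR R).
Local Notation E := 'rV[R]_d.
Local Notation T := (d.-tuple mR).
Local Notation lam := (@lebesgue_tuple R d).
Local Notation rt := (@row_of_tuple R d).
Implicit Types f g : E -> R.

Definition rint f : R := \int[lam]_t f (rt t).

Lemma measD f g : meas f -> meas g -> meas (fun x => f x + g x).
Proof. exact: measurable_funD. Qed.

Lemma measB f g : meas f -> meas g -> meas (fun x => f x - g x).
Proof. exact: measurable_funB. Qed.

Lemma measM f g : meas f -> meas g -> meas (fun x => f x * g x).
Proof. exact: measurable_funM. Qed.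

Lemma meas_cst (c : R) : meas (fun _ : E => c).
Proof. exact: measurable_cst. Qed.

Lemma meas_norm f : meas f -> meas (fun x => `|f x|).
Proof. by move=> mf; apply: measurableT_comp. Qed.

Lemma meas_comp (h : R -> R) f : measurable_fun setT h -> meas f ->
  meas (fun x => h (f x)).
Proof. by move=> mh mf; exact: measurableT_comp mh mf. Qed.

Lemma meas_coord i : meas (fun x : E => x ord0 i).
Proof.
rewrite /meas (_ : (fun t : T => _) = (fun t : T => tnth t i : R)).
  exact: (measurable_tnth i).
by apply/funext => t; rewrite mxE.
Qed.

Lemma eint_ge0 f : (forall x, 0 <= f x) -> (0 <= eint f)%E.
Proof. by move=> f0; apply: integral_ge0 => t _; rewrite lee_fin. Qed.

Lemma eintD f g : meas f -> meas g -> (forall x, 0 <= f x) ->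
  (forall x, 0 <= g x) -> (eint (fun x => f x + g x)%R = eint f + eint g)%E.
Proof.
move=> mf mg f0 g0; rewrite -ge0_integralD//.
- by move=> t _; rewrite lee_fin.
- exact/measurable_EFinP.
- by move=> t _; rewrite lee_fin.
- exact/measurable_EFinP.
Qed.

Lemma eintZ f c : meas f -> (forall x, 0 <= f x) -> 0 <= c ->
  (eint (fun x => c * f x)%R = c%:E * eint f)%E.
Proof.
move=> mf f0 c0; rewrite -ge0_integralZl//.
- exact/measurable_EFinP.
- by move=> t _; rewrite lee_fin.
Qed.

Lemma summP f : summ f <-> meas f /\ (eint (fun x => `|f x|)%R < +oo)%E.
Proof.
split=> [/integrableP[mf fi]|[mf fi]]; first by split => //; apply/measurable_EFinP.
by apply/integrableP; split => //; apply/measurable_EFinP.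
Qed.

Lemma summ_meas f : summ f -> meas f. Proof. by case/summP. Qed.

Lemma summ_le f g : meas f -> (forall x, `|f x| <= g x) -> summ g -> summ f.
Proof.
move=> mf fg sg; apply: le_integrable sg => //; first exact/measurable_EFinP.
by move=> t _; rewrite /= lee_fin (le_trans (fg _))// ler_norm.
Qed.

Lemma summD f g : summ f -> summ g -> summ (fun x => f x + g x).
Proof. by move=> sf sg; exact: (integrableD _ sf sg). Qed.

Lemma summB f g : summ f -> summ g -> summ (fun x => f x - g x).
Proof. by move=> sf sg; exact: (integrableB _ sf sg). Qed.

Lemma summZ f c : summ f -> summ (fun x => c * f x).
Proof. by move=> sf; exact: (integrableZl _ c sf). Qed.

Lemma summ_norm f : summ f -> summ (fun x => `|f x|).
Proof.
move=> sf; apply: summ_le (meas_norm (summ_meas sf)) _ (_ : summ (fun x => `|f x|)).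
  by move=> x; rewrite normr_id.
by apply: integrable_norm; exact: sf.
Qed.

Lemma summM f g C : meas f -> (forall x, `|f x| <= C) -> summ g ->
  summ (fun x => f x * g x).
Proof.
move=> mf fC sg; apply: (summ_le (g := fun x => C * `|g x|)).
- exact: measM mf (summ_meas sg).
- by move=> x; rewrite normrM ler_wpM2r.
- exact/summZ/summ_norm.
Qed.

Lemma summ0 : summ (fun _ : E => 0). Proof. exact: integrable0. Qed.

Lemma summ_sum (I : Type) (r : seq I) (F : I -> E -> R) :
  (forall i, summ (F i)) -> summ (fun x => \sum_(i <- r) F i x).
Proof.
move=> sF; elim: r => [|i r IH].
  by have := summ0; congr summ; apply/funext => x; rewrite big_nil.
by have := summD (sF i) IH; congr summ; apply/funext => x; rewrite big_cons.
Qed.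

Lemma eint_rint f : summ f -> eint f = (rint f)%:E.
Proof.
by move=> sf; rewrite /rint /Rintegral fineK//; exact: (integrable_fin_num _ sf).
Qed.

Lemma rint_eint f : rint f = fine (eint f). Proof. by []. Qed.

Lemma rintD f g : summ f -> summ g ->
  rint (fun x => f x + g x) = rint f + rint g.
Proof. by move=> sf sg; exact: (RintegralD _ sf sg). Qed.

Lemma rintB f g : summ f -> summ g ->
  rint (fun x => f x - g x) = rint f - rint g.
Proof. by move=> sf sg; exact: (RintegralB _ sf sg). Qed.

Lemma rintZ f c : summ f -> rint (fun x => c * f x) = c * rint f.
Proof. by move=> sf; exact: (RintegralZl _ _ sf). Qed.

Lemma rint0 : rint (fun _ : E => 0) = 0.
Proof. by rewrite /rint /Rintegral integral0. Qed.

Lemma rint_ge0 f : (forall x, 0 <= f x) -> 0 <= rint f.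
Proof. by move=> f0; apply: Rintegral_ge0. Qed.

Lemma le_rint f g : summ f -> summ g -> (forall x, f x <= g x) ->
  rint f <= rint g.
Proof. by move=> sf sg fg; exact: (le_Rintegral _ sf sg). Qed.

Lemma norm_rint f : summ f -> `|rint f| <= rint (fun x => `|f x|).
Proof. by move=> sf; exact: (le_normr_Rintegral _ sf). Qed.

Lemma rint_bound f g : meas f -> summ g -> (forall x, `|f x| <= g x) ->
  `|rint f| <= rint g.
Proof.
move=> mf sg fg; have sf := summ_le mf fg sg.
exact: le_trans (norm_rint sf) (le_rint (summ_norm sf) sg fg).
Qed.

Lemma eq_rint f g : f =1 g -> rint f = rint g.
Proof. by move=> /funext ->. Qed.

Lemma summ_affine f (a : R) (b : E) : a != 0 -> summ f ->
  summ (fun x => f (a *: x + b)).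
Proof.
move=> a0 /summP[mf fi]; apply/summP; split; first exact: meas_affine.
move: fi; rewrite (eint_affine b a0 (meas_norm mf))//.
set I := eint _; case: I => [r|//|//]; rewrite ?ltry//.
by rewrite gt0_muley// lte_fin exprn_gt0// normr_gt0.
Qed.

(** Change of variables for nonnegative functions, applied to the positive and
the negative part. *)
Lemma rint_affine f (a : R) (b : E) : a != 0 -> summ f ->
  rint f = `|a| ^+ d * rint (fun x => f (a *: x + b)).
Proof.
move=> a0 sf; have mf := summ_meas sf.
have E1 g : meas g -> (forall x, 0 <= g x) -> summ g ->
    rint g = `|a| ^+ d * rint (fun x => g (a *: x + b)).
  move=> mg g0 sg; apply/EFin_inj; rewrite EFinM -!eint_rint//.
    exact: eint_affine.
  exact: summ_affine.
pose p x := Num.max (f x) 0; pose q x := Num.max (- f x) 0.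
have fE x : f x = p x - q x.
  by rewrite /p /q; case: (lerP (f x) 0) => h; case: (lerP (- f x) 0) => h'; lra.
have sp : summ p.
  apply: (summ_le (g := fun x => `|f x|)); last exact: summ_norm.
  - by apply: measurable_maxr => //.
  - by move=> x; rewrite /p; case: (lerP (f x) 0); rewrite ?normr0.
have sq : summ q.
  apply: (summ_le (g := fun x => `|f x|)); last exact: summ_norm.
  - by apply: measurable_maxr => //; exact: measurable_funN.
  - by move=> x; rewrite /q; case: (lerP (- f x) 0); rewrite ?normr0 ?normrN.
have -> : rint f = rint p - rint q by rewrite -rintB//; exact: eq_rint.
rewrite (@eq_rint (fun x => f (a *: x + b))
   (fun x => p (a *: x + b) - q (a *: x + b))); last by move=> x; rewrite -fE.
rewrite rintB; [|exact: summ_affine..].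
rewrite (E1 p)//; [|exact: summ_meas|by move=> x; rewrite /p le_max lexx orbT].
rewrite (E1 q)//; [|exact: summ_meas|by move=> x; rewrite /q le_max lexx orbT].
by rewrite mulrBr.
Qed.

Lemma summ_prod (f : 'I_d -> R -> R) (c : 'I_d -> R) :
  (forall i, measurable_fun setT (f i)) -> (forall i x, 0 <= f i x) ->
  (forall i, \int[lebesgue_measure]_x (f i x)%:E = (c i)%:E)%E ->
  summ (fun x : E => \prod_i f i (x ord0 i)) /\
  rint (fun x : E => \prod_i f i (x ord0 i)) = \prod_i c i.
Proof.
move=> mf f0 fc.
have H : eint (fun x : E => \prod_i f i (x ord0 i)) = (\prod_i c i)%:E.
  rewrite -(integral_prod mf f0 fc); apply: eq_integral => t _.
  by congr _%:E; apply: eq_bigr => i _; rewrite mxE.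
split; last by rewrite rint_eint H.
apply/summP; split.
  apply: measurable_prod => i _; exact: (meas_comp (mf i) (meas_coord i)).
rewrite (_ : (fun x => `|_|) = fun x : E => \prod_i f i (x ord0 i)) ?H ?ltry//.
by apply/funext => x; rewrite ger0_norm// prodr_ge0.
Qed.

(** An integrable weight; every decay estimate below is stated as a bound by a
multiple of it. *)
Definition wt (x : E) : R := ((1 + `|x|) ^+ (2 * d))^-1.

Lemma norm1_gt0 (x : E) : 0 < 1 + `|x|.
Proof. by rewrite ltr_pwDl. Qed.

Lemma wt_gt0 x : 0 < wt x.
Proof. by rewrite invr_gt0 exprn_gt0// norm1_gt0. Qed.

Lemma wt_ge0 x : 0 <= wt x. Proof. exact/ltW/wt_gt0. Qed.

Lemma meas_normx : meas (fun x : E => `|x|).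
Proof. by apply: meas_continuous => x; exact: norm_continuous. Qed.

Lemma meas_wt : meas wt.
Proof.
pose h (r : R) := ((1 + `|r|) ^+ (2 * d))^-1.
rewrite (_ : wt = fun x => h `|x|); last first.
  by apply/funext => x; rewrite /h normr_id.
apply: meas_comp meas_normx; apply: continuous_measurable_fun => r.
apply: (@continuousV _ _ (fun x : R => (1 + `|x|) ^+ (2 * d)) r); first by rewrite gt_eqF// exprn_gt0// ltr_pwDl.
apply: (cvg_comp (fun x : R => 1 + `|x|) (fun y => y ^+ (2 * d))).
  by apply: cvgD; [exact: cvg_cst|exact: norm_continuous].
exact: exprn_continuous.
Qed.

Lemma integral_oneDsqrV :
  (\int[lebesgue_measure]_x ((oneDsqr x)^-1)%:E = (pi : R)%:E)%E.
Proof.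
rewrite ge0_symfun_integralT.
- rewrite (_ : [set x | 0 <= x] = `[0, +oo[%classic :> set R); last first.
    by apply/seteqP; split=> x /=; rewrite in_itv/= andbT.
  by rewrite integral0y_oneDsqr -EFinM; congr _%:E; field.
- by move=> x; rewrite invr_ge0 addr_ge0// sqr_ge0.
- exact: continuous_oneDsqrV.
- by move=> x; rewrite /oneDsqr /= sqrrN.
Qed.

Lemma prod_oneDsqr_summ :
  summ (fun x : E => \prod_(i < d) (oneDsqr (x ord0 i))^-1).
Proof.
have [|||h _] := @summ_prod (fun _ x => (oneDsqr x)^-1) (fun=> pi).
- by move=> i; apply: continuous_measurable_fun; exact: continuous_oneDsqrV.
- by move=> i x; rewrite invr_ge0 addr_ge0// sqr_ge0.
- by move=> i; exact: integral_oneDsqrV.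
- exact: h.
Qed.

(** In the maximum norm each of the [d] factors [(1 + |x|)^-2] is at most
[1 / (1 + x_i^2)], which reduces integrability to dimension one. *)
Lemma wt_le_prod x : wt x <= \prod_(i < d) (oneDsqr (x ord0 i))^-1.
Proof.
rewrite (_ : wt x = \prod_(i < d) ((1 + `|x|) ^+ 2)^-1); last first.
  by rewrite prodr_const card_ord /wt exprM exprVn.
apply: ler_prod => i _; have := coord_le_norm x i.
move: (x ord0 i) `|x| (norm1_gt0 x) => r n n0 rn.
rewrite invr_ge0 sqr_ge0/= lef_pV2 ?posrE ?exprn_gt0//.
rewrite /oneDsqr -(ger0_norm (sqr_ge0 r)) normrX.
by have := normr_ge0 r; nra.
Qed.

Lemma summ_wt : summ wt.
Proof.
apply: summ_le prod_oneDsqr_summ; first exact: meas_wt.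
by move=> x; rewrite ger0_norm ?wt_ge0// wt_le_prod.
Qed.

End Integrals.

(** * Differential calculus with partial derivatives *)

Section Calculus.
Context {R : realType} {d : nat}.
Local Notation E := 'rV[R]_d.
Implicit Types f g : E -> R.

Lemma is_derive_line f (x v : E) (t : R) : differentiable f (x + t *: v) ->
  is_derive t (1 : R) (fun t : R => f (x + t *: v)) ('D_v f (x + t *: v)).
Proof.
move=> df; have dv := diff_derivable (v := v) df.
pose g s := f (x + s *: v).
have e : (fun h => h^-1 *: ((g \o shift t) (h *: 1) - g t)) =
    (fun h => h^-1 *: ((f \o shift (x + t *: v)) (h *: v) - f (x + t *: v))).
  apply/funext => h; rewrite /g /=; congr (_ *: (f _ - _)).
  by rewrite [h *: 1]mulr1 scalerDl addrCA.
split; first by rewrite /derivable e.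
by rewrite /derive e.
Qed.

Lemma derive_sum_partial f (x v : E) : differentiable f x ->
  'D_v f x = \sum_(j < d) v ord0 j * partial j f x.
Proof.
move=> df; rewrite deriveE//.
rewrite {1}(row_sum_delta v) linear_sum /=; apply: eq_bigr => j _.
by rewrite linearZ /= /partial deriveE.
Qed.

Lemma mean_value f (x v : E) : (forall y, differentiable f y) ->
  exists2 s : R, 0 <= s <= 1 &
    f (x + v) - f x = \sum_(j < d) v ord0 j * partial j f (x + s *: v).
Proof.
move=> df.
have dl (t : R) : is_derive t (1 : R) (fun t : R => f (x + t *: v)) ('D_v f (x + t *: v)).
  exact: is_derive_line.
have [|s s01] := @MVT_segment R (fun t => f (x + t *: v))
    (fun t => 'D_v f (x + t *: v)) 0 1 ler01 (fun t _ => dl t).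
- apply: continuous_subspaceT => t.
  apply: differentiable_continuous; apply/derivable1_diffP.
  by have [] := dl t.
rewrite scale1r scale0r addr0 subr0 mulr1 => ->.
by exists s => //; rewrite derive_sum_partial.
Qed.

Definition lincomb (a : 'I_d -> R) (h : E) : R := \sum_j h ord0 j * a j.

Lemma lincomb_is_linear a : linear (lincomb a : E -> R^o).
Proof.
move=> k u v; rewrite /lincomb scaler_sumr -big_split /=; apply: eq_bigr => j _.
by rewrite !mxE mulrDl -mulrA.
Qed.

HB.instance Definition _ a :=
  GRing.isLinear.Build R E R^o *:%R (lincomb a) (lincomb_is_linear a).

Lemma continuous_lincomb a : continuous (lincomb a).
Proof.
apply: continuous_big => [|j _ x]; first exact: add_continuous.
apply: (@continuousM _ _ (fun h : E => h ord0 j) (fun=> a j)).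
  exact: coord_continuous.
exact: cst_continuous.
Qed.

(** A first order expansion with quadratic error gives differentiability
together with the partial derivatives; under an integral sign such an expansion is
obtained by integrating a pointwise one. *)
Lemma differentiable_quad f (x : E) (a : 'I_d -> R) C :
  (forall h, `|f (x + h) - f x - \sum_j h ord0 j * a j| <= C * `|h| ^+ 2) ->
  differentiable f x /\ forall j, partial j f x = a j.
Proof.
move=> fC.
have H : (f : E -> R^o) \o shift x =
    cst (f x : R^o) + (lincomb a : E -> R^o) +o_ (0 : E) id.
  apply/eqaddoP => _/posnumP[e].
  near=> h.
  rewrite /= opprD -![(_ + _ : _ -> _) _]/(_ + _) -![(- _ : _ -> _) _]/(- _) /=.
  rewrite addrA (addrC h).
  apply: le_trans (fC h) _.
  rewrite expr2 mulrA ler_wpM2r//.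
  have h1 : `|h| <= e%:num / (1 + `|C|).
    have e0 : 0 < e%:num / (1 + `|C|) by rewrite divr_gt0// ltr_pwDl.
    near: h; apply/nbhs_ballP; exists (e%:num / (1 + `|C|)) => //= h.
    by rewrite mx_norm_ball /ball_ /= sub0r normrN => /ltW.
  have C1 : C <= `|C| by exact: ler_norm.
  have : C * `|h| <= (1 + `|C|) * `|h|.
    by rewrite ler_wpM2r//; lra.
  move=> /le_trans; apply; rewrite mulrC -ler_pdivlMr// ltr_pwDl//.
have D := diff_unique (@continuous_lincomb a) H.
have df : differentiable f x.
  apply/diff_locallyP; split; first by rewrite D; exact: continuous_lincomb.
  by rewrite D.
split=> // j; rewrite /partial deriveE//.
transitivity (lincomb a (delta_mx ord0 j)); first by rewrite D.
rewrite /lincomb (bigD1 j)//= mxE !eqxx mul1r.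
rewrite big1 ?addr0// => i ij; rewrite mxE eqxx/= (negbTE ij) mul0r//.
Unshelve. all: by end_near. Qed.

End Calculus.

(** * Smooth functions of compact support *)

Section TestFun.
Context {R : realType} {d : nat}.
Local Notation E := 'rV[R]_d.
Implicit Types f g : E -> R.

Lemma partials_cons (s : seq 'I_d) j f :
  partials (j :: s) f = partial j (partials s f).
Proof. by []. Qed.

Lemma partials_rcons (s : seq 'I_d) j f :
  partials (rcons s j) f = partials s (partial j f).
Proof. by rewrite /partials foldr_rcons. Qed.

Lemma partialD j f g : (forall x, differentiable f x) ->
  (forall x, differentiable g x) ->
  partial j (fun x => f x + g x) = (fun x => partial j f x + partial j g x).
Proof.
move=> df dg; apply/funext => x; rewrite /partial.
exact: (@deriveD _ _ _ f g x _ (diff_derivable (df x)) (diff_derivable (dg x))).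
Qed.

Lemma partialM j f g : (forall x, differentiable f x) ->
  (forall x, differentiable g x) ->
  partial j (fun x => f x * g x) =
  (fun x => f x * partial j g x + g x * partial j f x).
Proof.
move=> df dg; apply/funext => x; rewrite /partial.
exact: (@deriveM _ _ f g x _ (diff_derivable (df x)) (diff_derivable (dg x))).
Qed.

Lemma partialZ j c f : (forall x, differentiable f x) ->
  partial j (fun x => c * f x) = (fun x => c * partial j f x).
Proof.
move=> df; apply/funext => x; rewrite /partial.
exact: (@deriveZ _ _ _ f c x _ (diff_derivable (df x))).
Qed.

Lemma differentiable_coordE j (x : E) : differentiable (fun x : E => x ord0 j) x.
Proof. exact: differentiable_coord. Qed.

Lemma partial_coord i j :
  partial i (fun x : E => x ord0 j) = (fun=> (i == j)%:R).
Proof.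
apply/funext => x.
have [|_] := @differentiable_quad R d (fun x : E => x ord0 j) x
  (fun i => (i == j)%:R) 0; last exact.
move=> h; rewrite mul0r mxE [x ord0 j + _]addrC addrK (bigD1 j)//= eqxx mulr1 big1 ?addr0.
  by rewrite subrr normr0.
by move=> k /negbTE ->; rewrite mulr0.
Qed.

Lemma differentiableDf f g x : differentiable f x -> differentiable g x ->
  differentiable (fun x : E => f x + g x) x.
Proof. by move=> df dg; exact: (differentiableD df dg). Qed.

Lemma differentiableMf f g x : differentiable f x -> differentiable g x ->
  differentiable (fun x : E => f x * g x) x.
Proof. by move=> df dg; exact: (differentiableM df dg). Qed.

Lemma differentiableZf c f x : differentiable f x ->
  differentiable (fun x : E => c * f x) x.
Proof. by move=> df; exact: (differentiableZ c df). Qed.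

Lemma partial_sumf (I : Type) (L : seq I) (F : I -> E -> R) j :
  (forall i x, differentiable (F i) x) ->
  (forall x, differentiable (fun x => \sum_(i <- L) F i x) x) /\
  partial j (fun x => \sum_(i <- L) F i x) =
  (fun x => \sum_(i <- L) partial j (F i) x).
Proof.
move=> dF; elim: L => [|i L [IH1 IH2]].
  have -> : (fun x : E => \sum_(i <- [::]) F i x) = cst 0.
    by apply/funext => x; rewrite big_nil.
  split; first by move=> x; exact: differentiable_cst.
  by apply/funext => x; rewrite big_nil /partial derive_cst.
have -> : (fun x => \sum_(k <- i :: L) F k x) =
          (fun x => F i x + \sum_(k <- L) F k x).
  by apply/funext => x; rewrite big_cons.
split; first by move=> x; exact: differentiableDf.
rewrite partialD//; apply/funext => x; rewrite big_cons; congr (_ + _).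
by rewrite -/(partial j _ x) IH2.
Qed.

Lemma smooth_continuous f : smooth f -> continuous f.
Proof. by move=> sf x; exact: differentiable_continuous (sf [::] x). Qed.

Lemma smooth_partial f j : smooth f -> smooth (partial j f).
Proof. by move=> sf s x; rewrite -partials_rcons; exact: sf. Qed.

Lemma partialsD f g s : smooth f -> smooth g ->
  partials s (fun x => f x + g x) = (fun x => partials s f x + partials s g x).
Proof.
move=> sf sg; elim: s => [//|i s IH].
by rewrite !partials_cons IH partialD.
Qed.

Lemma partialsZ f c s : smooth f ->
  partials s (fun x => c * f x) = (fun x => c * partials s f x).
Proof.
move=> sf; elim: s => [//|i s IH].
by rewrite !partials_cons IH partialZ.
Qed.

Lemma smoothD f g : smooth f -> smooth g -> smooth (fun x => f x + g x).
Proof.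
move=> sf sg s x; rewrite partialsD//.
by apply: differentiableDf; [exact: sf|exact: sg].
Qed.

Lemma smoothZ f c : smooth f -> smooth (fun x => c * f x).
Proof. by move=> sf s x; rewrite partialsZ//; apply: differentiableZf; exact: sf. Qed.

(** Leibniz rule in the only form that is needed: multiplying by a coordinate
and differentiating produces the expected term plus derivatives of [f] alone. *)
Lemma partials_coord f j s : smooth f -> exists L : seq (seq 'I_d),
  partials s (fun x => x ord0 j * f x) =
  (fun x => x ord0 j * partials s f x + \sum_(u <- L) partials u f x).
Proof.
move=> sf; elim: s => [|i s [L IH]].
  by exists [::]; apply/funext => x; rewrite big_nil addr0.
exists ((if i == j then [:: s] else [::]) ++ [seq i :: u | u <- L]).
rewrite !partials_cons IH.
have dL u x : differentiable (partials u f) x by exact: sf.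
have [dS pS] := @partial_sumf _ L (fun u => partials u f) i dL.
rewrite partialD//; last first.
  by move=> x; apply: differentiableMf => //; exact: differentiable_coordE.
rewrite pS partialM//; last by move=> x; exact: differentiable_coordE.
apply/funext => x; rewrite partial_coord big_cat /= big_map -!addrA.
congr (_ + (_ + _)).
by case: eqP => _; rewrite ?big_seq1 ?mulr1// big_nil mulr0.
Qed.

Lemma smooth_coordM f j : smooth f -> smooth (fun x => x ord0 j * f x).
Proof.
move=> sf s x; have [L ->] := partials_coord j s sf.
have [dS _] := @partial_sumf _ L (fun u => partials u f) j (fun u x => sf u x).
apply: differentiableDf => //; apply: differentiableMf => //.
exact: differentiable_coordE.
Qed.

Definition supported (r : R) f := forall x, r < `|x| -> f x = 0.

(** The generator of a dyadic resolution of unity has real and imaginary parts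
of this kind. *)
Definition testfun f := [/\ smooth f, exists r, supported r f &
  forall s, exists M, forall x, `|partials s f x| <= M].

Lemma supported_partial r f j : supported r f -> supported r (partial j f).
Proof.
move=> sf x rx; rewrite /partial -[RHS](derive_cst (0 : R) x (delta_mx ord0 j)).
apply: near_eq_derive.
apply/nbhs_ballP; exists (`|x| - r); first by rewrite /= subr_gt0.
move=> y; rewrite mx_norm_ball /ball_ /= => xy; apply: sf.
have := ler_distD y x 0; rewrite !subr0 => h.
by have := ler_normB x y; have := lerB_dist x y; lra.
Qed.

Lemma supported_partials r f s : supported r f -> supported r (partials s f).
Proof. by move=> sf; elim: s => //= i s IH; exact: supported_partial. Qed.

Lemma testfun_partial f j : testfun f -> testfun (partial j f).
Proof.
move=> [sf [r rf] bf]; split; first exact: smooth_partial.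
- by exists r; exact: supported_partial.
- by move=> s; have [M] := bf (rcons s j); rewrite partials_rcons; exists M.
Qed.

Lemma testfunZ f c : testfun f -> testfun (fun x => c * f x).
Proof.
move=> [sf [r rf] bf]; split; first exact: smoothZ.
- by exists r => x rx; rewrite rf// mulr0.
- move=> s; have [M bM] := bf s; exists (`|c| * M) => x.
  by rewrite partialsZ// normrM ler_wpM2l.
Qed.

Lemma testfun_coordM f j : testfun f -> testfun (fun x => x ord0 j * f x).
Proof.
move=> [sf [r rf] bf]; split; first exact: smooth_coordM.
- by exists r => x rx; rewrite rf// mulr0.
- move=> s; have [L ->] := partials_coord j s sf.
  have [M bM] : exists M, forall x, `|\sum_(u <- L) partials u f x| <= M.
    elim: L => [|u L [M IH]]; first by exists 0 => x; rewrite big_nil normr0.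
    have [N bN] := bf u; exists (N + M) => x; rewrite big_cons.
    by rewrite (le_trans (ler_normD _ _))// lerD.
  have [N bN] := bf s; exists (`|r| * N + M) => x.
  rewrite (le_trans (ler_normD _ _))// lerD// normrM.
  case: (ltP r `|x|) => rx.
    by rewrite (supported_partials s rf rx) normr0 mulr0 mulr_ge0// (le_trans _ (bN x)).
  rewrite ler_pM//; apply: le_trans (coord_le_norm x j) _.
  exact: le_trans rx (ler_norm r).
Qed.

Lemma testfun_meas f : testfun f -> meas f.
Proof. by move=> [sf _ _]; apply: meas_continuous; exact: smooth_continuous. Qed.

Lemma supported_le_wt (f : E -> R) r M : supported r f -> 0 <= M ->
  (forall x, `|f x| <= M) ->
  forall x, `|f x| <= M * (1 + `|r|) ^+ (2 * d) * wt x.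
Proof.
move=> sf M0 bf x; case: (ltP r `|x|) => rx.
  by rewrite sf// normr0 !mulr_ge0 ?exprn_ge0 ?wt_ge0// addr_ge0.
apply: le_trans (bf x) _; rewrite -mulrA ler_peMr//.
rewrite /wt -[leLHS](@mulVf _ ((1 + `|x|) ^+ (2 * d))); last first.
  by rewrite gt_eqF// exprn_gt0// norm1_gt0.
rewrite mulrC ler_wpM2r ?invr_ge0 ?exprn_ge0 ?addr_ge0//.
by rewrite lerXn2r ?nnegrE ?addr_ge0// lerD2l (le_trans rx)// ler_norm.
Qed.

Lemma supported_summ f r M : meas f -> supported r f ->
  (forall x, `|f x| <= M) -> summ f.
Proof.
move=> mf sf bf; have M0 : 0 <= M by exact: le_trans (bf 0).
apply: summ_le mf (supported_le_wt sf M0 bf) _.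
exact: summZ summ_wt.
Qed.

Lemma testfun_summ f : testfun f -> summ f.
Proof.
move=> tf; have mf := testfun_meas tf; case: tf => sf [r rf] bf.
by have [M bM] := bf [::]; exact: supported_summ mf rf bM.
Qed.

End TestFun.

(** * The Fourier transform of a test function is a Schwartz function *)

Section Trig.
Context {R : realType}.

Lemma mvt_line (g dg : R -> R) (a b : R) :
  (forall x : R, is_derive x (1 : R) g (dg x)) ->
  exists2 c, `|c - a| <= `|b| & g (a + b) - g a = dg c * b.
Proof.
move=> dg'.
have cg : continuous g.
  move=> x; apply: differentiable_continuous; apply/derivable1_diffP.
  by have [] := dg' x.
have [b0|b0] := leP 0 b.
  have ab : a <= a + b by rewrite lerDl.
  have [c] := MVT_segment ab (fun x _ => dg' x) (continuous_subspaceT cg).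
  rewrite in_itv /= => /andP[ac cab] E; exists c.
    by rewrite !ger0_norm ?subr_ge0// lerBlDl.
  by rewrite E addrC addKr.
have ab : a + b <= a by rewrite gerDl ltW.
have [c] := MVT_segment ab (fun x _ => dg' x) (continuous_subspaceT cg).
rewrite in_itv /= => /andP[ac cab] E; exists c.
  by rewrite ler0_norm ?subr_le0// ltr0_norm//; lra.
by apply: oppr_inj; rewrite opprB E; ring.
Qed.

Lemma sin_lip (a b : R) : `|sin (a + b) - sin a| <= `|b|.
Proof.
have [c _ ->] := @mvt_line sin cos a b (fun x => is_derive_sin x).
by rewrite normrM ler_piMl// ler_norml cos_geN1 cos_le1.
Qed.

Lemma cos_lip (a b : R) : `|cos (a + b) - cos a| <= `|b|.
Proof.
have [c _ ->] := @mvt_line cos (fun x => - sin x) a b (fun x => is_derive_cos x).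
by rewrite normrM ler_piMl// normrN ler_norml sin_geN1 sin_le1.
Qed.

Lemma sin_taylor (a b : R) : `|sin (a + b) - sin a - b * cos a| <= b ^+ 2.
Proof.
have [c cb ->] := @mvt_line sin cos a b (fun x => is_derive_sin x).
rewrite [_ * b]mulrC -mulrBr normrM -(ger0_norm (sqr_ge0 b)) normrX expr2.
rewrite ler_wpM2l//; have := cos_lip a (c - a); rewrite [a + _]addrC subrK.
by move=> /le_trans; exact.
Qed.

Lemma cos_taylor (a b : R) : `|cos (a + b) - cos a + b * sin a| <= b ^+ 2.
Proof.
have [c cb ->] := @mvt_line cos (fun x => - sin x) a b (fun x => is_derive_cos x).
rewrite mulNr [_ * b]mulrC addrC -mulrBr normrM.
rewrite -(ger0_norm (sqr_ge0 b)) normrX expr2.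
rewrite ler_wpM2l// distrC; have := sin_lip a (c - a).
by rewrite [a + _]addrC subrK => /le_trans; exact.
Qed.

Lemma norm_cos_le1 (x : R) : `|cos x| <= 1.
Proof. by rewrite ler_norml cos_geN1 cos_le1. Qed.

Lemma norm_sin_le1 (x : R) : `|sin x| <= 1.
Proof. by rewrite ler_norml sin_geN1 sin_le1. Qed.
End Trig.

Section Transform.
Context {R : realType} {d : nat}.
Local Notation E := 'rV[R]_d.
Implicit Types f g : E -> R.

Definition phase (x xi : E) : R := 2 * pi * dot x xi.

(** The real part of an inverse Fourier transform, for a density with real part [f]
and imaginary part [- g].  Working with pairs of real functions avoids complex
calculus: the class of these functions is closed under derivatives and under
multiplication by coordinates. *)
Definition trig f g (x : E) : R :=
  rint (fun xi => f xi * cos (phase x xi) + g xi * sin (phase x xi)).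

Lemma dotDl (x y z : E) : dot (x + y) z = dot x z + dot y z.
Proof.
by rewrite /dot -big_split; apply: eq_bigr => i _; rewrite mxE mulrDl.
Qed.

Lemma dotC (x y : E) : dot x y = dot y x.
Proof. by apply: eq_bigr => i _; rewrite mulrC. Qed.

Lemma dotDr (x y z : E) : dot z (x + y) = dot z x + dot z y.
Proof. by rewrite dotC dotDl !(dotC z). Qed.

Lemma dotZr (x y : E) a : dot x (a *: y) = a * dot x y.
Proof. by rewrite /dot mulr_sumr; apply: eq_bigr => i _; rewrite mxE mulrCA. Qed.

Lemma dot_delta (x : E) j : dot x (delta_mx ord0 j) = x ord0 j.
Proof.
rewrite /dot (bigD1 j)//= mxE !eqxx mulr1 big1 ?addr0// => i ij.
by rewrite mxE eqxx (negbTE ij) mulr0.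
Qed.

Lemma norm_dot (x y : E) : `|dot x y| <= d%:R * (`|x| * `|y|).
Proof.
apply: le_trans (ler_norm_sum _ _ _) _.
have -> : d%:R * (`|x| * `|y|) = \sum_(i < d) `|x| * `|y|.
  by rewrite sumr_const card_ord mulr_natl.
by apply: ler_sum => i _; rewrite normrM ler_pM// coord_le_norm.
Qed.

Lemma continuous_dot (x : E) : continuous (dot x).
Proof.
apply: continuous_big => [|j _ y]; first exact: add_continuous.
apply: (@continuousM _ _ (fun=> x ord0 j) (fun h : E => h ord0 j)).
  exact: cst_continuous.
exact: coord_continuous.
Qed.

Lemma meas_phase x : meas (phase x).
Proof. by apply: measM; [exact: meas_cst|apply: meas_continuous; exact: continuous_dot]. Qed.

Lemma meas_cos x : meas (fun xi => cos (phase x xi)).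
Proof.
apply: meas_comp (meas_phase x); apply: continuous_measurable_fun.
exact: continuous_cos.
Qed.

Lemma meas_sin x : meas (fun xi => sin (phase x xi)).
Proof.
apply: meas_comp (meas_phase x); apply: continuous_measurable_fun.
exact: continuous_sin.
Qed.

Lemma summ_cos f x : summ f -> summ (fun xi => f xi * cos (phase x xi)).
Proof.
move=> sf; have := summM (meas_cos x) (fun xi => norm_cos_le1 _) sf.
by congr summ; apply/funext => xi; rewrite mulrC.
Qed.

Lemma summ_sin f x : summ f -> summ (fun xi => f xi * sin (phase x xi)).
Proof.
move=> sf; have := summM (meas_sin x) (fun xi => norm_sin_le1 _) sf.
by congr summ; apply/funext => xi; rewrite mulrC.
Qed.

Lemma trig_bound f g x : summ f -> summ g ->
  `|trig f g x| <= rint (fun xi => `|f xi| + `|g xi|).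
Proof.
move=> sf sg; apply: rint_bound.
- by apply: summ_meas; apply: summD; [exact: summ_cos|exact: summ_sin].
- by apply: summD; exact: summ_norm.
- move=> xi; rewrite (le_trans (ler_normD _ _))// lerD// normrM ler_piMr//.
    exact: norm_cos_le1.
  exact: norm_sin_le1.
Qed.

Lemma rint_sum (I : Type) (r : seq I) (F : I -> E -> R) :
  (forall i, summ (F i)) ->
  rint (fun x => \sum_(i <- r) F i x) = \sum_(i <- r) rint (F i).
Proof.
move=> sF; elim: r => [|i r IH].
  by rewrite big_nil -[RHS](@rint0 R d); apply: eq_rint => x; rewrite big_nil.
rewrite big_cons -IH -rintD//; last exact: summ_sum.
by apply: eq_rint => x; rewrite big_cons.
Qed.

(** Differentiation under the integral sign, from second order Taylor bounds for
sine and cosine on the support of [f] and [g]. *)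
Lemma trig_diff f g x : testfun f -> testfun g ->
  differentiable (trig f g) x /\ forall j, partial j (trig f g) x =
    trig (fun xi => 2 * pi * (xi ord0 j * g xi))
         (fun xi => (- (2 * pi)) * (xi ord0 j * f xi)) x.
Proof.
move=> tf tg.
have [sf sg] := (testfun_summ tf, testfun_summ tg).
have tcf j := testfunZ (- (2 * pi)) (testfun_coordM j tf).
have tcg j := testfunZ (2 * pi) (testfun_coordM j tg).
have scf j := testfun_summ (tcf j); have scg j := testfun_summ (tcg j).
have [_ [rf supf] bf] := tf; have [_ [rg supg] bg] := tg.
have [Mf bMf] := bf [::]; have [Mg bMg] := bg [::].
pose G xi := `|f xi| + `|g xi|.
pose r := Num.max `|rf| `|rg|.
have sG : summ G by apply: summD; exact: summ_norm.
pose B := 2 * pi * (d%:R * r).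
have sG2 : summ (fun xi => B ^+ 2 * G xi) by exact: summZ.
apply: (@differentiable_quad R d _ x _ (rint (fun xi => B ^+ 2 * G xi))) => h.
under eq_bigr => j _.
  rewrite -rintZ; last by apply: summD; [exact: summ_cos|exact: summ_sin].
  over.
rewrite -rint_sum; last first.
  by move=> j; apply: summZ; apply: summD; [exact: summ_cos|exact: summ_sin].
have sfg y : summ (fun xi => f xi * cos (phase y xi) + g xi * sin (phase y xi)).
  by apply: summD; [exact: summ_cos|exact: summ_sin].
have sD : summ (fun xi => \sum_j h ord0 j *
     (2 * pi * (xi ord0 j * g xi) * cos (phase x xi) +
      (- (2 * pi)) * (xi ord0 j * f xi) * sin (phase x xi))).
  apply: summ_sum => j; apply: summZ.
  by apply: summD; [exact: (summ_cos _ (scg j))|exact: (summ_sin _ (scf j))].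
rewrite -rintB// -rintB//; last exact: summB.
rewrite [leRHS]mulrC -rintZ//.
apply: rint_bound.
- by apply: measB; [apply: measB; exact: summ_meas|exact: summ_meas].
- exact: summZ.
move=> xi.
set a := phase x xi; pose b := phase h xi.
have phE : phase (x + h) xi = a + b by rewrite /phase dotDl mulrDr.
have bE : \sum_j h ord0 j * (2 * pi * (xi ord0 j * g xi) * cos a +
      (- (2 * pi)) * (xi ord0 j * f xi) * sin a) =
    b * (g xi * cos a - f xi * sin a).
  rewrite /b /phase /dot mulr_sumr mulr_suml; apply: eq_bigr => j _; ring.
rewrite bE phE.
have -> : f xi * cos (a + b) + g xi * sin (a + b) -
    (f xi * cos a + g xi * sin a) - b * (g xi * cos a - f xi * sin a) =
    f xi * (cos (a + b) - cos a + b * sin a) +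
    g xi * (sin (a + b) - sin a - b * cos a) by ring.
have le1 : `|f xi * (cos (a + b) - cos a + b * sin a) +
    g xi * (sin (a + b) - sin a - b * cos a)| <= b ^+ 2 * G xi.
  apply: le_trans (ler_normD _ _) _; rewrite !normrM /G mulrDr.
  rewrite ![b ^+ 2 * _]mulrC.
  by rewrite lerD// ler_wpM2l//; [exact: cos_taylor|exact: sin_taylor].
apply: le_trans le1 _.
have [->|G0] := eqVneq (G xi) 0; first by rewrite !mulr0.
have xir : `|xi| <= r.
  rewrite leNgt; apply: contra_neqN G0; rewrite /r gt_max => /andP[h1 h2].
  rewrite /G supf ?supg ?normr0 ?addr0//.
    exact: le_lt_trans (ler_norm _) h2.
  exact: le_lt_trans (ler_norm _) h1.
rewrite mulrA ler_wpM2r ?addr_ge0// -exprMn -ler_sqrt ?sqr_ge0//.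
rewrite !sqrtr_sqr [X in _ <= X]ger0_norm; last first.
  by rewrite !mulr_ge0// ?pi_ge0// le_max normr_ge0.
rewrite /b /phase normrM ger0_norm ?mulr_ge0 ?pi_ge0//.
rewrite /B mulrCA ler_wpM2l ?mulr_ge0 ?pi_ge0//.
apply: le_trans (norm_dot h xi) _.
by rewrite mulrCA ler_wpM2l// ler_wpM2l.
Qed.

End Transform.

Section Decay.
Context {R : realType} {d : nat}.
Local Notation E := 'rV[R]_d.
Implicit Types f g : E -> R.

Lemma rint_shift f (v : E) : summ f -> rint (fun x => f (x + v)) = rint f.
Proof.
move=> sf; rewrite (rint_affine (a := 1) v (oner_neq0 R) sf).
by rewrite normr1 expr1n mul1r; apply: eq_rint => x; rewrite scale1r.
Qed.

Lemma summ_shift f (v : E) : summ f -> summ (fun x => f (x + v)).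
Proof.
move=> sf; have := summ_affine v (oner_neq0 R) sf.
by congr summ; apply/funext => x; rewrite scale1r.
Qed.

Lemma norm_delta_le1 (j : 'I_d) : `|delta_mx ord0 j : E| <= 1.
Proof.
apply: norm_le_row => // i; rewrite mxE eqxx /=.
by case: eqP => _; rewrite ?normr1 ?normr0.
Qed.

(** The integral of a derivative vanishes: [int (F(xi + t v) - F(xi)) = 0] by
translation invariance, and the difference quotients converge to [F'] uniformly
on a common compact support. *)
Lemma rint_derivative0 (F F' : E -> R) (v : E) r C :
  summ F -> summ F' -> supported r F -> supported r F' -> `|v| <= 1 ->
  (forall xi t, 0 < t <= 1 -> `|F (xi + t *: v) - F xi - t * F' xi| <= C * t ^+ 2) ->
  rint F' = 0.
Proof.
move=> sF sF' rF rF' v1 FC.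
have C0 : 0 <= C.
  have := FC 0 1; rewrite ltr01 lexx expr1n mulr1 => /(_ isT).
  exact: le_trans.
(* the expansion is supported in the ball of radius |r| + 1, as |t v| <= 1 *)
pose K := C * (1 + `|(`|r| + 1)|) ^+ (2 * d) * rint (@wt R d).
have H (t : R) : 0 < t <= 1 -> t * `|rint F'| <= t ^+ 2 * K.
  move=> t01; have /andP[t0 t1] := t01.
  have E1 : t * rint F' = - rint (fun xi => F (xi + t *: v) - F xi - t * F' xi).
    rewrite rintB ?rintB//; [|exact: summ_shift|apply: summB => //; exact: summ_shift|exact: summZ].
    by rewrite rint_shift// subrr sub0r opprK rintZ.
  rewrite -[X in X * `|_|](gtr0_norm t0) -normrM E1 normrN /K.
  rewrite mulrA -rintZ; last exact: summ_wt.
  apply: rint_bound.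
  - apply: summ_meas; apply: summB; last exact: summZ.
    by apply: summB => //; exact: summ_shift.
  - by apply: summZ; exact: summ_wt.
  - move=> x; rewrite mulrA [t ^+ 2 * C]mulrC.
    apply: (supported_le_wt (f := fun xi => F (xi + t *: v) - F xi - t * F' xi)).
    + move=> y ry; have ry' : r < `|y|.
        by apply: lt_trans ry; have := ler_norm r; lra.
      rewrite (rF y)// (rF' y)// rF ?mulr0 ?subrr ?subr0//.
      have := lerB_dist y (- (t *: v)); rewrite opprK normrN normrZ gtr0_norm//.
      have : t * `|v| <= 1 by rewrite mulr_ile1// ltW.
      by have := ler_norm r; lra.
    + by rewrite mulr_ge0// sqr_ge0.
    + by move=> xi; exact: FC.
apply/eqP; rewrite -normr_eq0 eq_le normr_ge0 andbT.
apply/ler_addgt0Pl => e e0; rewrite addr0.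
pose t := Num.min 1 (e / (1 + `|K|)).
have p : 0 < 1 + `|K| by rewrite ltr_pwDl.
have t0 : 0 < t by rewrite lt_min ltr01 divr_gt0.
have t1 : t <= 1 by rewrite ge_min lexx.
have te : t <= e / (1 + `|K|) by rewrite ge_min lexx orbT.
have := H t; rewrite t0 t1 => /(_ isT); rewrite expr2 -mulrA ler_pM2l// => h.
apply: le_trans h _; apply: (@le_trans _ _ (t * (1 + `|K|))).
  by rewrite ler_wpM2l ?(ltW t0)//; have := ler_norm K; lra.
by rewrite -ler_pdivlMr.
Qed.

Lemma sum_delta (t : R) j (G : 'I_d -> R) :
  \sum_i (t *: delta_mx ord0 j : E) ord0 i * G i = t * G j.
Proof.
rewrite (bigD1 j)//= !mxE !eqxx mulr1 big1 ?addr0// => i ij.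
by rewrite !mxE eqxx (negbTE ij) mulr0 mul0r.
Qed.

Lemma partial_lip f j : testfun f -> exists2 C, 0 <= C &
  forall xi t, `|f (xi + t *: delta_mx ord0 j) - f xi - t * partial j f xi|
    <= C * t ^+ 2.
Proof.
move=> tf; have [sf _ bf] := tf; have [M bM] := bf [:: j; j].
exists `|M| => // xi t.
have [s s01 ->] := @mean_value R d f xi (t *: delta_mx ord0 j) (sf [::]).
rewrite sum_delta -mulrBr normrM.
have [s' s01' E'] := @mean_value R d (partial j f) xi
  (s *: (t *: delta_mx ord0 j)) (sf [:: j]).
rewrite E' scalerA sum_delta !normrM -(ger0_norm (sqr_ge0 t)) normrX.
have /andP[s0 s1] := s01; rewrite (ger0_norm s0).
set X := partial j (partial j f) _.
have qM : `|X| <= `|M| by apply: le_trans (bM _) (ler_norm _).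
have := normr_ge0 X; move: `|X| qM => q qM q0.
have t0 := normr_ge0 t; move: `|t| t0 => a a0.
rewrite [leLHS](_ : _ = (s * q) * a ^+ 2); last by ring.
rewrite ler_wpM2r ?sqr_ge0//; apply: le_trans qM.
by rewrite ler_piMl.
Qed.

Lemma testfun_bounded f : testfun f -> exists2 M, 0 <= M & forall x, `|f x| <= M.
Proof.
move=> [_ _ bf]; have [M bM] := bf [::]; exists M => //.
exact: le_trans (bM 0).
Qed.

(** Integration by parts, as the vanishing of the integral of the derivative of
[f w]; the product expansion is quadratic because those of [f] and [w] are. *)
Lemma rint_ibp f (w w' : E -> R) j C : testfun f -> meas w -> meas w' ->
  (forall xi, `|w xi| <= 1) -> (forall xi, `|w' xi| <= C) ->
  (forall xi t, `|w (xi + t *: delta_mx ord0 j) - w xi - t * w' xi| <= C ^+ 2 * t ^+ 2) ->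
  rint (fun xi => partial j f xi * w xi + f xi * w' xi) = 0.
Proof.
move=> tf mw mw' bw bw' Cw.
have C0 : 0 <= C by exact: le_trans (bw' 0).
have [C1 C10 hC1] := partial_lip j tf.
have [M M0 bM] := testfun_bounded tf.
have [M' M'0 bM'] := testfun_bounded (testfun_partial j tf).
have [sf [r rf] _] := tf.
have smf := testfun_summ tf; have smf' := testfun_summ (testfun_partial j tf).
have s1 : summ (fun xi => f xi * w xi).
  by have := summM mw bw smf; congr summ; apply/funext => x; rewrite mulrC.
have s2 : summ (fun xi => partial j f xi * w xi).
  by have := summM mw bw smf'; congr summ; apply/funext => x; rewrite mulrC.
have s3 : summ (fun xi => f xi * w' xi).
  by have := summM mw' bw' smf; congr summ; apply/funext => x; rewrite mulrC.
apply: (@rint_derivative0 (fun xi => f xi * w xi) _ (delta_mx ord0 j) r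
   (C1 + (M' * (C + C ^+ 2) + M * C ^+ 2))) => //.
- exact: summD.
- by move=> x rx; rewrite rf// mul0r.
- by move=> x rx; rewrite rf// (supported_partial j rf)// !mul0r addr0.
- exact: norm_delta_le1.
move=> xi t /andP[t0 t1]; set y := xi + _.
have e1 := hC1 xi t; have e2 := Cw xi t; rewrite -/y in e1 e2.
have -> : f y * w y - f xi * w xi - t * (partial j f xi * w xi + f xi * w' xi) =
   (f y - f xi - t * partial j f xi) * w y + (t * partial j f xi) *
     ((w y - w xi - t * w' xi) + t * w' xi) + f xi * (w y - w xi - t * w' xi) by ring.
set A := f y - _ - _ in e1 *; set B := w y - _ - _ in e2 *.
have b1 : `|A * w y| <= C1 * t ^+ 2.
  by rewrite normrM; apply: le_trans e1; rewrite ler_piMr.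
have b2 : `|B + t * w' xi| <= (C + C ^+ 2) * t.
  have b21 : `|B| <= C ^+ 2 * t.
    by apply: le_trans e2 _; rewrite ler_wpM2l ?sqr_ge0// expr2 ler_piMr// ltW.
  have b22 : `|t * w' xi| <= C * t.
    by rewrite normrM gtr0_norm// mulrC ler_wpM2r// ltW.
  by have := ler_normD B (t * w' xi); lra.
have b3 : `|t * partial j f xi * (B + t * w' xi)| <= M' * (C + C ^+ 2) * t ^+ 2.
  rewrite normrM [leRHS](_ : _ = (t * M') * ((C + C ^+ 2) * t)); last by ring.
  by rewrite ler_pM// normrM gtr0_norm// ler_wpM2l// ltW.
have b4 : `|f xi * B| <= M * C ^+ 2 * t ^+ 2.
  by rewrite normrM -mulrA ler_pM.
have := ler_normD (A * w y + t * partial j f xi * (B + t * w' xi)) (f xi * B).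
have := ler_normD (A * w y) (t * partial j f xi * (B + t * w' xi)).
lra.
Qed.

Lemma phase_shift (x xi : E) t j :
  phase x (xi + t *: delta_mx ord0 j) = phase x xi + t * (2 * pi * x ord0 j).
Proof. by rewrite /phase dotDr dotZr dot_delta; ring. Qed.

(** Integration by parts against sine and cosine: multiplication by a coordinate
on one side is differentiation on the other. *)
Lemma trig_coordM f g (x : E) j : testfun f -> testfun g ->
  x ord0 j * trig f g x =
  trig (fun xi => (2 * pi)^-1 * partial j g xi)
       (fun xi => (- (2 * pi)^-1) * partial j f xi) x.
Proof.
move=> tf tg; pose b := 2 * pi * x ord0 j.
have pi0 : (2 * pi : R) != 0 by rewrite mulf_neq0 ?pnatr_eq0// gt_eqF// pi_gt0.
have [sf sg] := (testfun_summ tf, testfun_summ tg).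
have [sf' sg'] := (testfun_summ (testfun_partial j tf), testfun_summ (testfun_partial j tg)).
have b2 t (a : R) : 0 <= a -> a <= (t * b) ^+ 2 -> a <= `|b| ^+ 2 * t ^+ 2.
  by move=> a0; rewrite real_normK ?num_real// exprMn mulrC.
have m1 : meas (fun xi => b * cos (phase x xi)).
  by apply: measM; [exact: meas_cst|exact: meas_cos].
have m2 : meas (fun xi => - b * sin (phase x xi)).
  by apply: measM; [exact: meas_cst|exact: meas_sin].
have I1 := @rint_ibp f (fun xi => sin (phase x xi)) (fun xi => b * cos (phase x xi))
   j `|b| tf (meas_sin x) m1.
have I2 := @rint_ibp g (fun xi => cos (phase x xi)) (fun xi => - b * sin (phase x xi))
   j `|b| tg (meas_cos x) m2.
rewrite /trig -rintZ; last by apply: summD; [exact: summ_cos|exact: summ_sin].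
apply/eqP; rewrite -subr_eq0 -rintB; last 2 first.
- by apply: summZ; apply: summD; [exact: summ_cos|exact: summ_sin].
- apply: summD; [apply: summ_cos|apply: summ_sin]; exact: summZ.
have -> : 0 = (2 * pi)^-1 * 0 + (- (2 * pi)^-1) * 0 :> R by ring.
rewrite -{1}I1; last 3 first.
- by move=> xi; exact: norm_sin_le1.
- by move=> xi; rewrite normrM ler_piMr// norm_cos_le1.
- move=> xi t; rewrite phase_shift -/b.
  by apply: b2 => //; rewrite [t * (b * _)]mulrA; exact: sin_taylor.
rewrite -{1}I2; last 3 first.
- by move=> xi; exact: norm_cos_le1.
- by move=> xi; rewrite normrM normrN ler_piMr// norm_sin_le1.
- move=> xi t; rewrite phase_shift -/b mulNr mulrN opprK.
  by apply: b2 => //; rewrite [t * (b * _)]mulrA; exact: cos_taylor.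
have sA : summ (fun xi => partial j f xi * sin (phase x xi) +
    f xi * (b * cos (phase x xi))).
  apply: summD; first exact: summ_sin.
  have := summZ b (summ_cos x sf); congr summ; apply/funext => xi; ring.
have sB : summ (fun xi => partial j g xi * cos (phase x xi) +
    g xi * (- b * sin (phase x xi))).
  apply: summD; first exact: summ_cos.
  have := summZ (- b) (summ_sin x sg); congr summ; apply/funext => xi; ring.
rewrite -!rintZ// -rintD; [|exact: summZ..].
apply/eqP; apply: eq_rint => xi; rewrite /b.
move: (phase x xi) (2 * pi) pi0 => a q q0; field.
exact: q0.
Qed.

Definition transformed (F : E -> R) :=
  exists f g, [/\ testfun f, testfun g & F = trig f g].

Lemma transformed_partial F j : transformed F -> transformed (partial j F).
Proof.
move=> [f [g [tf tg ->]]].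
exists (fun xi : E => 2 * pi * (xi ord0 j * g xi)),
       (fun xi : E => (- (2 * pi)) * (xi ord0 j * f xi)); split.
- by apply: testfunZ; exact: testfun_coordM.
- by apply: testfunZ; exact: testfun_coordM.
- by apply/funext => x; have [_ ->] := trig_diff x tf tg.
Qed.

Lemma transformed_coordM F j : transformed F ->
  transformed (fun x => x ord0 j * F x).
Proof.
move=> [f [g [tf tg ->]]].
exists (fun xi : E => (2 * pi)^-1 * partial j g xi),
       (fun xi : E => (- (2 * pi)^-1) * partial j f xi); split.
- by apply: testfunZ; exact: testfun_partial.
- by apply: testfunZ; exact: testfun_partial.
- by apply/funext => x; exact: trig_coordM.
Qed.

Lemma transformed_partials F s : transformed F -> transformed (partials s F).
Proof. by move=> tF; elim: s => //= j s IH; exact: transformed_partial. Qed.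

Lemma transformed_bounded F : transformed F -> exists M, forall x, `|F x| <= M.
Proof.
move=> [f [g [tf tg ->]]]; exists (rint (fun xi => `|f xi| + `|g xi|)) => x.
exact: trig_bound (testfun_summ tf) (testfun_summ tg).
Qed.

Lemma transformed_smooth F : transformed F -> smooth F.
Proof.
move=> tF s x; have [f [g [tf tg ->]]] := transformed_partials s tF.
by have [] := trig_diff x tf tg.
Qed.

Lemma norm_coord (x : E) : `|x| = 0 \/ exists j, `|x| = `|x ord0 j|.
Proof.
have [->|x0] := eqVneq x 0; first by left; rewrite normr0.
right; have [|[i j] /= h] := @mx_norm_neq0 R 1 d x; last by exists j; rewrite ord1 in h.
by apply/eqP => /mx_norm_eq0 x00; rewrite x00 eqxx in x0.
Qed.

Lemma transformed_coordX F j N : transformed F ->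
  transformed (fun x => x ord0 j ^+ N * F x).
Proof.
move=> tF; elim: N => [|N IH].
  by rewrite (_ : (fun x => _) = F)//; apply/funext => x; rewrite mul1r.
have := transformed_coordM j IH; congr transformed.
by apply/funext => x; rewrite exprS mulrA.
Qed.

(** Both operations stay inside a class of bounded functions, so all
[x_j^N D^s F] are bounded. *)
Lemma transformed_decay F N s : transformed F ->
  exists M, forall x, (1 + `|x|) ^+ N * `|partials s F x| <= M.
Proof.
move=> /(transformed_partials s); move: (partials s F) => {}F tF.
have [M0 bM0] := transformed_bounded tF.
have /choice[M bM] : forall j : 'I_d,
    exists M : R, forall x : E, `|x ord0 j ^+ N * F x| <= M.
  by move=> j; apply: transformed_bounded; exact: transformed_coordX.
have Mp j : 0 <= M j by apply: le_trans (bM j 0).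
exists (2 ^+ N * (M0 + \sum_j M j)) => x.
have M00 : 0 <= M0 by apply: le_trans (bM0 0).
have SM0 : 0 <= \sum_j M j by apply: sumr_ge0.
have [x1|x1] := leP `|x| 1.
  rewrite ler_pM// ?exprn_ge0//.
    by rewrite lerXn2r ?nnegrE ?addr_ge0//; lra.
  by apply: le_trans (bM0 x) _; rewrite lerDl.
have [x0|[j xj]] := norm_coord x; first by rewrite x0 ltr10 in x1.
apply: (@le_trans _ _ ((2 * `|x|) ^+ N * `|F x|)).
  by rewrite ler_wpM2r// lerXn2r ?nnegrE ?addr_ge0 ?mulr_ge0//; lra.
rewrite exprMn -mulrA ler_wpM2l ?exprn_ge0//.
rewrite xj -normrX -normrM; apply: le_trans (bM j x) _.
by rewrite (bigD1 j)//= addrCA lerDl addr_ge0// sumr_ge0.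
Qed.

End Decay.

(** * Real-valued Schwartz functions *)

Section Rapid.
Context {R : realType} {d : nat}.
Local Notation E := 'rV[R]_d.
Implicit Types F G : E -> R.

Definition rapid F := smooth F /\
  forall N s, exists M, forall x, (1 + `|x|) ^+ N * `|partials s F x| <= M.

Lemma transformed_rapid F : transformed F -> rapid F.
Proof.
move=> tF; split; first exact: transformed_smooth.
by move=> N s; exact: transformed_decay.
Qed.

Lemma rapidD F G : rapid F -> rapid G -> rapid (fun x => F x + G x).
Proof.
move=> [sF bF] [sG bG]; split; first exact: smoothD.
move=> N s; have [M bM] := bF N s; have [M' bM'] := bG N s.
exists (M + M') => x; rewrite partialsD//.
apply: le_trans (lerD (bM x) (bM' x)); rewrite -mulrDr ler_wpM2l ?exprn_ge0//.
exact: ler_normD.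
Qed.

Lemma rapidZ F c : rapid F -> rapid (fun x => c * F x).
Proof.
move=> [sF bF]; split; first exact: smoothZ.
move=> N s; have [M bM] := bF N s.
exists (`|c| * M) => x; rewrite partialsZ// normrM mulrCA ler_wpM2l//.
Qed.

Lemma rapidB F G : rapid F -> rapid G -> rapid (fun x => F x - G x).
Proof.
move=> rF /(rapidZ (-1)) /(rapidD rF); congr rapid.
by apply/funext => x; rewrite mulN1r.
Qed.

Lemma partial_affine F a (b : E) j : (forall x, differentiable F x) ->
  (forall y, differentiable (fun y => F (a *: y + b)) y) /\
  partial j (fun y => F (a *: y + b)) = (fun y => a * partial j F (a *: y + b)).
Proof.
move=> dF.
have dA (y : E) : is_diff y (fun y => a *: y + b) ( *:%R a).
  have h1 := is_diff_scaler a y.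
  have := is_diffD h1 (is_diff_cst b y); rewrite addr0; exact.
have dC y : differentiable (fun y => F (a *: y + b)) y.
  by apply: (@differentiable_comp _ _ _ _ (fun y => a *: y + b) F).
split => //; apply/funext => y; rewrite /partial.
set v := delta_mx _ _.
transitivity ('D_(a *: v) F (a *: y + b)); last by rewrite !deriveE// linearZ.
pose G z := F (a *: z + b).
have e : (fun h : R => h^-1 *: ((G \o shift y) (h *: v) - G y)) =
    (fun h => h^-1 *: ((F \o shift (a *: y + b)) (h *: (a *: v)) - F (a *: y + b))).
  apply/funext => h; rewrite /G /=; congr (_ *: (F _ - _)).
  by rewrite scalerDr -addrA !scalerA [a * h]mulrC.
by rewrite /derive -/G e.
Qed.

Lemma partials_affine F a (b : E) s : smooth F ->
  partials s (fun y => F (a *: y + b)) =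
  (fun y => a ^+ size s * partials s F (a *: y + b)).
Proof.
move=> sF; elim: s => [|j s IH]; first by apply/funext => y; rewrite mul1r.
rewrite !partials_cons IH.
have [dA pA] := @partial_affine (partials s F) a b j (sF s).
by rewrite partialZ// pA; apply/funext => y; rewrite mulrA exprSr.
Qed.

Lemma smooth_affine F a (b : E) : smooth F -> smooth (fun y => F (a *: y + b)).
Proof.
case: (pselect (exists j : 'I_d, True)) => [[j _]|nj] sF s y.
  rewrite partials_affine//; apply: differentiableZf.
  by have [dA _] := @partial_affine (partials s F) a b j (sF s).
case: s => [|j]; last by case: nj; exists j.
have y0 z : z = y by apply/rowP => j; case: nj; exists j.
rewrite (_ : partials [::] _ = cst (F y)); first exact: differentiable_cst.
by apply/funext => z; congr F; exact: y0.
Qed.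

Lemma rapid_affine F a (b : E) : a != 0 -> rapid F ->
  rapid (fun y => F (a *: y + b)).
Proof.
move=> a0 [sF bF]; split; first exact: smooth_affine.
move=> N s; have [M bM] := bF N s.
have M0 : 0 <= M.
  by apply: le_trans (bM 0); rewrite mulr_ge0// exprn_ge0// addr_ge0.
pose c := 1 + `|a|^-1 * (1 + `|b|).
have c0 : 0 <= c by rewrite addr_ge0// mulr_ge0 ?invr_ge0// addr_ge0.
exists (c ^+ N * `|a| ^+ size s * M) => y.
rewrite partials_affine// normrM normrX mulrCA.
rewrite -[leRHS]mulrA [leRHS]mulrCA ler_wpM2l ?exprn_ge0//.
apply: le_trans (_ : c ^+ N * ((1 + `|a *: y + b|) ^+ N * `|partials s F (a *: y + b)|) <= _).
  rewrite mulrA -exprMn ler_wpM2r// lerXn2r ?nnegrE ?mulr_ge0 ?addr_ge0//.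
  have h : `|a| * `|y| <= `|a *: y + b| + `|b|.
    by rewrite -normrZ -[X in `|X| <= _](addrK b) (le_trans (ler_normB _ _)).
  have h2 : `|y| <= `|a|^-1 * (`|a *: y + b| + `|b|).
    by rewrite ler_pdivlMl ?normr_gt0.
  move: h2; rewrite /c; have : 0 <= `|a|^-1 by rewrite invr_ge0.
  have := normr_ge0 (a *: y + b); have := normr_ge0 b.
  move: `|y| `|a *: y + b| `|b| `|a|^-1 => u w v z v0 w0 z0 h2.
  have : 0 <= z * v * w by rewrite !mulr_ge0.
  lra.
by rewrite ler_wpM2l ?exprn_ge0.
Qed.

Lemma rapid_meas F : rapid F -> meas F.
Proof. by move=> [sF _]; apply: meas_continuous; exact: smooth_continuous. Qed.

Lemma weight_le_wt (F : E -> R) k M x :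
  (1 + `|x|) ^+ (2 * d + k) * `|F x| <= M -> `|F x| * (1 + `|x|) ^+ k <= M * wt x.
Proof.
rewrite exprD -mulrA mulrC /wt => h.
have p : 0 < (1 + `|x|) ^+ (2 * d) by rewrite exprn_gt0// norm1_gt0.
by rewrite ler_pdivlMr// [X in X * _]mulrC.
Qed.

Lemma rapid_wt F k : rapid F -> exists2 M, 0 <= M &
  forall x, `|F x| * (1 + `|x|) ^+ k <= M * wt x.
Proof.
move=> [_ bF]; have [M bM] := bF (2 * d + k)%N [::]; exists M.
  by apply: le_trans (bM 0); rewrite mulr_ge0// exprn_ge0// addr_ge0.
by move=> x; apply: weight_le_wt; exact: bM.
Qed.

Lemma rapid_moment F k : rapid F -> summ (fun x => `|F x| * (1 + `|x|) ^+ k).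
Proof.
move=> rF; have [M M0 bM] := rapid_wt k rF.
apply: summ_le (summZ M summ_wt).
  apply: measM; first by apply: meas_norm; exact: rapid_meas.
  apply: measurable_funX; apply: measurable_funD => //; exact: meas_normx.
move=> x; rewrite ger0_norm ?bM// mulr_ge0// exprn_ge0// addr_ge0//.
Qed.

Lemma rapid_moment1 F : rapid F -> summ (fun x => `|F x| * (1 + `|x|)).
Proof. by move=> /(rapid_moment 1); congr summ; apply/funext => x; rewrite expr1. Qed.

Lemma rapid_summ F : rapid F -> summ F.
Proof.
move=> rF; apply: summ_le (rapid_meas rF) _ (rapid_moment 0 rF).
by move=> x; rewrite mulr1.
Qed.

Lemma wt_shift (x v : E) : `|v| <= 1 -> wt (x + v) <= 2 ^+ (2 * d) * wt x.
Proof.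
move=> v1; rewrite /wt ler_pdivlMr ?exprn_gt0 ?norm1_gt0//.
rewrite mulrC ler_pdivrMr ?exprn_gt0 ?norm1_gt0// -exprMn.
rewrite lerXn2r ?nnegrE ?mulr_ge0 ?addr_ge0//.
have : `|x| <= `|x + v| + `|v|.
  by rewrite -[X in `|X| <= _](addrK v) (le_trans (ler_normB _ _)).
by have := normr_ge0 (x + v); lra.
Qed.

(** The class on which step approximations are studied: it contains the Schwartz
functions, it is stable under soft thresholding, and its constant [C] controls all
estimates. *)
Definition wlip C F := [/\ meas F, 0 <= C, forall x, `|F x| <= C * wt x &
  forall x v, `|v| <= 1 -> `|F (x + v) - F x| <= C * `|v| * wt x].

(** Mean value theorem; a shift by at most one changes the weight by a bounded
factor. *)
Lemma rapid_wlip F : rapid F -> exists C, wlip C F.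
Proof.
move=> rF; have [M M0 bM] := rapid_wt 0 rF.
have [sF bF] := rF.
have /choice[K bK] : forall j : 'I_d, exists K : R, forall x : E,
    (1 + `|x|) ^+ (2 * d) * `|partial j F x| <= K.
  by move=> j; exact: (bF (2 * d)%N [:: j]).
have K0 j : 0 <= K j.
  by apply: le_trans (bK j 0); rewrite mulr_ge0// exprn_ge0// addr_ge0.
have S0 : 0 <= \sum_j K j by exact: sumr_ge0.
exists (M + 2 ^+ (2 * d) * \sum_j K j); split.
- exact: rapid_meas.
- by rewrite addr_ge0// mulr_ge0// exprn_ge0.
- move=> x; have := bM x; rewrite mulr1 => /le_trans; apply.
  by rewrite ler_wpM2r ?wt_ge0// lerDl mulr_ge0// exprn_ge0.
move=> x v v1; have [s /andP[s0 s1] ->] := @mean_value R d F x v (sF [::]).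
apply: (@le_trans _ _ (\sum_j `|v| * (K j * (2 ^+ (2 * d) * wt x)))).
  apply: le_trans (ler_norm_sum _ _ _) _; apply: ler_sum => j _.
  rewrite normrM ler_pM ?coord_le_norm//.
  have sv1 : `|s *: v| <= 1 by rewrite normrZ ger0_norm// mulr_ile1.
  apply: le_trans (_ : K j * wt (x + s *: v) <= _); last first.
    by rewrite ler_wpM2l// wt_shift.
  rewrite /wt ler_pdivlMr ?exprn_gt0 ?norm1_gt0// mulrC; exact: bK.
rewrite -mulr_sumr -mulr_suml; set S := \sum_j K j.
have -> : (M + 2 ^+ (2 * d) * S) * `|v| * wt x =
  M * `|v| * wt x + `|v| * (S * (2 ^+ (2 * d) * wt x)) by ring.
by rewrite lerDr !mulr_ge0 ?wt_ge0.
Qed.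

End Rapid.

(** * Littlewood-Paley blocks as differences of averages *)

Section Blocks.
Context {R : realType} {d : nat}.
Local Notation E := 'rV[R]_d.
Local Notation C := R[i].
Implicit Types F K : E -> R.

Lemma cReM (x y : C) : complex.Re (x * y) =
  complex.Re x * complex.Re y - complex.Im x * complex.Im y.
Proof. by case: x; case: y. Qed.

Lemma cImM (x y : C) : complex.Im (x * y) =
  complex.Re x * complex.Im y + complex.Im x * complex.Re y.
Proof. by case: x; case: y. Qed.

Lemma cReB (x y : C) : complex.Re (x - y) = complex.Re x - complex.Re y.
Proof. by case: x; case: y. Qed.

Lemma cImB (x y : C) : complex.Im (x - y) = complex.Im x - complex.Im y.
Proof. by case: x; case: y. Qed.

Lemma cintegralE (f : E -> C) : cintegral f =
  Complex (rint (fun x => complex.Re (f x))) (rint (fun x => complex.Im (f x))).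
Proof. by []. Qed.

Lemma normc_le (x : C) : Normc.normc x <= `|complex.Re x| + `|complex.Im x|.
Proof.
case: x => a b /=; rewrite -[leRHS]ger0_norm ?addr_ge0// -sqrtr_sqr.
rewrite ler_sqrt ?sqr_ge0// sqrrD !real_normK ?num_real// -addrA lerD2l.
by rewrite lerDr mulrn_wge0// mulr_ge0.
Qed.

Lemma Re_le_normc (x : C) : `|complex.Re x| <= Normc.normc x.
Proof.
by case: x => a b /=; rewrite -sqrtr_sqr ler_sqrt ?addr_ge0 ?sqr_ge0// lerDl sqr_ge0.
Qed.

Lemma Im_le_normc (x : C) : `|complex.Im x| <= Normc.normc x.
Proof.
by case: x => a b /=; rewrite -sqrtr_sqr ler_sqrt ?addr_ge0 ?sqr_ge0// lerDr sqr_ge0.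
Qed.

Lemma schwartz_rapidP (f : E -> C) : schwartz f <->
  rapid (fun x => complex.Re (f x)) /\ rapid (fun x => complex.Im (f x)).
Proof.
split=> [[s1 s2 b]|[[s1 b1] [s2 b2]]].
  split; split => // N s; have [M bM] := b N s; exists M => x;
    apply: le_trans (bM x); rewrite /schwartz_weight ler_wpM2l ?exprn_ge0 ?addr_ge0//.
    exact: (Re_le_normc (cpartials s f x)).
  exact: (Im_le_normc (cpartials s f x)).
split => // N s; have [M bM] := b1 N s; have [M' bM'] := b2 N s.
exists (M + M') => x; apply: le_trans (lerD (bM x) (bM' x)).
rewrite -mulrDr /schwartz_weight ler_wpM2l ?exprn_ge0 ?addr_ge0//.
exact: (normc_le (cpartials s f x)).
Qed.

Lemma coord_le_eucl (x : E) j : `|x ord0 j| <= eucl_norm x.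
Proof.
rewrite /eucl_norm -sqrtr_sqr ler_sqrt; last by apply: sumr_ge0 => i _; rewrite -expr2 sqr_ge0.
rewrite /dot (bigD1 j)//= -expr2 lerDl.
by apply: sumr_ge0 => i _; rewrite -expr2 sqr_ge0.
Qed.

Lemma norm_le_eucl (x : E) : `|x| <= eucl_norm x.
Proof. by apply: norm_le_row => [|j]; [exact: sqrtr_ge0|exact: coord_le_eucl]. Qed.

Section Generator.
Variables (phi : E -> C) (hphi : lp_generator phi).

Lemma generator_testfun :
  testfun (fun x => complex.Re (phi x)) /\ testfun (fun x => complex.Im (phi x)).
Proof.
have [/schwartz_rapidP[[s1 b1] [s2 b2]] _ phi0] := hphi.
have sup x : 2 < `|x| -> phi x = 0.
  by move=> x2; apply: phi0; rewrite ltW// (lt_le_trans x2)// norm_le_eucl.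
split; split => //.
- by exists 2 => x /sup ->.
- by move=> s; have [M bM] := b1 0%N s; exists M => x; have := bM x; rewrite mul1r.
- by exists 2 => x /sup ->.
- by move=> s; have [M bM] := b2 0%N s; exists M => x; have := bM x; rewrite mul1r.
Qed.

(** Real and imaginary parts of the inverse Fourier transform of the generator. *)
Definition kernel_re := trig (fun x => complex.Re (phi x)) (fun x => (-1) * complex.Im (phi x)).
Definition kernel_im := trig (fun x => complex.Im (phi x)) (fun x => complex.Re (phi x)).

Lemma kernel_re_rapid : rapid kernel_re.
Proof.
have [t1 t2] := generator_testfun; apply: transformed_rapid.
by exists (fun x => complex.Re (phi x)), (fun x => (-1) * complex.Im (phi x));
  split => //; exact: testfunZ.
Qed.

Lemma kernel_im_rapid : rapid kernel_im.
Proof.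
have [t1 t2] := generator_testfun; apply: transformed_rapid.
by exists (fun x => complex.Im (phi x)), (fun x => complex.Re (phi x)).
Qed.

Lemma inv_fourierE (f : E -> C) x : inv_fourier f x =
  Complex (trig (fun x => complex.Re (f x)) (fun x => (-1) * complex.Im (f x)) x)
          (trig (fun x => complex.Im (f x)) (fun x => complex.Re (f x)) x).
Proof.
rewrite /inv_fourier cintegralE; congr Complex; apply: eq_rint => xi.
  by rewrite cReM /expi /phase /= mulN1r mulNr.
by rewrite cImM /expi /phase /= addrC.
Qed.

Lemma trig_scale (f g : E -> R) c x : c != 0 -> summ f -> summ g ->
  trig (fun xi => f (c *: xi)) (fun xi => g (c *: xi)) x =
  `|c| ^- d * trig f g (c^-1 *: x).
Proof.
move=> c0 sf sg; rewrite [in RHS]/trig.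
rewrite (rint_affine (a := c) 0 c0); last first.
  by apply: summD; [exact: summ_cos|exact: summ_sin].
rewrite mulKf; last by rewrite expf_neq0// normr_eq0.
apply: eq_rint => xi; rewrite addr0.
suff -> : phase (c^-1 *: x) (c *: xi) = phase x xi by [].
by rewrite /phase dotZr dotC dotZr mulVKf// dotC.
Qed.

Lemma trigB (f f' g g' : E -> R) x : summ f -> summ g -> summ f' -> summ g' ->
  trig (fun xi => f xi - f' xi) (fun xi => g xi - g' xi) x =
  trig f g x - trig f' g' x.
Proof.
move=> sf sg sf' sg'; rewrite /trig -rintB.
- by apply: eq_rint => xi; ring.
- by apply: summD; [exact: summ_cos|exact: summ_sin].
- by apply: summD; [exact: summ_cos|exact: summ_sin].
Qed.

(** The L^1-normalised dilation, the inverse Fourier transform of the density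
dilated by [2^k]. *)
Definition dilate K k (x : E) := 2 ^+ (k * d) * K (2 ^+ k *: x).
Definition multiplier_kernel K k (x : E) :=
  if k is j.+1 then dilate K j.+1 x - dilate K j x else K x.

Lemma summ_scale F c : c != 0 -> summ F -> summ (fun x => F (c *: x)).
Proof.
move=> c0 sF; have := summ_affine 0 c0 sF; congr summ.
by apply/funext => x; rewrite addr0.
Qed.

Lemma pow2V_neq0 k : (2 : R) ^- k != 0.
Proof. by rewrite invr_eq0 expf_neq0// pnatr_eq0. Qed.

Lemma dilate_trig f g k x : summ f -> summ g ->
  trig (fun xi => f (2 ^- k *: xi)) (fun xi => g (2 ^- k *: xi)) x =
  dilate (trig f g) k x.
Proof.
move=> sf sg; rewrite trig_scale//.
rewrite /dilate invrK; congr (_ * _).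
by rewrite ger0_norm ?invr_ge0 ?exprn_ge0// exprVn invrK exprM.
Qed.

Lemma inv_fourier_multiplier k x : inv_fourier (lp_multiplier phi k) x =
  Complex (multiplier_kernel kernel_re k x) (multiplier_kernel kernel_im k x).
Proof.
have [/testfun_summ t1 /testfun_summ t2] := generator_testfun.
have t3 := summZ (-1) t2.
have sc F j : summ F -> summ (fun x => F (2 ^- j *: x)).
  by apply: summ_scale; exact: pow2V_neq0.
rewrite inv_fourierE; case: k => [|j] //=.
rewrite -![(dilate kernel_re) _ _]dilate_trig// -![(dilate kernel_im) _ _]dilate_trig//.
rewrite -!trigB; try exact: (sc _ _ t1); try exact: (sc _ _ t2);
  try exact: (sc _ _ t3).
congr Complex; apply: eq_rint => xi /=; rewrite cReB cImB//.
by rewrite mulrBr.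
Qed.

Lemma dilate_rapid K k : rapid K -> rapid (dilate K k).
Proof.
move=> rK; apply: rapidZ.
have := @rapid_affine _ _ _ (2 ^+ k) 0 _ rK; rewrite expf_neq0 ?pnatr_eq0//.
move=> /(_ isT); congr rapid; by apply/funext => x; rewrite addr0.
Qed.

Lemma multiplier_kernel_rapid K k : rapid K -> rapid (multiplier_kernel K k).
Proof. by case: k => [//|j] rK; apply: rapidB; exact: dilate_rapid. Qed.

Lemma rapid_reflect K x : rapid K -> rapid (fun y => K (x - y)).
Proof.
move=> rK; have := @rapid_affine _ _ _ (-1) x _ rK.
rewrite oppr_eq0 oner_neq0 => /(_ isT); congr rapid.
by apply/funext => y; rewrite scaleN1r addrC.
Qed.

(** A distribution given by a function is zero outside the Schwartz class, so its
blocks can be computed only after this check. *)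
Lemma schwartz_kernel k x :
  schwartz (fun y => inv_fourier (lp_multiplier phi k) (x - y)).
Proof.
apply/schwartz_rapidP; split.
  have := rapid_reflect x (multiplier_kernel_rapid k kernel_re_rapid); congr rapid.
  by apply/funext => y; rewrite inv_fourier_multiplier.
have := rapid_reflect x (multiplier_kernel_rapid k kernel_im_rapid); congr rapid.
by apply/funext => y; rewrite inv_fourier_multiplier.
Qed.

Definition smear F K k (x : E) := rint (fun z => K z * F (x - 2 ^- k *: z)).
Definition block F K k (x : E) :=
  if k is j.+1 then smear F K j.+1 x - smear F K j x else smear F K 0 x.

Definition bdd a F := meas F /\ forall x, `|F x| <= a.

Lemma bdd_affine a F c (b : E) : bdd a F -> bdd a (fun x => F (c *: x + b)).
Proof. by move=> [mF bF]; split => //; exact: meas_affine. Qed.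

Lemma summ_bdd a F K : bdd a F -> summ K -> summ (fun x => K x * F x).
Proof.
move=> [mF bF] sK; have := summM mF bF sK; congr summ.
by apply/funext => x; rewrite mulrC.
Qed.

Lemma bdd_line a F k x : bdd a F -> bdd a (fun z => F (x - 2 ^- k *: z)).
Proof.
move=> /(bdd_affine (- 2 ^- k) x); congr bdd.
by apply/funext => z; rewrite scaleNr addrC.
Qed.

Lemma summ_smear a F K k x : bdd a F -> summ K ->
  summ (fun z => K z * F (x - 2 ^- k *: z)).
Proof. by move=> bF; apply: summ_bdd; exact: bdd_line bF. Qed.

Lemma smear_dilate a F K k x : bdd a F -> summ K ->
  rint (fun y => F y * dilate K k (x - y)) = smear F K k x.
Proof.
move=> bF sK; have a0 : - 2 ^+ k != 0 :> R by rewrite oppr_eq0 expf_neq0// pnatr_eq0.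
rewrite /smear [RHS](rint_affine (a := - 2 ^+ k) (2 ^+ k *: x) a0); last first.
  exact: summ_smear bF sK.
rewrite -rintZ; last first.
  exact: (summ_affine _ a0 (summ_smear k x bF sK)).
apply: eq_rint => y; rewrite /dilate normrN normrX ger0_norm// exprM.
have -> : - 2 ^+ k *: y + 2 ^+ k *: x = 2 ^+ k *: (x - y).
  by rewrite scalerBr scaleNr addrC.
rewrite scalerA mulVf ?expf_neq0 ?pnatr_eq0// scale1r.
have -> : x - (x - y) = y by rewrite opprB addrCA subrr addr0.
by ring.
Qed.

Lemma block_convolution a F K k x : bdd a F -> rapid K ->
  rint (fun y => F y * multiplier_kernel K k (x - y)) = block F K k x.
Proof.
move=> bF rK; have sK := rapid_summ rK.
have s j : summ (fun y => F y * dilate K j (x - y)).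
  have := summ_bdd bF (rapid_summ (rapid_reflect x (dilate_rapid j rK))).
  by congr summ; apply/funext => y; rewrite mulrC.
case: k => [|j] /=.
  rewrite -(smear_dilate 0 x bF sK); apply: eq_rint => y.
  by rewrite /dilate mul0n expr0 mul1r scale1r.
rewrite -!(smear_dilate _ _ bF sK) -rintB//.
by apply: eq_rint => y; rewrite mulrBr.
Qed.

(** Blocks become real integrals at a fixed kernel: the dilation has been moved
from the kernel to the function by a change of variables. *)
Lemma lp_blockE a (f : E -> C) k x : bdd a (fun x => complex.Re (f x)) ->
  bdd a (fun x => complex.Im (f x)) ->
  lp_block phi k (dist_of f) x =
  Complex (block (fun x => complex.Re (f x)) kernel_re k x -
           block (fun x => complex.Im (f x)) kernel_im k x)
          (block (fun x => complex.Re (f x)) kernel_im k x +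
           block (fun x => complex.Im (f x)) kernel_re k x).
Proof.
move=> b1 b2; rewrite /lp_block /dist_of.
case: asboolP => [_|]; last by move=> n; case: n; exact: schwartz_kernel.
have s F K : bdd a F -> rapid K -> summ (fun y => F y * multiplier_kernel K k (x - y)).
  move=> bF rK.
  have := summ_bdd bF (rapid_summ (rapid_reflect x (multiplier_kernel_rapid k rK))).
  by congr summ; apply/funext => y; rewrite mulrC.
have [rr ri] := (kernel_re_rapid, kernel_im_rapid).
rewrite cintegralE; congr Complex.
  rewrite -(block_convolution k x b1 rr) -(block_convolution k x b2 ri) -rintB; [|exact: s..].
  by apply: eq_rint => y; rewrite inv_fourier_multiplier cReM.
rewrite -(block_convolution k x b1 ri) -(block_convolution k x b2 rr) -rintD; [|exact: s..].
by apply: eq_rint => y; rewrite inv_fourier_multiplier cImM.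
Qed.

End Generator.
End Blocks.

(** * Integral bounds for the blocks *)

Section L1bound.
Context {R : realType} {d : nat}.
Local Notation mR := (measurableTypeR R).
Local Notation E := 'rV[R]_d.
Local Notation T := (d.-tuple mR).
Local Notation lam := (@lebesgue_tuple R d).
Local Notation rt := (@row_of_tuple R d).
Implicit Types F K : E -> R.

Definition jmeas (G : E -> E -> R) :=
  measurable_fun [set: T * T] (fun z : T * T => G (rt z.1) (rt z.2)).

(** Positive and negative parts, so that the measurability statement of Tonelli's
theorem applies. *)
Lemma meas_rint (G : E -> E -> R) : jmeas G -> (forall x, summ (G x)) ->
  meas (fun x => rint (G x)).
Proof.
move=> mG sG.
pose p x z := Num.max (G x z) 0; pose q x z := Num.max (- G x z) 0.
have GE x z : G x z = p x z - q x z.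
  by rewrite /p /q; case: (lerP (G x z) 0) => h; case: (lerP (- G x z) 0) => h'; lra.
have mH (H : E -> E -> R) : jmeas H -> (forall x z, 0 <= H x z) -> meas (fun x => rint (H x)).
  move=> mH H0.
  have /measurable_EFinP mH' := mH.
  have := measurable_fun_fubini_tonelli_F (m2 := lam)
    (fun z : T * T => (H (rt z.1) (rt z.2))%:E) mH' (fun z => H0 _ _).
  move=> h; apply: (measurableT_comp (fine_measurable measurableT) h).
have mp : jmeas p by apply: measurable_maxr.
have mq : jmeas q by apply: measurable_maxr => //; exact: measurable_funN.
have np x z : `|p x z| <= `|G x z|.
  by rewrite /p; case: (lerP (G x z) 0); rewrite ?normr0.
have nq x z : `|q x z| <= `|G x z|.
  by rewrite /q; case: (lerP (- G x z) 0); rewrite ?normr0 ?normrN.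
have sp x : summ (p x).
  apply: summ_le (np x) (summ_norm (sG x)).
  by apply: measurable_maxr => //; exact: summ_meas.
have sq x : summ (q x).
  apply: summ_le (nq x) (summ_norm (sG x)).
  by apply: measurable_maxr => //; apply: measurable_funN; exact: summ_meas.
have := measB (mH p mp (fun x z => _)) (mH q mq (fun x z => _)).
have E1 : (fun x => rint (p x) - rint (q x)) = (fun x => rint (G x)).
  by apply/funext => x; rewrite -rintB//; apply: eq_rint => z; rewrite -GE.
rewrite E1; apply.
- by move=> x z; rewrite /p le_max lexx orbT.
- by move=> x z; rewrite /q le_max lexx orbT.
Qed.

Lemma jmeas_line F c : meas F -> jmeas (fun x z => F (x - c *: z)).
Proof.
move=> mF; have := meas_lin2 1 (- c) 0 mF; congr measurable_fun.
by apply/funext => z; rewrite scale1r scaleNr addr0.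
Qed.

Lemma jmeas_snd K : meas K -> jmeas (fun _ z => K z).
Proof. by move=> mK; exact: (measurableT_comp mK measurable_snd). Qed.

(** Tonelli: an average of functions of L^1 norm at most [c (1 + |z|)] against [K]. *)
Lemma L1_param (K : E -> R) (G : E -> E -> R) c : 0 <= c -> meas K -> jmeas G ->
  (forall x, summ (fun z => K z * G x z)) ->
  summ (fun z => `|K z| * (1 + `|z|)) ->
  (forall z, (eint (fun x => `|G x z|)%R <= (c * (1 + `|z|))%:E)%E) ->
  (eint (fun x => `|rint (fun z => K z * G x z)|)%R <=
   (c * rint (fun z => `|K z| * (1 + `|z|)))%:E)%E.
Proof.
move=> c0 mK mG sKG sK Gc.
have mKG : jmeas (fun x z => K z * G x z).
  by apply: measurable_funM => //; exact: jmeas_snd.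
pose h z := (`|K (rt z.2) * G (rt z.1) (rt z.2)|)%:E.
have mh : measurable_fun [set: T * T] h.
  by apply/measurable_EFinP; apply: measurableT_comp mKG.
have h0 z : (0 <= h z)%E by rewrite lee_fin.
apply: (@le_trans _ _ (\int[lam]_t \int[lam]_s h (t, s))%E).
  apply: ge0_le_integral => //.
  - by apply/measurable_EFinP; apply: measurableT_comp (meas_rint mKG sKG).
  - exact: (measurable_fun_fubini_tonelli_F (m2 := lam) h mh h0).
  - move=> t _; have := norm_rint (sKG (rt t)); rewrite -lee_fin => /le_trans; apply.
    by rewrite -eint_rint//; exact: summ_norm.
rewrite (fubini_tonelli _ mh h0).
rewrite -rintZ// -eint_rint; last exact: summZ.
apply: ge0_le_integral => //.
- by move=> s _; apply: integral_ge0.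
- exact: (measurable_fun_fubini_tonelli_G (m1 := lam) h mh h0).
- by apply/measurable_EFinP; exact: (summ_meas (summZ c sK)).
move=> s _; rewrite mulrCA EFinM.
apply: le_trans (_ : ((`|K (rt s)|)%:E * eint (fun x => `|G x (rt s)|)%R <= _)%E); last first.
  by rewrite lee_wpmul2l// lee_fin.
rewrite -ge0_integralZl//; last first.
  apply/measurable_EFinP; apply: measurableT_comp => //.
  exact: (measurableT_comp mG (measurable_pair2 s)).
rewrite le_eqVlt; apply/orP; left; apply/eqP.
by apply: eq_integral => t _; rewrite -EFinM -normrM.
Qed.

(** [V] bounds the L^1 norm and the L^1 modulus of continuity, as for functions of
bounded variation. *)
Definition bv V F := [/\ summ F, 0 <= V, rint (fun x => `|F x|) <= V &
  forall v, rint (fun x => `|F (x + v) - F x|) <= V * `|v|].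

Lemma eint_le (f : E -> R) c : summ f -> rint f <= c -> (eint f <= c%:E)%E.
Proof. by move=> sf; rewrite eint_rint// lee_fin. Qed.

Lemma smear_bound a F K k x : bdd a F -> summ K ->
  `|smear F K k x| <= a * rint (fun z => `|K z|).
Proof.
move=> bF sK; rewrite -rintZ; last exact: summ_norm.
apply: rint_bound.
- by apply: summ_meas; exact: summ_smear bF sK.
- by apply: summZ; exact: summ_norm.
by move=> z; rewrite normrM mulrC ler_wpM2r//; case: bF.
Qed.

Lemma block_bound a F K k x : bdd a F -> summ K ->
  `|block F K k x| <= 2 * (a * rint (fun z => `|K z|)).
Proof.
move=> bF sK; have a0 : 0 <= a by case: bF => _ b; apply: le_trans (b 0).
have h j := smear_bound j x bF sK.
case: k => [|k] /=.
  apply: le_trans (h 0%N) _; rewrite ler_peMl ?ler1n//.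
  by rewrite mulr_ge0// rint_ge0.
by apply: le_trans (ler_normB _ _) _; rewrite mulr_natl mulr2n lerD.
Qed.

Lemma meas_smear a F K k : bdd a F -> summ K -> meas (smear F K k).
Proof.
move=> bF sK; apply: meas_rint; last by move=> x; exact: summ_smear bF sK.
apply: measurable_funM; first by apply: jmeas_snd; exact: summ_meas.
by apply: jmeas_line; case: bF.
Qed.

Lemma meas_block a F K k : bdd a F -> summ K -> meas (block F K k).
Proof.
move=> bF sK; case: k => [|k]; first exact: meas_smear bF sK.
by apply: measB; exact: meas_smear bF sK.
Qed.

(** For [k >= 1] the block averages the increments of [F] over the vector
[2^-k z], so its L^1 norm gains [2^-k] from [bv], at the price of a moment of [K]. *)
Lemma block_L1 a V F K k : bdd a F -> rapid K -> bv V F ->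
  (eint (fun x => `|block F K k x|)%R <=
   (2 ^- k * V * rint (fun z => `|K z| * (1 + `|z|)))%:E)%E.
Proof.
move=> bF rK [sF V0 F1 FV]; have sK := rapid_summ rK; have mK := summ_meas sK.
have sK1 := rapid_moment1 rK.
have mF : meas F by case: bF.
have sh j z : summ (fun x => F (x - 2 ^- j *: z)) by exact: summ_shift.
case: k => [|k] /=.
  rewrite invr1 mul1r; apply: L1_param => //.
  - exact: jmeas_line.
  - by move=> x; exact: summ_smear bF sK.
  move=> z; apply: eint_le; first by apply: summ_norm; exact: sh.
  rewrite (rint_shift (- (2 ^- 0 *: z)) (summ_norm sF)).
  by apply: le_trans F1 _; rewrite ler_peMr// lerDl.
pose G x z := F (x - 2 ^- k.+1 *: z) - F (x - 2 ^- k *: z).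
have -> : (fun x => `|smear F K k.+1 x - smear F K k x|) =
    (fun x => `|rint (fun z => K z * G x z)|).
  apply/funext => x; rewrite /smear -rintB; [|exact: summ_smear bF sK..].
  by congr `|_|; apply: eq_rint => z; rewrite /G mulrBr.
apply: L1_param => //.
- by rewrite mulr_ge0// invr_ge0 exprn_ge0.
- by apply: measurable_funB; exact: jmeas_line.
- move=> x; have := summB (summ_smear k.+1 x bF sK) (summ_smear k x bF sK).
  by congr summ; apply/funext => z; rewrite /G mulrBr.
move=> z; apply: eint_le; first by apply: summ_norm; exact: summB.
have e : (fun x => `|G x z|) = (fun x => (fun y => `|F (y + 2 ^- k.+1 *: z) - F y|)
    (x + (- (2 ^- k *: z)))).
  apply/funext => x; rewrite /G /=; congr `|F _ - _|.
  rewrite -addrA; congr (_ + _); rewrite -!scaleNr -scalerDl; congr (_ *: _).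
  by rewrite exprS invfM; move: ((2 ^+ k)^-1) => q; lra.
have sd : summ (fun y => `|F (y + 2 ^- k.+1 *: z) - F y|).
  by apply: summ_norm; apply: summB => //; exact: summ_shift.
rewrite e (rint_shift (- (2 ^- k *: z)) sd).
apply: le_trans (FV _) _; rewrite normrZ ger0_norm ?invr_ge0 ?exprn_ge0//.
rewrite mulrCA -mulrA ler_wpM2l ?invr_ge0 ?exprn_ge0// ler_wpM2l// lerDr//.
Qed.

End L1bound.

(** * Lebesgue and Besov norms of possibly nonmeasurable functions *)

Section LowerIntegral.
Local Open Scope ereal_scope.
Context {disp} {T : measurableType disp} {R : realType}.
Variable mu : {measure set T -> \bar R}.
Import HBNNSimple.

(** The integral of a nonnegative function is a supremum over the simple
functions below it, so it is monotone without measurability.  This matters because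
the blocks of an arbitrary tempered distribution are not known to be measurable
functions. *)
Lemma le_integral_nonmeas (f g : T -> \bar R) : (forall x, 0 <= f x) ->
  (forall x, f x <= g x) -> \int[mu]_x f x <= \int[mu]_x g x.
Proof.
move=> f0 fg; have g0 x : 0 <= g x by exact: le_trans (fg x).
rewrite !ge0_integralTE//; apply: le_ereal_sup => _ [h hf <-].
by exists h => // x; exact: le_trans (hf x) (fg x).
Qed.

(** Subadditivity when only [g] is measurable: a simple function [h] below
[f + g] is split as [g] plus the positive part of [h - g], which is measurable and
lies below [f]. *)
Lemma integralD_le_nonmeas (f g : T -> R) : measurable_fun setT g ->
  (forall x, 0 <= f x)%R -> (forall x, 0 <= g x)%R ->
  \int[mu]_x (f x + g x)%:E <= \int[mu]_x (f x)%:E + \int[mu]_x (g x)%:E.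
Proof.
move=> mg f0 g0.
rewrite ge0_integralTE; last by move=> x; rewrite lee_fin addr_ge0.
apply: ub_ereal_sup => _ [h hfg <-].
pose m x := Num.max (h x - g x)%R 0%R.
have mm : measurable_fun setT m.
  by apply: measurable_maxr => //; exact: measurable_funB.
have m0 x : (0 <= m x)%R by rewrite /m le_max lexx orbT.
rewrite -integralT_nnsfun; apply: (@le_trans _ _ (\int[mu]_x ((m x)%:E + (g x)%:E))).
  apply: le_integral_nonmeas => x; first by rewrite lee_fin.
  rewrite -EFinD lee_fin -lerBlDr.
  by rewrite /m le_max lexx.
rewrite ge0_integralD//.
- rewrite leeD2r//; apply: le_integral_nonmeas => x; first by rewrite lee_fin.
  rewrite lee_fin /m ge_max f0 andbT lerBlDr; have := hfg x; by rewrite lee_fin.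
- by move=> x _; rewrite lee_fin.
- exact/measurable_EFinP.
- by move=> x _; rewrite lee_fin.
- exact/measurable_EFinP.
Qed.

End LowerIntegral.

Section Norms.
Context {R : realType} {d : nat}.
Local Notation mR := (measurableTypeR R).
Local Notation E := 'rV[R]_d.
Local Notation C := R[i].
Local Notation T := (d.-tuple mR).
Local Notation lam := (@lebesgue_tuple R d).
Local Notation rt := (@row_of_tuple R d).

Lemma normc_ge0 (x : C) : 0 <= Normc.normc x.
Proof. by case: x => a b; exact: sqrtr_ge0. Qed.

Lemma lebesgue_tuple_gt0 : (0 < lam setT)%E.
Proof.
have L : (0 < lebesgue_measure [set: R])%E.
  by rewrite -set_itvNyy lebesgue_measure_itv /= ltry.
elim: (d) => [|n IH] /=; first by rewrite diracT.
rewrite /leb_cons /pushforward preimage_setT -setXTT product_measure1E//.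
by apply: mule_gt0.
Qed.

(** A nonempty set has counting measure at least one. *)
Lemma ae_counting (P : nat -> Prop) :
  (\forall k \ae (@counting nat R), P k) -> forall k, P k.
Proof.
move=> [N [mN N0 sub]] k; apply: contrapT => nP.
have Nk : N k by apply: sub.
have : ((@counting nat R) [set k] <= @counting nat R N)%E.
  by apply: le_measure; rewrite ?inE// => _ ->.
rewrite N0 /counting asboolT// fset_set1 finmap.cardfs1 lee_fin.
by rewrite ler10.
Qed.

Definition bterm (phi : E -> C) (s : R) (p : \bar R) U k : \bar R :=
  ((2 `^ (k%:R * s))%:E * cLnorm p (lp_block phi k U))%E.

Lemma bterm_ge0 phi s p U k : (0 <= bterm phi s p U k)%E.
Proof. by rewrite mule_ge0// ?lee_fin ?powR_ge0// Lnorm_ge0. Qed.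

Lemma counting_pos : (0 < (@counting nat R) setT)%E.
Proof.
have : ((@counting nat R) [set 0%N] <= @counting nat R setT)%E.
  by apply: le_measure; rewrite ?inE.
by apply: lt_le_trans; rewrite /counting asboolT// fset_set1 finmap.cardfs1 lte_fin.
Qed.

(** For [q = oo] the essential supremum over the indices is a genuine supremum. *)
Lemma besov_norm_leP phi s p U (B : \bar R) :
  (besov_norm phi s p +oo U <= B)%E <-> forall k, (bterm phi s p U k <= B)%E.
Proof.
rewrite /besov_norm unlock counting_pos; split.
  move=> h k; have := ess_sup_ge (@counting nat R)
    (abse \o (fun k => bterm phi s p U k)) => /ae_counting /(_ k) /=.
  by rewrite gee0_abs ?bterm_ge0// => /le_trans; apply.
move=> h; apply/ess_supP; apply: nearW => k /=.
by rewrite -/(bterm phi s p U k) gee0_abs ?bterm_ge0//; exact: h.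
Qed.

Lemma cLnormE r (f : E -> C) : cLnorm r%:E f =
  ((\int[lam]_t (Normc.normc (f (rt t)) `^ r)%:E) `^ r^-1)%E.
Proof.
rewrite /cLnorm unlock; congr poweR; apply: eq_integral => t _.
by rewrite /= ger0_norm// normc_ge0.
Qed.

Lemma cLnorm_oo (f : E -> C) (B : \bar R) : (cLnorm +oo f <= B)%E <->
  \forall t \ae lam, ((Normc.normc (f (rt t)))%:E <= B)%E.
Proof.
rewrite /cLnorm unlock lebesgue_tuple_gt0; split.
  move=> h; apply: filterS (ess_sup_ge lam
    (abse \o (fun t => (Normc.normc (f (rt t)))%:E))) => t /=.
  rewrite ger0_norm ?normc_ge0// => /le_trans; exact.
move=> h; apply/ess_supP; apply: filterS h => t /=.
by rewrite ger0_norm ?normc_ge0.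
Qed.

End Norms.

Section Interp.
Context {R : realType} {d : nat}.
Local Notation mR := (measurableTypeR R).
Local Notation E := 'rV[R]_d.
Local Notation C := R[i].
Local Notation T := (d.-tuple mR).
Local Notation lam := (@lebesgue_tuple R d).
Local Notation rt := (@row_of_tuple R d).

(** The interpolation bound [a^(1-1/p) b^(1/p)] for the L^p norm of a function
bounded by [a] whose L^1 norm is at most [b]. *)
Definition theta (p : \bar R) (a b : R) : R :=
  if p is r%:E then (a `^ (r - 1) * b) `^ r^-1 else a.

Lemma poweR_le_root (X : \bar R) r e : 1 < r -> (0 <= X)%E -> 0 <= e ->
  (X `^ r^-1 <= e%:E)%E -> (X <= (e `^ r)%:E)%E.
Proof.
move=> r1 X0 e0 h; have r0 : 0 < r by lra.
have -> : X = ((X `^ r^-1) `^ r)%E.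
  by rewrite -poweRrM mulVf ?poweRe1// gt_eqF.
rewrite -poweR_EFin; apply: gt0_ler_poweR => //; first exact: ltW.
- by rewrite in_itv /= poweR_ge0 leey.
- by rewrite in_itv /= lee_fin e0 leey.
Qed.

Lemma poweR_root_le (X : \bar R) r b : 1 < r -> (0 <= X)%E ->
  (X <= b%:E)%E -> (X `^ r^-1 <= (b `^ r^-1)%:E)%E.
Proof.
move=> r1 X0 h; have r0 : 0 < r by lra.
rewrite -poweR_EFin; apply: gt0_ler_poweR => //; first by rewrite invr_ge0 ltW.
- by rewrite in_itv /= X0 leey.
- by rewrite in_itv /= (le_trans X0 h) leey.
Qed.

Lemma int_powR_ge0 (G : E -> R) r : (0 <= \int[lam]_t (G (rt t) `^ r)%:E)%E.
Proof. by apply: integral_ge0 => t _; rewrite lee_fin powR_ge0. Qed.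

Lemma int_powR_le (G : E -> R) a b r : 1 < r -> 0 <= a -> meas G ->
  (forall x, 0 <= G x <= a) -> (eint G <= b%:E)%E ->
  (\int[lam]_t (G (rt t) `^ r)%:E <= (a `^ (r - 1) * b)%:E)%E.
Proof.
move=> r1 a0 mG Ga Gb; have r0 : 0 < r by lra.
apply: (@le_trans _ _ (eint (fun x => a `^ (r - 1) * G x))).
  apply: le_integral_nonmeas => t; first by rewrite lee_fin powR_ge0.
  have /andP[G0 G1] := Ga (rt t).
  rewrite lee_fin -mulr_powRB1// mulrC ler_wpM2r//.
  by apply: ge0_ler_powR; rewrite ?nnegrE//; lra.
rewrite eintZ ?powR_ge0//; last by move=> x; case/andP: (Ga x).
by rewrite EFinM lee_wpmul2l// lee_fin powR_ge0.
Qed.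

Lemma cLnorm_le p (f : E -> C) (G : E -> R) a b : (1 < p)%E -> 0 <= a ->
  meas G -> (forall x, Normc.normc (f x) <= G x <= a) -> (eint G <= b%:E)%E ->
  (cLnorm p f <= (theta p a b)%:E)%E.
Proof.
move=> p1 a0 mG fG Gb; case: p p1 => [r| |//].
  rewrite lte_fin => r1; have r0 : 0 < r by lra.
  rewrite cLnormE /theta; apply: poweR_root_le => //.
    exact: (int_powR_ge0 (fun x => Normc.normc (f x))).
  apply: le_trans (int_powR_le r1 a0 mG _ Gb) => [|x]; last first.
    by have /andP[h1 ->] := fG x; rewrite (le_trans (normc_ge0 _) h1).
  apply: le_integral_nonmeas => t; first by rewrite lee_fin powR_ge0.
  have /andP[h1 _] := fG (rt t); rewrite lee_fin; apply: ge0_ler_powR => //.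
  - exact: ltW.
  - by rewrite nnegrE normc_ge0.
  - by rewrite nnegrE (le_trans (normc_ge0 _) h1).
move=> _; apply/cLnorm_oo; apply: nearW => t; rewrite lee_fin.
by have /andP[h1] := fG (rt t); exact: le_trans.
Qed.

Import HBNNSimple.

(** A substitute for Minkowski's inequality, with a constant, in which [f1] may
be nonmeasurable; it rests on [|x + y|^r <= (2|x|)^r + (2|y|)^r]. *)
Lemma cLnorm_perturb p (f1 f2 : E -> C) (G : E -> R) a b e : (1 < p)%E -> 0 <= a ->
  meas G -> (forall x, Normc.normc (f2 x) <= G x <= a) -> (eint G <= b%:E)%E ->
  theta p a b <= e -> (cLnorm p f1 <= e%:E)%E ->
  (cLnorm p (fun x => (f1 x + f2 x)%R) <= (4 * e)%:E)%E.
Proof.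
move=> p1 a0 mG fG Gb the f1e.
have e0 : 0 <= e by move: f1e; rewrite -lee_fin; apply: le_trans; exact: Lnorm_ge0.
have G0 x : 0 <= G x by have /andP[h _] := fG x; exact: le_trans (normc_ge0 _) h.
have tri x : Normc.normc (f1 x + f2 x) <= Normc.normc (f1 x) + G x.
  apply: le_trans (le_normcD _ _) _; rewrite lerD2l.
  by case/andP: (fG x).
case: p p1 the f1e => [r| |//]; last first.
  move=> _ /= ae /cLnorm_oo f1e; apply/cLnorm_oo.
  apply: filterS f1e => t; rewrite !lee_fin => h.
  have := tri (rt t); have /andP[_ Ga] := fG (rt t); lra.
rewrite lte_fin => r1 the; have r0 : 0 < r by lra.
rewrite !cLnormE => /poweR_le_root f1e.
have {}f1e := f1e r1 (int_powR_ge0 (fun x => Normc.normc (f1 x)) r) e0.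
have Ge : (\int[lam]_t (G (rt t) `^ r)%:E <= (e `^ r)%:E)%E.
  have Ga x : 0 <= G x <= a by rewrite G0; case/andP: (fG x).
  apply: le_trans (int_powR_le r1 a0 mG Ga Gb) _.
  have X0 : 0 <= a `^ (r - 1) * b.
    rewrite mulr_ge0 ?powR_ge0// -lee_fin; apply: le_trans Gb.
    exact: eint_ge0.
  by apply: poweR_le_root; rewrite ?lee_fin// poweR_EFin lee_fin.
have rV : r^-1 <= 1 by rewrite invf_le1//; lra.
apply: (@le_trans _ _ (((2 `^ r * (2 * e `^ r)) `^ r^-1)%:E)); last first.
  rewrite lee_fin powRM ?powR_ge0 ?mulr_ge0 ?powR_ge0//.
  rewrite powRM ?powR_ge0// -!powRrM mulfV ?gt_eqF// !powRr1//.
  rewrite [4](_ : _ = 2 * 2 :> R); last by rewrite -natrM.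
  rewrite -mulrA ler_wpM2l// ler_wpM2r//.
  by rewrite -[leRHS](@powRr1 _ 2)// ler_powR// ler1n.
apply: poweR_root_le => //.
  exact: (int_powR_ge0 (fun x => Normc.normc (f1 x + f2 x))).
pose F t := (2 * Normc.normc (f1 (rt t))) `^ r.
pose H t := (2 * G (rt t)) `^ r.
have mH : measurable_fun setT H.
  apply: (@measurableT_comp _ _ _ _ _ _ (fun x : R => x `^ r) _ (fun t => 2 * G (rt t))).
    exact: measurable_powR.
  by apply: measurable_funM.
apply: (@le_trans _ _ (\int[lam]_t (F t + H t)%:E)%E).
  apply: le_integral_nonmeas => t; first by rewrite lee_fin powR_ge0.
  rewrite lee_fin; apply: (@le_trans _ _ ((2 * Num.max (Normc.normc (f1 (rt t))) (G (rt t))) `^ r)).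
    apply: ge0_ler_powR; rewrite ?nnegrE ?normc_ge0 ?mulr_ge0 ?le_max ?normc_ge0//.
      exact: ltW.
    apply: le_trans (tri _) _; rewrite mulr_natl mulr2n.
    by rewrite lerD// le_max lexx ?orbT.
  rewrite /F /H; case: (leP (Normc.normc (f1 (rt t))) (G (rt t))) => _.
    by rewrite lerDr powR_ge0.
  by rewrite lerDl powR_ge0.
apply: le_trans (integralD_le_nonmeas _ mH _ _) _.
- by move=> t; exact: powR_ge0.
- by move=> t; exact: powR_ge0.
have sc (h : T -> R) : (forall t, 0 <= h t) -> (\int[lam]_t (h t `^ r)%:E <= (e `^ r)%:E)%E ->
    (\int[lam]_t ((2 * h t) `^ r)%:E <= (2 `^ r * e `^ r)%:E)%E.
  move=> h0 hE.
  rewrite ge0_integralTE; last by move=> t; rewrite lee_fin powR_ge0.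
  apply: ub_ereal_sup => _ [g hg <-].
  have c0 : 0 < 2 `^ r :> R by exact: powR_gt0.
  rewrite -integralT_nnsfun.
  have -> : (\int[lam]_x (g x)%:E)%E =
     ((2 `^ r)%:E * \int[lam]_x ((2 `^ r)^-1 * g x)%:E)%E.
    rewrite -ge0_integralZl//; last first.
    - by move=> x _; rewrite lee_fin mulr_ge0// invr_ge0 ltW.
    - by apply/measurable_EFinP; apply: measurable_funM.
    by apply: eq_integral => x _; rewrite -EFinM mulVKf// gt_eqF.
  rewrite EFinM lee_pmul2l//; apply: le_trans hE.
  apply: le_integral_nonmeas => x; first by rewrite lee_fin mulr_ge0// invr_ge0 ltW.
  have := hg x; rewrite !lee_fin powRM// => hh.
  by rewrite ler_pdivrMl.
rewrite [2 * e `^ r]mulr_natl mulr2n mulrDr EFinD; apply: leeD.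
  exact: (sc (fun t => Normc.normc (f1 (rt t))) (fun t => normc_ge0 _)).
exact: (sc (fun t => G (rt t)) (fun t => G0 _)).
Qed.

End Interp.

(** * The upper bound for the Besov norm *)

Section Besov.
Context {R : realType} {d : nat}.
Local Notation mR := (measurableTypeR R).
Local Notation E := 'rV[R]_d.
Local Notation C := R[i].
Local Notation T := (d.-tuple mR).
Local Notation lam := (@lebesgue_tuple R d).
Local Notation rt := (@row_of_tuple R d).

Lemma fine_inv_fin (r : R) : r != 0 -> fine ((r%:E)^-1)%E = r^-1.
Proof. by move=> r0; rewrite /inve (negbTE r0). Qed.

(** The smoothness [1/p] is the one for which an L^1 gain of [2^-k] is exactly
compensated. *)
Lemma theta_scale (p : \bar R) a b k : (1 < p)%E -> 0 <= b ->
  2 `^ (k%:R * fine (p^-1)%E) * theta p a (2 ^- k * b) = theta p a b.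
Proof.
case: p => [r| |//]; last by rewrite /inve /= mulr0 powRr0 mul1r.
rewrite lte_fin => r1 b0; have r0 : r != 0 by rewrite gt_eqF//; lra.
rewrite fine_inv_fin// powRrM powR_mulrn// /theta -powRM.
- congr (_ `^ _); rewrite mulrCA; congr (_ * _).
  by rewrite mulVKf// expf_neq0// pnatr_eq0.
- by rewrite exprn_ge0.
- by rewrite mulr_ge0 ?powR_ge0// mulr_ge0// invr_ge0 exprn_ge0.
Qed.

(** Here [p > 1] enters: the exponent of [a] is positive. *)
Lemma theta_small (p : \bar R) b e : (1 < p)%E -> 0 <= b -> 0 < e ->
  exists2 a0, 0 < a0 & forall a, 0 <= a <= a0 -> theta p a b <= e.
Proof.
case: p => [r| |//]; last by move=> _ _ e0; exists e => // a /andP[].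
rewrite lte_fin => r1 b0 e0; have r0 : 0 < r by lra.
pose q := e `^ r / (1 + b).
have q0 : 0 < q by rewrite divr_gt0 ?powR_gt0//; lra.
exists (q `^ (r - 1)^-1); first exact: powR_gt0.
move=> a /andP[a0 aq] /=.
have h1 : a `^ (r - 1) <= q.
  apply: (@le_trans _ _ ((q `^ (r - 1)^-1) `^ (r - 1))).
    by apply: ge0_ler_powR; rewrite ?nnegrE ?powR_ge0//; lra.
  by rewrite -powRrM mulVf ?powRr1 ?(ltW q0)// gt_eqF//; lra.
have h2 : a `^ (r - 1) * b <= e `^ r.
  apply: (@le_trans _ _ (q * (1 + b))); last by rewrite /q divfK// gt_eqF//; lra.
  by rewrite ler_pM ?powR_ge0//; lra.
apply: (@le_trans _ _ ((e `^ r) `^ r^-1)).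
  apply: ge0_ler_powR; rewrite ?nnegrE ?powR_ge0 ?mulr_ge0 ?powR_ge0//.
  by rewrite invr_ge0 ltW.
by rewrite -powRrM mulfV ?powRr1 ?(ltW e0)// gt_eqF.
Qed.

Definition kmass (phi : E -> C) : R :=
  rint (fun z => `|kernel_re phi z| * (1 + `|z|)) + rint (fun z => `|kernel_im phi z| * (1 + `|z|)).

Section Gen.
Variables (phi : E -> C) (hphi : lp_generator phi).

Lemma rint_norm_le_moment (K : E -> R) : rapid K ->
  rint (fun z => `|K z|) <= rint (fun z => `|K z| * (1 + `|z|)).
Proof.
move=> rK; apply: le_rint; [by apply: summ_norm; exact: rapid_summ|exact: rapid_moment1|].
by move=> z; rewrite ler_peMr// lerDl.
Qed.

Lemma moment_ge0 (K : E -> R) : 0 <= rint (fun z => `|K z| * (1 + `|z|)).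
Proof. by apply: rint_ge0 => z; rewrite mulr_ge0// addr_ge0. Qed.

Lemma kmass_ge0 : 0 <= kmass phi.
Proof. by rewrite addr_ge0// moment_ge0. Qed.

(** A measurable majorant of the modulus of a block with both bounds, on which
the interpolation is carried out. *)
Lemma block_dominated (f : E -> C) a V k :
  bdd a (fun x => complex.Re (f x)) -> bdd a (fun x => complex.Im (f x)) ->
  bv V (fun x => complex.Re (f x)) -> bv V (fun x => complex.Im (f x)) ->
  exists G : E -> R, [/\ meas G,
    forall x, Normc.normc (lp_block phi k (dist_of f) x) <= G x <= 8 * kmass phi * a &
    (eint G <= (2 ^- k * (4 * kmass phi * V))%:E)%E].
Proof.
move=> b1 b2 v1 v2.
have [rr ri] := (kernel_re_rapid hphi, kernel_im_rapid hphi).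
have [sr si] := (rapid_summ rr, rapid_summ ri).
pose N (F K : E -> R) (x : E) := `|block F K k x|.
pose G1 (x : E) := N (fun x => complex.Re (f x)) (kernel_re phi) x + N (fun x => complex.Im (f x)) (kernel_im phi) x.
pose G2 (x : E) := N (fun x => complex.Re (f x)) (kernel_im phi) x + N (fun x => complex.Im (f x)) (kernel_re phi) x.
have a0 : 0 <= a by case: b1 => _ b; apply: le_trans (b 0).
have mN F K : bdd a F -> rapid K -> meas (N F K).
  by move=> bF rK; apply: meas_norm; exact: (meas_block k bF (rapid_summ rK)).
have V0 : 0 <= V by case: v1.
have km K : K = kernel_re phi \/ K = kernel_im phi ->
    rint (fun z => `|K z| * (1 + `|z|)) <= kmass phi.
  by case=> ->; rewrite /kmass; [rewrite lerDl|rewrite lerDr]; exact: moment_ge0.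
have bN F K x : bdd a F -> rapid K -> K = kernel_re phi \/ K = kernel_im phi ->
    N F K x <= 2 * kmass phi * a.
  move=> bF rK hK; apply: le_trans (block_bound k x bF (rapid_summ rK)) _.
  rewrite -mulrA ler_wpM2l// mulrC ler_wpM2r//.
  exact: le_trans (rint_norm_le_moment rK) (km K hK).
have eN F K : bdd a F -> rapid K -> bv V F -> K = kernel_re phi \/ K = kernel_im phi ->
    (eint (N F K) <= (2 ^- k * (kmass phi * V))%:E)%E.
  move=> bF rK vF hK; apply: le_trans (block_L1 k bF rK vF) _.
  rewrite lee_fin -mulrA ler_wpM2l ?invr_ge0 ?exprn_ge0// mulrC ler_wpM2r//.
  exact: km.
have N0 F K x : 0 <= N F K x := normr_ge0 _.
have mG1 : meas G1 := measD (mN _ _ b1 rr) (mN _ _ b2 ri).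
have mG2 : meas G2 := measD (mN _ _ b1 ri) (mN _ _ b2 rr).
exists (fun x => G1 x + G2 x); split.
- exact: measD mG1 mG2.
- move=> x; apply/andP; split; last first.
    have four (u1 u2 u3 u4 m : R) : u1 <= 2 * m * a -> u2 <= 2 * m * a ->
      u3 <= 2 * m * a -> u4 <= 2 * m * a -> u1 + u2 + (u3 + u4) <= 8 * m * a by lra.
    apply: four; [exact: (bN _ _ x b1 rr (or_introl erefl))|
      exact: (bN _ _ x b2 ri (or_intror erefl))|
      exact: (bN _ _ x b1 ri (or_intror erefl))|
      exact: (bN _ _ x b2 rr (or_introl erefl))].
  rewrite (lp_blockE hphi k x b1 b2); apply: le_trans (normc_le _) _ => /=.
  by rewrite lerD//; [exact: ler_normB|exact: ler_normD].
have G10 x : 0 <= G1 x by rewrite addr_ge0// N0.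
have G20 x : 0 <= G2 x by rewrite addr_ge0// N0.
rewrite (eintD mG1 mG2 G10 G20).
pose re x := complex.Re (f x); pose im x := complex.Im (f x).
pose m := 2 ^- k * (kmass phi * V).
have E1 : (eint G1 <= (m + m)%:E)%E.
  rewrite EFinD (_ : eint G1 = (eint (N re (kernel_re phi)) + eint (N im (kernel_im phi)))%E).
    apply: leeD; [exact: (eN _ _ b1 rr v1 (or_introl erefl))|
      exact: (eN _ _ b2 ri v2 (or_intror erefl))].
  by apply: eintD; [exact: mN|exact: mN|exact: N0|exact: N0].
have E2 : (eint G2 <= (m + m)%:E)%E.
  rewrite EFinD (_ : eint G2 = (eint (N re (kernel_im phi)) + eint (N im (kernel_re phi)))%E).
    apply: leeD; [exact: (eN _ _ b1 ri v1 (or_intror erefl))|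
      exact: (eN _ _ b2 rr v2 (or_introl erefl))].
  by apply: eintD; [exact: mN|exact: mN|exact: N0|exact: N0].
have -> : 2 ^- k * (4 * kmass phi * V) = (m + m) + (m + m) by rewrite /m; ring.
by rewrite (EFinD (m + m)); exact: (leeD E1 E2).
Qed.

Section P.
Variables (p : \bar R) (p1 : (1 < p)%E).
Local Notation s := (fine (p^-1)%E).

Lemma besov_norm_bound (f : E -> C) a V :
  bdd a (fun x => complex.Re (f x)) -> bdd a (fun x => complex.Im (f x)) ->
  bv V (fun x => complex.Re (f x)) -> bv V (fun x => complex.Im (f x)) ->
  (besov_norm phi s p +oo (dist_of f) <=
    (theta p (8 * kmass phi * a) (4 * kmass phi * V))%:E)%E.
Proof.
move=> b1 b2 v1 v2; apply/besov_norm_leP => k.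
have a0 : 0 <= a by case: b1 => _ b; apply: le_trans (b 0).
have V0 : 0 <= V by case: v1.
have k0 := kmass_ge0.
have [G [mG fG eG]] := block_dominated k b1 b2 v1 v2.
have aa : 0 <= 8 * kmass phi * a by rewrite !mulr_ge0.
have H := cLnorm_le p1 aa mG fG eG.
rewrite /bterm -(theta_scale _ k p1); last by rewrite !mulr_ge0.
by rewrite EFinM; apply: lee_wpmul2l H; rewrite lee_fin powR_ge0.
Qed.

(** Adding a small function to a distribution of small Besov norm; the
distribution is arbitrary, hence [cLnorm_perturb] rather than the triangle
inequality of L^p. *)
Lemma besov_norm_perturb (f : E -> C) T1 T2 a V e :
  bdd a (fun x => complex.Re (f x)) -> bdd a (fun x => complex.Im (f x)) ->
  bv V (fun x => complex.Re (f x)) -> bv V (fun x => complex.Im (f x)) ->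
  theta p (8 * kmass phi * a) (4 * kmass phi * V) <= e ->
  (besov_norm phi s p +oo T1 <= e%:E)%E ->
  (forall k x, lp_block phi k T2 x = (lp_block phi k T1 x + lp_block phi k (dist_of f) x)%R) ->
  (besov_norm phi s p +oo T2 <= (4 * e)%:E)%E.
Proof.
move=> b1 b2 v1 v2 the /besov_norm_leP T1e T2E; apply/besov_norm_leP => k.
have a0 : 0 <= a by case: b1 => _ b; apply: le_trans (b 0).
have V0 : 0 <= V by case: v1.
have k0 := kmass_ge0.
have [G [mG fG eG]] := block_dominated k b1 b2 v1 v2.
have aa : 0 <= 8 * kmass phi * a by rewrite !mulr_ge0.
pose w : R := 2 `^ (k%:R * s).
have w0 : 0 < w by exact: powR_gt0.
have the' : theta p (8 * kmass phi * a) (2 ^- k * (4 * kmass phi * V)) <= w^-1 * e.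
  by rewrite ler_pdivlMl// theta_scale// !mulr_ge0.
have T1k : (cLnorm p (lp_block phi k T1) <= (w^-1 * e)%:E)%E.
  rewrite -(@lee_pmul2l _ w%:E)//.
  by rewrite -EFinM mulVKf ?gt_eqF//; exact: T1e.
have := cLnorm_perturb p1 aa mG fG eG the' T1k.
have E2 : lp_block phi k T2 =
    (fun x => (lp_block phi k T1 x + lp_block phi k (dist_of f) x)%R).
  by apply/funext => x; exact: T2E.
rewrite /bterm E2.
move=> h; rewrite (_ : 4 * e = w * (4 * (w^-1 * e))); last first.
  by rewrite mulrCA mulVKf// gt_eqF.
rewrite EFinM; apply: lee_wpmul2l; last exact: h.
by rewrite lee_fin ltW.
Qed.

End P.
End Gen.

Lemma summ_cmul a (g psi : E -> C) :
  bdd a (fun x => complex.Re (g x)) -> bdd a (fun x => complex.Im (g x)) ->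
  summ (fun x => complex.Re (psi x)) -> summ (fun x => complex.Im (psi x)) ->
  summ (fun x => complex.Re (g x * psi x)) /\ summ (fun x => complex.Im (g x * psi x)).
Proof.
move=> [m1 b1] [m2 b2] s1 s2; split.
  have := summB (summM m1 b1 s1) (summM m2 b2 s2).
  by congr summ; apply/funext => x; rewrite cReM.
have := summD (summM m1 b1 s2) (summM m2 b2 s1).
by congr summ; apply/funext => x; rewrite cImM.
Qed.

Lemma dist_ofB (f g : E -> C) a :
  bdd a (fun x => complex.Re (f x)) -> bdd a (fun x => complex.Im (f x)) ->
  bdd a (fun x => complex.Re (g x)) -> bdd a (fun x => complex.Im (g x)) ->
  (dist_of f \- dist_of g)%R = dist_of (fun x => f x - g x).
Proof.
move=> f1 f2 g1 g2; apply/funext => psi; rewrite /dist_of /=.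
case: asboolP => [/schwartz_rapidP[/rapid_summ s1 /rapid_summ s2]|_]; last by rewrite subr0.
have [f3 f4] := summ_cmul f1 f2 s1 s2; have [g3 g4] := summ_cmul g1 g2 s1 s2.
rewrite !cintegralE.
have -> : rint (fun x => complex.Re ((f x - g x) * psi x)) =
    rint (fun x => complex.Re (f x * psi x)) - rint (fun x => complex.Re (g x * psi x)).
  by rewrite -rintB//; apply: eq_rint => x; rewrite mulrBl cReB.
have -> : rint (fun x => complex.Im ((f x - g x) * psi x)) =
    rint (fun x => complex.Im (f x * psi x)) - rint (fun x => complex.Im (g x * psi x)).
  by rewrite -rintB//; apply: eq_rint => x; rewrite mulrBl cImB.
by [].
Qed.

End Besov.

(** * Approximation by step functions of bounded variation *)

Section Step.
Context {R : realType} {d : nat}.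
Local Notation E := 'rV[R]_d.
Implicit Types F G : E -> R.

Lemma bvB V1 V2 F G : bv V1 F -> bv V2 G -> bv (V1 + V2) (fun x => F x - G x).
Proof.
move=> [sF V10 F1 FV] [sG V20 G1 GV]; split.
- exact: summB.
- exact: addr_ge0.
- apply: le_trans (lerD F1 G1); rewrite -rintD; [|exact: summ_norm..].
  apply: le_rint; [by apply: summ_norm; exact: summB|by apply: summD; exact: summ_norm|].
  by move=> x; exact: ler_normB.
move=> v; rewrite mulrDl; apply: le_trans (lerD (FV v) (GV v)).
have sFv : summ (fun x => `|F (x + v) - F x|).
  by apply: summ_norm; apply: summB => //; exact: summ_shift.
have sGv : summ (fun x => `|G (x + v) - G x|).
  by apply: summ_norm; apply: summB => //; exact: summ_shift.
rewrite -rintD//; apply: le_rint; [|exact: summD|].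
  by apply: summ_norm; exact: (summB (summ_shift v (summB sF sG)) (summB sF sG)).
move=> x; rewrite (_ : _ - _ = (F (x + v) - F x) - (G (x + v) - G x)); last by ring.
exact: ler_normB.
Qed.

Lemma wt_ratio (x v : E) : wt (x + v) <= (1 + `|v|) ^+ (2 * d) * wt x.
Proof.
rewrite /wt ler_pdivlMr ?exprn_gt0 ?norm1_gt0//.
rewrite mulrC ler_pdivrMr ?exprn_gt0 ?norm1_gt0// -exprMn.
rewrite lerXn2r ?nnegrE ?mulr_ge0 ?addr_ge0//.
have : `|x| <= `|x + v| + `|v|.
  by rewrite -[X in `|X| <= _](addrK v) (le_trans (ler_normB _ _)).
have := normr_ge0 (x + v); have := normr_ge0 v.
by move: `|x| `|v| `|x + v| => a b c b0 c0 h; nra.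
Qed.

Lemma pow1D_le (a : R) m : 0 <= a <= 1 -> (1 + a) ^+ m - 1 <= a * 2 ^+ m.
Proof.
move=> /andP[a0 a1]; elim: m => [|m IH]; first by rewrite !expr0 subrr mulr1.
rewrite !exprS; have p : (1 + a) ^+ m <= 2 ^+ m.
  by rewrite lerXn2r ?nnegrE ?addr_ge0//; lra.
move: ((1 + a) ^+ m) (2 ^+ m) IH p => u w IH p; nra.
Qed.

Lemma dist_le_ratio (q z w w' n : R) : w' <= q * w -> w <= q * w' ->
  0 < w -> 0 < w' -> 1 <= q -> q - 1 <= n * z -> `|w' - w| <= z * n * w.
Proof.
move=> h1 h2 w0 w'0 q1 qz.
have qw : (q - 1) * w <= z * n * w by rewrite ler_wpM2r ?(ltW w0)//; lra.
rewrite ler_norml; apply/andP; split; last by lra.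
have qw0 : 0 <= (q - 1) * w by rewrite mulr_ge0 ?(ltW w0)//; lra.
have [ww|ww] := leP w w'; first by lra.
have : (q - 1) * w' <= (q - 1) * w by rewrite ler_wpM2l//; lra.
lra.
Qed.

Lemma wt_lip (x v : E) : `|v| <= 1 ->
  `|wt (x + v) - wt x| <= 2 ^+ (2 * d) * `|v| * wt x.
Proof.
move=> v1; have h1 := wt_ratio x v; have h2 := wt_ratio (x + v) (- v).
rewrite addrK normrN in h2.
apply: dist_le_ratio h1 h2 (wt_gt0 _) (wt_gt0 _) _ _.
  by rewrite exprn_ege1// lerDl.
by apply: pow1D_le; rewrite normr_ge0.
Qed.

Definition wmass : R := rint (@wt R d).

Lemma wmass_ge0 : 0 <= wmass.
Proof. by apply: rint_ge0 => x; exact: wt_ge0. Qed.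

Lemma wt_le1 (x : E) : wt x <= 1.
Proof. by rewrite /wt invf_le1 ?exprn_gt0 ?norm1_gt0// exprn_ege1// lerDl. Qed.

(** For shifts longer than one, the modulus of continuity is bounded by twice the
L^1 norm. *)
Lemma bv_intro V F : summ F -> 0 <= V -> rint (fun x => `|F x|) <= V ->
  (forall v, `|v| <= 1 -> rint (fun x => `|F (x + v) - F x|) <= V * `|v|) ->
  bv (2 * V) F.
Proof.
move=> sF V0 F1 FV; split => //.
- exact: mulr_ge0.
- by lra.
move=> v; have [v1|v1] := leP `|v| 1.
  by apply: le_trans (FV v v1) _; rewrite -mulrA ler_peMl ?mulr_ge0// ler1n.
have sv := summ_shift v sF.
apply: (@le_trans _ _ (2 * rint (fun x => `|F x|))).
  rewrite mulr_natl mulr2n -{1}(rint_shift v (summ_norm sF)).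
  rewrite -rintD; [|exact: (summ_shift v (summ_norm sF))|exact: summ_norm].
  apply: le_rint; [by apply: summ_norm; exact: summB| |].
    by apply: summD; [exact: (summ_shift v (summ_norm sF))|exact: summ_norm].
  by move=> x; exact: ler_normB.
rewrite -mulrA ler_wpM2l//; apply: le_trans F1 _.
by rewrite ler_peMr// (ltW v1).
Qed.

Lemma wlip_summ C F : wlip C F -> summ F.
Proof. by move=> [mF C0 bF _]; exact: summ_le mF bF (summZ C summ_wt). Qed.

Lemma wlip_bv C F : wlip C F -> bv (2 * (C * wmass)) F.
Proof.
move=> wF; have sF := wlip_summ wF; case: wF => mF C0 bF lF.
have Cw : summ (fun x : E => C * wt x) by exact: summZ summ_wt.
apply: bv_intro => //; first by rewrite mulr_ge0// wmass_ge0.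
  rewrite /wmass -rintZ; last exact: summ_wt.
  by apply: le_rint => //; exact: summ_norm.
move=> v v1; rewrite mulrAC /wmass -rintZ; last exact: summ_wt.
apply: le_rint; [|exact: summZ summ_wt|by move=> x; exact: lF].
by apply: summ_norm; apply: summB => //; exact: summ_shift.
Qed.

(** Two points within distance three of [x] suffice to compare the values at the
grid points of [x] and of a neighbour. *)
Lemma wlip_wide C F (x u w : E) : wlip C F -> `|u - x| <= 3 -> `|w - x| <= 3 ->
  `|F u - F w| <= 2 * 4 ^+ (2 * d) * C * `|u - w| * wt x.
Proof.
move=> [mF C0 bF lF] ux wx.
have four y : `|y - x| <= 3 -> wt y <= 4 ^+ (2 * d) * wt x.
  move=> yx; have := wt_ratio x (y - x); rewrite addrC subrK => /le_trans; apply.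
  by rewrite ler_wpM2r ?wt_ge0// lerXn2r ?nnegrE ?addr_ge0//; lra.
have hu := four u ux; have hw := four w wx.
have Cw0 : 0 <= 4 ^+ (2 * d) * wt x by rewrite mulr_ge0 ?wt_ge0// exprn_ge0.
have -> : 2 * 4 ^+ (2 * d) * C * `|u - w| * wt x =
   2 * (C * (4 ^+ (2 * d) * wt x) * `|u - w|) by ring.
have K0 : 0 <= C * (4 ^+ (2 * d) * wt x) by rewrite mulr_ge0.
have [uw|uw] := leP `|u - w| 1.
  have := lF w (u - w) uw; rewrite [w + _]addrC subrK => /le_trans; apply.
  have : C * `|u - w| * wt w <= C * (4 ^+ (2 * d) * wt x) * `|u - w|.
    by rewrite mulrAC ler_wpM2r// ler_wpM2l.
  move=> /le_trans; apply.
  by rewrite ler_peMl ?ler1n// mulr_ge0.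
apply: le_trans (ler_normB _ _) _.
have h1 : `|F u| <= C * (4 ^+ (2 * d) * wt x).
  by apply: le_trans (bF u) _; rewrite ler_wpM2l.
have h2 : `|F w| <= C * (4 ^+ (2 * d) * wt x).
  by apply: le_trans (bF w) _; rewrite ler_wpM2l.
move: (C * (4 ^+ (2 * d) * wt x)) `|u - w| uw K0 h1 h2 => K n n1 K0 h1 h2; nra.
Qed.

Definition gridc N (t : R) : R := (Num.floor (2 ^+ N * t))%:~R / 2 ^+ N.

Lemma gridE N (x : E) i : grid N x ord0 i = gridc N (x ord0 i).
Proof. by rewrite mxE. Qed.

Lemma gridc_itv N t : 0 <= t - gridc N t <= 1.
Proof.
rewrite /gridc; have p : 0 < 2 ^+ N :> R by rewrite exprn_gt0.
set y := 2 ^+ N * t; have /andP[h1 h2] := floor_itv y.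
have -> : t = y / 2 ^+ N by rewrite /y [2 ^+ N * _]mulrC mulfK// gt_eqF.
rewrite -mulrBl mulr_ge0 ?subr_ge0 ?invr_ge0 ?(ltW p)//=.
rewrite ler_pdivrMr// mul1r; apply: (@le_trans _ _ 1).
  by move: h2; rewrite intrD; lra.
by rewrite exprn_ege1// ler1n.
Qed.

Lemma gridc_mono N s t : s <= t -> gridc N s <= gridc N t.
Proof.
move=> st; rewrite /gridc ler_wpM2r ?invr_ge0 ?exprn_ge0//.
by rewrite ler_int le_floor// ler_wpM2l ?exprn_ge0.
Qed.

Lemma meas_gridc N (i : 'I_d) : meas (fun x : E => gridc N (x ord0 i)).
Proof.
have := @meas_grid R d (fun x => x ord0 i) N; congr meas.
by apply/funext => x /=; rewrite gridE.
Qed.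

(** The step function [gridc N] is monotone, so its increments have a
constant sign, and it differs from the identity by a bounded function [b].  The
integral of [b(x+v) - b(x)] against the weight is moved to the weight by
translation, where the Lipschitz bound applies; hence a bound in [|v|] that does not
depend on [N]. *)
Lemma grid_coord_int N (i : 'I_d) (v : E) : `|v| <= 1 ->
  summ (fun x : E => wt x * `|gridc N (x ord0 i + v ord0 i) - gridc N (x ord0 i)|) /\
  rint (fun x : E => wt x * `|gridc N (x ord0 i + v ord0 i) - gridc N (x ord0 i)|)
   <= (1 + 2 ^+ (2 * d)) * wmass * `|v|.
Proof.
move=> v1; pose b (x : E) := gridc N (x ord0 i) - x ord0 i.
have mb : meas b by apply: measB; [exact: meas_gridc|exact: meas_coord].
have b1 x : `|b x| <= 1.
  have := gridc_itv N (x ord0 i); rewrite /b => /andP[h1 h2].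
  by rewrite ler_norml; apply/andP; split; lra.
(* the common sign of all increments of gridc N in the direction v *)
pose sg : R := if 0 <= v ord0 i then 1 else -1.
have E1 x : wt x * `|gridc N (x ord0 i + v ord0 i) - gridc N (x ord0 i)| =
    `|v ord0 i| * wt x + sg * (b (x + v) * wt x - b x * wt x).
  rewrite /sg /b mxE; case: ifPn => v0.
    rewrite !ger0_norm// ?subr_ge0 ?gridc_mono ?lerDl//; ring.
  rewrite -ltNge in v0.
  rewrite !ler0_norm ?(ltW v0)// ?subr_le0 ?gridc_mono ?gerDl ?(ltW v0)//; ring.
have s1 : summ (fun x : E => b x * wt x) by exact: summM mb b1 summ_wt.
have s2 : summ (fun x : E => b (x + v) * wt x).
  apply: (@summM _ _ (fun x => b (x + v)) _ 1) summ_wt => //.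
  by have := meas_affine 1 v mb; congr meas; apply/funext => x; rewrite scale1r.
have s2' : summ (fun x : E => b x * wt (x - v)).
  exact: summM mb b1 (summ_shift (- v) summ_wt).
have e2 : rint (fun x : E => b (x + v) * wt x) = rint (fun x : E => b x * wt (x - v)).
  by rewrite -(rint_shift v s2'); apply: eq_rint => x; rewrite addrK.
have s0 : summ (fun x : E => `|v ord0 i| * wt x) by exact: summZ summ_wt.
have s3 := summZ sg (summB s2 s1).
split.
  have := summD s0 s3; by congr summ; apply/funext => x; rewrite E1.
rewrite (eq_rint E1) rintD// (rintZ _ summ_wt) (rintZ sg (summB s2 s1)).
rewrite rintB// e2 -rintB//.
rewrite -[leRHS](_ : wmass * `|v| + 2 ^+ (2 * d) * wmass * `|v| = _); last by ring.
apply: lerD; first by rewrite mulrC ler_wpM2l ?wmass_ge0// coord_le_norm.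
apply: le_trans (ler_norm _) _; rewrite normrM.
have -> : `|sg| = 1 by rewrite /sg; case: ifP => _; rewrite ?normrN normr1.
rewrite mul1r mulrAC -rintZ; last exact: summ_wt.
apply: rint_bound; [by apply: summ_meas; exact: summB|exact: summZ summ_wt|].
move=> x; rewrite -mulrBr normrM.
apply: le_trans (_ : `|wt (x - v) - wt x| <= _); first by rewrite ler_piMl.
by have := @wt_lip x (- v); rewrite normrN; apply.
Qed.

Lemma norm_le_sum (x : E) : `|x| <= \sum_i `|x ord0 i|.
Proof.
apply: norm_le_row => [|i]; first exact: sumr_ge0.
by rewrite (bigD1 i)//= lerDl sumr_ge0.
Qed.

Lemma grid_near N (x : E) : `|grid N x - x| <= 1.
Proof.
rewrite distrC; apply: le_trans (grid_norm N x) _.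
by rewrite invf_le1 ?exprn_gt0// exprn_ege1// ler1n.
Qed.

Definition stepK : R := 2 * (2 * wmass + 2 * 4 ^+ (2 * d) * (d%:R * ((1 + 2 ^+ (2 * d)) * wmass))).

(** The increment of [F] between two grid points is at most a constant times the
sum of the increments of the coordinates of the grid, which [grid_coord_int]
integrates; the constant is independent of [N]. *)
Lemma wlip_step C F N : wlip C F -> bv (stepK * C) (F \o grid N).
Proof.
move=> wF; have [mF C0 bF lF] := wF.
have mH := @meas_grid R d F N.
have Hx x : `|(F \o grid N) x| <= 2 * C * wt x.
  have := lF x (grid N x - x) (grid_near N x); rewrite [x + _]addrC subrK /= => h.
  have h2 : C * `|grid N x - x| * wt x <= C * wt x.
    by rewrite ler_wpM2r ?wt_ge0// ler_piMr// grid_near.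
  rewrite -[F (grid N x)](subrK (F x)); apply: le_trans (ler_normD _ _) _.
  by have := bF x; lra.
have sH : summ (F \o grid N) by exact: summ_le mH Hx (summZ _ summ_wt).
have W0 := wmass_ge0.
have K0 : 0 <= 2 * 4 ^+ (2 * d) * (d%:R * ((1 + 2 ^+ (2 * d)) * wmass)) :> R.
  by rewrite !mulr_ge0 ?exprn_ge0// addr_ge0 ?exprn_ge0.
rewrite /stepK -mulrA; apply: bv_intro => //.
- by rewrite mulr_ge0// addr_ge0// mulr_ge0.
- apply: (@le_trans _ _ (2 * C * wmass)); last first.
    have -> : 2 * C * wmass = 2 * wmass * C :> R by ring.
    by rewrite [leRHS]mulrDl lerDl; exact: mulr_ge0 K0 C0.
  rewrite /wmass -rintZ; last exact: summ_wt.
  apply: le_rint; [exact: summ_norm|exact: summZ summ_wt|exact: Hx].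
move=> v v1.
pose A := 2 * 4 ^+ (2 * d) * C.
have A0 : 0 <= A by rewrite !mulr_ge0 ?exprn_ge0.
pose D i (x : E) := wt x * `|gridc N (x ord0 i + v ord0 i) - gridc N (x ord0 i)|.
have sD i : summ (D i) by exact: (grid_coord_int N i v1).1.
apply: (@le_trans _ _ (rint (fun x => A * \sum_i D i x))).
  apply: le_rint.
  - by apply: summ_norm; apply: summB => //; exact: summ_shift.
  - by apply: summZ; exact: summ_sum.
  move=> x; have h1 : `|grid N (x + v) - x| <= 3.
    have -> : grid N (x + v) - x = (grid N (x + v) - (x + v)) + v.
      by move: (grid N (x + v)) => g; apply/rowP => i; rewrite !mxE; ring.
    by have := ler_normD (grid N (x + v) - (x + v)) v; have := grid_near N (x + v); lra.
  have h2 : `|grid N x - x| <= 3 by have := grid_near N x; lra.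
  apply: le_trans (wlip_wide wF h1 h2) _.
  rewrite -/A -mulrA ler_wpM2l// mulrC /D -mulr_sumr ler_wpM2l ?wt_ge0//.
  apply: le_trans (norm_le_sum _) _; apply: ler_sum => i _.
  by rewrite !mxE.
rewrite rintZ; last exact: summ_sum.
rewrite rint_sum//.
apply: (@le_trans _ _ (A * (d%:R * ((1 + 2 ^+ (2 * d)) * wmass * `|v|)))).
  rewrite ler_wpM2l//.
  have -> : d%:R * ((1 + 2 ^+ (2 * d)) * wmass * `|v|) =
     \sum_(i < d) (1 + 2 ^+ (2 * d)) * wmass * `|v|.
    by rewrite sumr_const card_ord mulr_natl.
  by apply: ler_sum => i _; exact: (grid_coord_int N i v1).2.
rewrite /A; set Z := (1 + 2 ^+ (2 * d)) * wmass.
rewrite (_ : 2 * 4 ^+ (2 * d) * C * (d%:R * (Z * `|v|)) =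
   2 * 4 ^+ (2 * d) * (d%:R * Z) * C * `|v|); last by ring.
rewrite ler_wpM2r// ler_wpM2r// lerDr mulr_ge0//.
Qed.

Lemma wlip_grid_dist C F N x : wlip C F -> `|F x - F (grid N x)| <= C * 2 ^- N.
Proof.
move=> [mF C0 bF lF].
have := lF x (grid N x - x) (grid_near N x); rewrite [x + _]addrC subrK distrC => /le_trans; apply.
rewrite -mulrA ler_wpM2l//.
apply: le_trans (_ : `|grid N x - x| <= _); first by rewrite ler_piMr// wt_le1.
by rewrite distrC grid_norm.
Qed.

(** Soft thresholding: it shrinks [t] towards [0] by [e]. *)
Definition soft (e t : R) := Num.max (t - e) 0 + Num.min (t + e) 0.

Lemma soft_lip e s t : 0 <= e -> `|soft e s - soft e t| <= `|s - t|.
Proof.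
move=> e0; have h (a b : R) : b <= a -> 0 <= soft e a - soft e b <= a - b.
  rewrite /soft => ba.
  case: (leP (a - e) 0) => h1; case: (leP (b - e) 0) => h2;
  case: (leP (a + e) 0) => h3; case: (leP (b + e) 0) => h4; apply/andP; split; lra.
have [st|/ltW st] := leP t s.
  by have /andP[h1 h2] := h _ _ st; rewrite !ger0_norm//; lra.
rewrite distrC [leRHS]distrC.
by have /andP[h1 h2] := h _ _ st; rewrite !ger0_norm//; lra.
Qed.

Lemma soft_small e t : `|t| <= e -> soft e t = 0.
Proof.
rewrite ler_norml => /andP[h1 h2]; rewrite /soft.
by case: (leP (t - e) 0) => h3; case: (leP (t + e) 0) => h4; lra.
Qed.

Lemma soft_dist e t : 0 <= e -> `|t - soft e t| <= e.
Proof.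
move=> e0; rewrite /soft ler_norml.
by case: (leP (t - e) 0) => h3; case: (leP (t + e) 0) => h4; apply/andP; split; lra.
Qed.

Lemma wlip_soft C F e : 0 <= e -> wlip C F -> wlip C (fun x => soft e (F x)).
Proof.
move=> e0 [mF C0 bF lF]; split => //.
- apply: measurable_funD.
    by apply: measurable_maxr => //; apply: measurable_funB.
  by apply: measurable_minr => //; apply: measurable_funD.
- move=> x; have := @soft_lip e (F x) 0 e0.
  by rewrite (@soft_small e 0) ?normr0// !subr0 => /le_trans; apply.
- by move=> x v v1; apply: le_trans (soft_lip _ _ e0) (lF x v v1).
Qed.

End Step.

(** * Step functions are Haar polynomials *)

Section Span.
Context {R : realType} {d : nat}.
Local Notation E := 'rV[R]_d.
Local Notation C := R[i].

Lemma span_gen (A : set (E -> C)) g : A g -> lin_span A g.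
Proof.
move=> Ag; exists 1%N, (fun=> 1), (fun=> g); split => //.
by apply/funext => x; rewrite big_ord1 mul1r.
Qed.

Lemma spanZ (A : set (E -> C)) c g : lin_span A g -> lin_span A (fun x => c * g x).
Proof.
move=> [n [a [h [Ah ->]]]]; exists n, (fun j => c * a j), h; split => //.
by apply/funext => x; rewrite mulr_sumr; apply: eq_bigr => j _; rewrite mulrA.
Qed.

Lemma spanD (A : set (E -> C)) f g : lin_span A f -> lin_span A g ->
  lin_span A (fun x => f x + g x).
Proof.
move=> [n [a [h [Ah ->]]]] [m [b [k [Ak ->]]]].
exists (n + m)%N,
  (fun j => match fintype.split j with inl i => a i | inr i => b i end),
  (fun j => match fintype.split j with inl i => h i | inr i => k i end); split.
  by move=> j; case: fintype.split.
apply/funext => x; rewrite big_split_ord /=; congr (_ + _); apply: eq_bigr => i _.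
  by rewrite (unsplitK (inl i)).
by rewrite (unsplitK (inr i)).
Qed.

Lemma span0 (A : set (E -> C)) : lin_span A (fun=> 0).
Proof.
exists 0%N, (fun=> 0), (fun=> fun=> 0); split; first by case.
by apply/funext => x; rewrite big_ord0.
Qed.

Lemma span_sum (A : set (E -> C)) (I : Type) (r : seq I) (F : I -> E -> C) :
  (forall i, lin_span A (F i)) -> lin_span A (fun x => \sum_(i <- r) F i x).
Proof.
move=> AF; elim: r => [|i r IH].
  by have := span0 A; congr lin_span; apply/funext => x; rewrite big_nil.
by have := spanD (AF i) IH; congr lin_span; apply/funext => x; rewrite big_cons.
Qed.

(** The indicator of a half interval is half the sum or half the difference of the
two one-dimensional Haar functions on the interval. *)
Lemma haar1_half (z : R) (b : bool) :
  haar1 false (2 * z - b%:R) =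
  \sum_(e : bool) (2^-1 * (if e && b then -1 else 1)) * haar1 e z.
Proof.
have e1 : (2 * z - b%:R \in `[0, 1[) = if b then (z \in `[2^-1, 1[) else (z \in `[0, 2^-1[).
  by case: b; rewrite /= !in_itv /=; apply/idP/idP => /andP[h1 h2]; apply/andP; split; lra.
have e2 : (z \in `[0, 1[) = (z \in `[0, 2^-1[) || (z \in `[2^-1, 1[).
  rewrite !in_itv /=; apply/idP/idP => [/andP[h1 h2]|/orP[]/andP[h1 h2]].
  - have [h|h] := ltP z 2^-1; first by rewrite h1.
    by rewrite ?h h2 ?orbT.
  - by apply/andP; split; lra.
  - by apply/andP; split; lra.
have e3 : ~~ ((z \in `[0, 2^-1[) && (z \in `[2^-1, 1[)).
  by rewrite !in_itv /=; apply/negP => /andP[/andP[h1 h2] /andP[h3 h4]]; lra.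
rewrite big_bool /= /haar1 /= !indicE !mem_setE e1 e2.
move: e3; case: (z \in `[0, 2^-1[); case: (z \in `[2^-1, 1[) => //= _;
  case: b {e1} => /=; lra.
Qed.

(** Induction on [N]: a cube of side [2^-(N+1)] sits in one of side [2^-N], and the
product over the coordinates of [haar1_half] expands into Haar functions of level
[N], the constant one being covered by the induction hypothesis. *)
Lemma haar_cell N (mu : 'I_d -> int) :
  lin_span haar_system (haar (fun=> false) N mu : E -> C).
Proof.
elim: N mu => [|N IH] mu.
  by apply: span_gen; left; exists mu.
pose nu i := (mu i %/ 2)%Z; pose b i := (mu i %% 2)%Z == 1.
have muE i : mu i = nu i * 2 + (b i)%:R.
  rewrite {1}(divz_eq (mu i) 2) /nu /b; congr (_ + _).
  have := modz_ge0 (mu i) (isT : (2 : int) != 0); have := ltz_pmod (mu i) (isT : 0 < (2 : int)).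
  by case: (mu i %% 2)%Z => // [[|[|n]]].
pose co (e : {ffun 'I_d -> bool}) : R := \prod_i (2^-1 * (if e i && b i then -1 else 1)).
have -> : haar (fun=> false) N.+1 mu = (fun x : E =>
    \sum_(e : {ffun 'I_d -> bool}) ((co e)%:C%C * haar e N nu x) : C).
  apply/funext => x; rewrite /haar.
  transitivity ((\sum_(e : {ffun 'I_d -> bool}) co e *
     \prod_i haar1 (e i) (2 ^+ N * x ord0 i - (nu i)%:~R))%:C%C : C); last first.
    by rewrite rmorph_sum; apply: eq_bigr => e _; rewrite rmorphM.
  congr (_%:C%C).
  transitivity (\prod_i \sum_(e : bool) (2^-1 * (if e && b i then -1 else 1)) *
     haar1 e (2 ^+ N * x ord0 i - (nu i)%:~R)).
    apply: eq_bigr => i _; rewrite -haar1_half; congr (haar1 _ _).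
    by rewrite exprS (muE i) intrD intrM; case: (b i) => /=; ring.
  rewrite bigA_distr_bigA; apply: eq_bigr => e _.
  by rewrite /co -big_split.
apply: span_sum => e; apply: spanZ.
have [e0|e0] := pselect ((e : 'I_d -> bool) = (fun=> false)).
  by rewrite e0; exact: IH.
by apply: span_gen; right; exists e, N, nu.
Qed.

Lemma haar_cellE N (mu : 'I_d -> int) (x : E) : haar (fun=> false) N mu x =
  ([forall i, Num.floor (2 ^+ N * x ord0 i) == mu i]%:R : R)%:C%C.
Proof.
rewrite /haar; congr (_%:C%C).
have e i : haar1 false (2 ^+ N * x ord0 i - (mu i)%:~R) =
    (Num.floor (2 ^+ N * x ord0 i) == mu i)%:R.
  rewrite /haar1 indicE mem_setE floor_eq in_itv /= subr_ge0 ltrBlDr.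
  by rewrite intrD addrC.
under eq_bigr do rewrite e.
case: (boolP [forall i, _]) => [/forallP h|/forallPn[i h]].
  by rewrite big1// => i _; rewrite (eqP (h i)) eqxx.
by rewrite (bigD1 i)//= (negbTE h) mul0r.
Qed.

(** Only the cubes that meet the support carry a nonzero value, and there are
finitely many: their indices lie in a box of side [2m]. *)
Lemma step_span (F : E -> R) r N : supported r F ->
  lin_span haar_system (fun x => (F (grid N x))%:C%C : C).
Proof.
move=> sF; pose m := (Num.truncn (2 ^+ N * (`|r| + 1))).+1.
have mr : 2 ^+ N * (`|r| + 1) < m%:R by exact: truncnS_gt.
pose muj (j : {ffun 'I_d -> 'I_(m + m)}) i : int := (j i)%:Z - m%:Z.
pose pt (j : {ffun 'I_d -> 'I_(m + m)}) : E := \row_i ((muj j i)%:~R / 2 ^+ N).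
have -> : (fun x => (F (grid N x))%:C%C : C) = (fun x : E =>
    \sum_(j : {ffun 'I_d -> 'I_(m + m)}) (F (pt j))%:C%C * haar (fun=> false) N (muj j) x).
  apply/funext => x.
  under eq_bigr do rewrite haar_cellE -rmorphM.
  rewrite -rmorph_sum; congr (_%:C%C).
  pose k i := Num.floor (2 ^+ N * x ord0 i).
  have [out|inn] := pselect (exists i, ~~ (- m%:Z <= k i < m%:Z)).
    have [i out'] := out.
    rewrite sF; last first.
      apply: lt_le_trans (coord_le_norm _ i); rewrite mxE -/(k i).
      have p : 0 < 2 ^+ N :> R by rewrite exprn_gt0.
      rewrite normrM normfV (gtr0_norm p) ltr_pdivlMr//.
      have h : m%:R <= `|(k i)%:~R : R| + 1.
        rewrite -intr_norm -[1]/(1%:~R) -[m%:R]/(m%:Z%:~R) -intrD ler_int.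
        by move: out'; rewrite negb_and -!ltNge => /orP[]; case: (k i) => //= q; lia.
      have := ler_norm r; have q1 : 1 <= 2 ^+ N :> R by rewrite exprn_ege1// ler1n.
      by move: mr h q1; move: (m%:R) `|(k i)%:~R| (2 ^+ N) `|r| => a b c e; nra.
    rewrite big1// => j _; case: forallP => [/(_ i)/eqP h|_]; last by rewrite mulr0.
    case/negP: out'; rewrite -[k i]/(Num.floor _) h /muj.
    by have := ltn_ord (j i); case: (j i) => q /= hq _; lia.
  have kin i : (- m%:Z <= k i < m%:Z) by apply: contrapT => /negP h; apply: inn; exists i.
  have kb i : (`|(k i + m%:Z)%R|%N < m + m)%N by have := kin i; lia.
  pose j0 : {ffun 'I_d -> 'I_(m + m)} := [ffun i => Ordinal (kb i)].
  have mj i : muj j0 i = k i by rewrite /muj ffunE /=; have := kin i; lia.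
  rewrite (bigD1 j0)//= big1 ?addr0 => [|j jj0].
    rewrite (_ : [forall i, _]) ?mulr1; last by apply/forallP => i; rewrite mj.
    by congr F; apply/rowP => i; rewrite !mxE mj.
  case: forallP => [h|_]; last by rewrite mulr0.
  case/eqP: jj0; apply/ffunP => i; apply/val_inj => /=.
  have /eqP := h i; rewrite -/(k i) -mj /muj.
  by move: (nat_of_ord (j0 i)) (nat_of_ord (j i)) => a b; lia.
by apply: span_sum => j; apply: spanZ; exact: haar_cell.
Qed.

End Span.

(** * The mass of the kernel of the generator *)

Section Fejer1.
Context {R : realType}.
Local Notation leb := (@lebesgue_measure R).

(** A tent function has the nonnegative, integrable Fourier transform [fejer], which
makes it a convenient test function for inverting the Fourier transform at one
point. *)
Definition tri (x : R) : R := Num.max (1 - `|x|) 0.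
Definition fejer (a : R) : R := if a == 0 then 1 else 2 * (1 - cos a) / a ^+ 2.

Lemma tri_ge0 x : 0 <= tri x. Proof. by rewrite le_max lexx orbT. Qed.

Lemma tri_le1 x : tri x <= 1.
Proof. by rewrite ge_max ler01 andbT gerBl. Qed.

Lemma continuous_tri : continuous tri.
Proof.
move=> x; apply: (@continuous_max _ _ (fun x : R => 1 - `|x|) (fun=> 0)).
  by apply: cvgB; [exact: cvg_cst|exact: norm_continuous].
exact: cvg_cst.
Qed.

(** An antiderivative of [(1 - x) (1 + K cos(a x))]. *)
Definition fejer_prim (a K x : R) : R :=
  if a == 0 then (1 + K) * (x - 2^-1 * x ^+ 2)
  else x - 2^-1 * x ^+ 2 + K * ((1 - x) * sin (a * x) / a - cos (a * x) / a ^+ 2).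

Lemma is_derive_sinM (a x : R) : is_derive x (1 : R) (fun x => sin (a * x)) (a * cos (a * x)).
Proof.
have h : is_derive x (1 : R) (fun x => a * x) a.
  by apply: is_derive_eq; rewrite /GRing.scale /= mulr1.
by apply: is_derive_eq; rewrite /GRing.scale /= mulrC.
Qed.

Lemma is_derive_cosM (a x : R) : is_derive x (1 : R) (fun x => cos (a * x)) (- a * sin (a * x)).
Proof.
have h : is_derive x (1 : R) (fun x => a * x) a.
  by apply: is_derive_eq; rewrite /GRing.scale /= mulr1.
by apply: is_derive_eq; rewrite /GRing.scale /=; ring.
Qed.

Lemma fejer_prim_derive (a K x : R) :
  is_derive x (1 : R) (fejer_prim a K) ((1 - x) * (1 + K * cos (a * x))).
Proof.
rewrite /fejer_prim; have [->|a0] := eqVneq a 0.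
  by apply: is_derive_eq; rewrite /GRing.scale /= mul0r cos0; field.
have h1 := is_derive_sinM a x; have h2 := is_derive_cosM a x.
by apply: is_derive_eq; rewrite /GRing.scale /=; field.
Qed.

Lemma fejer_half (a K : R) :
  (\int[leb]_(x in `[0%R, 1%R]) ((1 - x) * (1 + K * cos (a * x)))%:E =
   (2^-1 * (1 + K * fejer a))%:E)%E.
Proof.
have dF := fejer_prim_derive a K.
have cF : continuous (fejer_prim a K).
  move=> x; apply: differentiable_continuous; apply/derivable1_diffP.
  by have [] := dF x.
rewrite (@continuous_FTC2 _ _ (fejer_prim a K))//.
- rewrite -EFinB; congr _%:E; rewrite /fejer_prim /fejer.
  have [a0|a0] := eqVneq a 0; first by lra.
  by rewrite mulr1 mulr0 cos0 sin0; field.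
- apply: continuous_subspaceT => x.
  apply: cvgM; first by apply: cvgB; [exact: cvg_cst|exact: cvg_id].
  apply: cvgD; first exact: cvg_cst.
  apply: cvgM; first exact: cvg_cst.
  apply: (cvg_comp (fun x => a * x) (@cos R)); last exact: continuous_cos.
  by apply: cvgM; [exact: cvg_cst|exact: cvg_id].
- split.
  + by move=> x _; have [] := dF x.
  + by apply: cvg_at_right_filter; exact: cF.
  + by apply: cvg_at_left_filter; exact: cF.
- by move=> x _; rewrite derive1E; have [_ ->] := dF x.
Qed.

Lemma cos_even_tri (K t x y : R) :
  y * (1 + K * cos (t + x)) + y * (1 + K * cos (t - x)) =
  2 * (y * (1 + K * cos t * cos x)).
Proof. by rewrite cosD cosB; ring. Qed.

Lemma measurable_triM (K t a : R) :
  measurable_fun setT (fun x : R => tri x * (1 + K * cos (t + a * x))).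
Proof.
apply: continuous_measurable_fun => x.
apply: cvgM; first exact: continuous_tri.
apply: cvgD; first exact: cvg_cst.
apply: cvgM; first exact: cvg_cst.
apply: (cvg_comp (fun x => t + a * x) (@cos R)); last exact: continuous_cos.
by apply: cvgD; [exact: cvg_cst|apply: cvgM; [exact: cvg_cst|exact: cvg_id]].
Qed.

Lemma triM_ge0 (K c : R) x : `|K| <= 1 -> `|c| <= 1 -> 0 <= tri x * (1 + K * c).
Proof.
move=> K1 c1; rewrite mulr_ge0 ?tri_ge0//.
have : `|K * c| <= 1 by rewrite normrM mulr_ile1.
by rewrite ler_norml; lra.
Qed.

Lemma integral_tri_even (K a : R) : `|K| <= 1 ->
  (\int[leb]_x (tri x * (1 + K * cos (a * x)))%:E = (1 + K * fejer a)%:E)%E.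
Proof.
move=> K1.
have mm := measurable_triM K 0 a.
rewrite ge0_symfun_integralT; last 3 first.
- by move=> x; exact: triM_ge0 (norm_cos_le1 _).
- move=> x; apply: cvgM; first exact: continuous_tri.
  apply: cvgD; first exact: cvg_cst.
  apply: cvgM; first exact: cvg_cst.
  apply: (cvg_comp (fun x => a * x) (@cos R)); last exact: continuous_cos.
  by apply: cvgM; [exact: cvg_cst|exact: cvg_id].
- by move=> x /=; rewrite /tri normrN mulrN cosN.
have -> : (\int[leb]_(x in [set x | (0 <= x)%R]) (tri x * (1 + K * cos (a * x)))%:E =
    \int[leb]_(x in `[0%R, 1%R]) ((1 - x) * (1 + K * cos (a * x)))%:E)%E.
  rewrite integral_mkcond [RHS]integral_mkcond; apply: eq_integral => x _.
  rewrite !patchE; case: (boolP (x \in `[0, 1])) => [x01|xN].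
    have := x01; rewrite in_itv /= => /andP[x0 x1].
    rewrite mem_set//= mem_set//= /tri ger0_norm// max_l// subr_ge0//.
  case: ifPn => [|_].
    rewrite inE /= => x0; rewrite memNset /=; last by apply/negP.
    have x1 : 1 < x by move: xN; rewrite in_itv /= x0 /= -ltNge.
    by rewrite /tri ger0_norm// max_r ?mul0r// subr_le0 ltW.
  by rewrite memNset//=; exact/negP.
by rewrite fejer_half -EFinM; congr _%:E; field.
Qed.

(** The added constant [1] makes the integrand nonnegative, so that Tonelli's
theorem can be iterated over the coordinates; [K] is a free parameter in [-1, 1]
because that iteration changes it. *)
Lemma integral_tri (K t a : R) : `|K| <= 1 ->
  (\int[leb]_x (tri x * (1 + K * cos (t + a * x)))%:E =
    (1 + K * (cos t * fejer a))%:E)%E.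
Proof.
move=> K1.
pose F (x : R) : \bar R := (tri x * (1 + K * cos (t + a * x)))%:E.
have F0 x : (0 <= F x)%E by rewrite lee_fin triM_ge0// norm_cos_le1.
have mF : measurable_fun setT F by apply/measurable_EFinP; exact: measurable_triM.
pose G (x : R) : \bar R := (tri x * (1 + K * cos (t - a * x)))%:E.
have G0 x : (0 <= G x)%E by rewrite lee_fin triM_ge0// norm_cos_le1.
have mG : measurable_fun setT G.
  apply/measurable_EFinP; have := measurable_triM K t (- a).
  by congr measurable_fun; apply/funext => x; rewrite mulNr.
have E1 : (\int[leb]_x F x = \int[leb]_x G x)%E.
  rewrite (@integral_affine1 R (-1) 0)// ?oppr_eq0 ?oner_neq0//.
  rewrite normrN normr1 mul1e; apply: eq_integral => x _; rewrite /F /G.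
  by rewrite addr0 mulN1r /tri normrN mulrN.
have Kt : `|K * cos t| <= 1 by rewrite normrM mulr_ile1// norm_cos_le1.
have E2 : (\int[leb]_x F x + \int[leb]_x G x = 2%:E * (1 + K * cos t * fejer a)%:E)%E.
  rewrite -ge0_integralD// -(integral_tri_even a Kt) -ge0_integralZl//; last 2 first.
  - apply/measurable_EFinP; have := measurable_triM (K * cos t) 0 a.
    by congr measurable_fun; apply/funext => x; rewrite add0r.
  - by move=> x _; rewrite lee_fin triM_ge0// norm_cos_le1.
  apply: eq_integral => x _; rewrite /F /G -EFinD -EFinM; congr _%:E.
  exact: cos_even_tri.
rewrite -/F -E1 in E2 *.
have Ffin : (\int[leb]_x F x)%E \is a fin_num.
  rewrite ge0_fin_numE; last exact: integral_ge0.
  apply: (@le_lt_trans _ _ (\int[leb]_x F x + \int[leb]_x F x)%E).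
    by rewrite leeDl// integral_ge0.
  by rewrite E2 -EFinM ltry.
rewrite -(fineK Ffin) -EFinD -EFinM in E2 *.
move: E2 => [E2]; congr _%:E; rewrite mulrA; lra.
Qed.

Lemma fejer_ge0 a : 0 <= fejer a.
Proof.
rewrite /fejer; case: eqP => // _.
by rewrite mulr_ge0 ?invr_ge0 ?sqr_ge0// mulr_ge0// subr_ge0 cos_le1.
Qed.

Lemma fejer_le1 a : fejer a <= 1.
Proof.
rewrite /fejer; case: eqP => // /eqP a0.
have := @cos_taylor R 0 (a / 2); rewrite add0r cos0 sin0 mulr0 addr0 => h.
have ha : a = a / 2 + a / 2 by field.
have cE : cos a = 1 - 2 * sin (a / 2) ^+ 2.
  by have := cos2Dsin2 (a / 2); rewrite [X in cos X = _]ha cosD -!expr2; lra.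
rewrite cE ler_pdivrMr ?exprn_even_gt0// mul1r.
have := @sin_lip R 0 (a / 2); rewrite add0r sin0 subr0 => hs.
have : sin (a / 2) ^+ 2 <= (a / 2) ^+ 2.
  by rewrite -[leLHS]real_normK ?num_real// -[leRHS]real_normK ?num_real// lerXn2r ?nnegrE.
by rewrite expr_div_n; lra.
Qed.

Lemma fejer_bound a : fejer a <= 8 * (oneDsqr a)^-1.
Proof.
have p : 0 < oneDsqr a by rewrite /oneDsqr ltr_pwDl// sqr_ge0.
rewrite ler_pdivlMr//; have [a1|a1] := leP (a ^+ 2) 1.
  have := fejer_le1 a; have := fejer_ge0 a; rewrite /oneDsqr.
  by have := sqr_ge0 a; nra.
rewrite /fejer; have -> : (a == 0) = false.
  by apply/negP => /eqP a0; move: a1; rewrite a0 expr0n /= ltr10.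
have a2 : 0 < a ^+ 2 by lra.
rewrite mulrAC ler_pdivrMr// /oneDsqr.
have := cos_geN1 a; have := cos_le1 a; nra.
Qed.

Lemma measurable_fejer : measurable_fun setT fejer.
Proof.
rewrite -(setUv [set 0 : R]); apply/measurable_funU => //; first exact: measurableC.
split; first exact: measurable_fun_set1.
have op : open (~` [set 0 : R]) by apply: closed_openC; exact: closed_eq.
apply: (eq_measurable_fun (fun a => 2 * (1 - cos a) / a ^+ 2)).
  by move=> x; rewrite inE /= => /eqP x0; rewrite /fejer (negbTE x0).
apply: open_continuous_measurable_fun => // x.
rewrite inE /= => /eqP x0.
apply: cvgM; first apply: cvgM; first exact: cvg_cst.
  by apply: cvgB; [exact: cvg_cst|exact: continuous_cos].
apply: cvgV; first by rewrite expf_neq0.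
exact: exprn_continuous.
Qed.

End Fejer1.

Section Fejer1b.
Context {R : realType}.
Local Notation leb := (@lebesgue_measure R).

Definition fejerpi (t : R) : R := fejer (2 * pi * t).

Lemma measurable_fejerpi : measurable_fun setT fejerpi.
Proof.
apply: measurableT_comp; first exact: measurable_fejer.
apply: continuous_measurable_fun => x.
by apply: cvgM; [exact: cvg_cst|exact: cvg_id].
Qed.

Lemma fejerpi_ge0 t : 0 <= fejerpi t. Proof. exact: fejer_ge0. Qed.

Lemma fejerpi_bound t : fejerpi t <= 8 * (oneDsqr t)^-1.
Proof.
apply: le_trans (fejer_bound _) _; rewrite ler_pM2l//.
have p (x : R) : 0 < oneDsqr x by rewrite /oneDsqr ltr_pwDl// sqr_ge0.
rewrite lef_pV2 ?posrE// /oneDsqr lerD2l exprMn ler_peMl ?sqr_ge0//.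
by have := pi_ge2 R; move: (pi : R) => q; nra.
Qed.

Lemma fejerpi_mass : exists2 c : R, 0 < c & (\int[leb]_t (fejerpi t)%:E = c%:E)%E.
Proof.
have m8 : measurable_fun setT (fun t : R => 8 * (oneDsqr t)^-1).
  apply: measurable_funM; first exact: measurable_cst.
  by apply: continuous_measurable_fun; exact: continuous_oneDsqrV.
have mE : measurable_fun setT (fun t : R => (fejerpi t)%:E).
  by apply/measurable_EFinP; exact: measurable_fejerpi.
have I8 : (\int[leb]_t (8 * (oneDsqr t)^-1)%:E = (8 * pi)%:E)%E.
  under eq_integral do rewrite EFinM.
  rewrite ge0_integralZl// ?integral_oneDsqrV//.
  apply/measurable_EFinP; apply: continuous_measurable_fun; exact: continuous_oneDsqrV.
have fin : (\int[leb]_t (fejerpi t)%:E <= (8 * pi)%:E)%E.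
  rewrite -I8; apply: ge0_le_integral => //.
  - by move=> x _; rewrite lee_fin fejerpi_ge0.
  - exact/measurable_EFinP.
  - by move=> x _; rewrite lee_fin fejerpi_bound.
pose I := `[(2 * pi)^-1, pi^-1 : R].
have p0 : 0 < (pi : R) by exact: pi_gt0.
pose m : R := (1 - cos 1) / 2.
have pi2 := pi_ge2 R.
have m0 : 0 < m.
  rewrite divr_gt0// subr_gt0 -{2}(cos0 R) ltr_cos ?in_itv ?ltr01//= ?lexx ?pi_ge0//.
  by rewrite ler01 /=; lra.
have low : ((m * (2 * pi)^-1)%:E <= \int[leb]_t (fejerpi t)%:E)%E.
  apply: (@le_trans _ _ (\int[leb]_(t in [set` I]) m%:E)%E).
    rewrite integral_cst//= lebesgue_measure_itv/= lte_fin ltf_pV2 ?posrE ?mulr_gt0//.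
    rewrite ltr_pMl// ltr1n /= -EFinD -EFinM lee_fin ler_pM2l//.
    by rewrite invfM; move: ((pi : R)^-1) => q; lra.
  apply: (@le_trans _ _ (\int[leb]_(t in [set` I]) (fejerpi t)%:E)%E).
    apply: ge0_le_integral => //.
    - by move=> x _; rewrite lee_fin ltW.
    - exact: measurable_funS mE.
    move=> t /=; rewrite in_itv /= => /andP[t1 t2]; rewrite lee_fin.
    have a1 : 1 <= 2 * pi * t by rewrite -ler_pdivrMl ?mulr_gt0// mulr1.
    have a2 : 2 * pi * t <= 2.
      by rewrite -mulrA ger_pMr// -ler_pdivlMl// mulr1.
    rewrite /fejerpi; move: (2 * pi * t) a1 a2 => a a1 a2.
    have a0 : 0 < a by lra.
    rewrite /fejer gt_eqF// ler_pdivlMr ?exprn_gt0// /m.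
    have := cos_le1 (1 : R); have : cos a <= cos 1.
      have := a1; rewrite le_eqVlt => /orP[/eqP <- //|a1'].
      by apply/ltW; rewrite ltr_cos// in_itv /=; apply/andP; split; lra.
    move: (cos a) (cos 1) => u v uv v1.
    have aa : a ^+ 2 <= 4 by rewrite expr2; nra.
    have : 0 <= (1 - v) * (4 - a ^+ 2) by rewrite mulr_ge0// subr_ge0.
    by move: (a ^+ 2) => q; nra.
  by apply: ge0_subset_integral => // x _; rewrite lee_fin fejerpi_ge0.
have ffin : (\int[leb]_t (fejerpi t)%:E)%E \is a fin_num.
  by rewrite ge0_fin_numE ?(le_lt_trans fin) ?ltry//; apply: integral_ge0 => x _; rewrite lee_fin fejerpi_ge0.
exists (fine (\int[leb]_t (fejerpi t)%:E)%E); last by rewrite fineK.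
by rewrite -lte_fin fineK// (lt_le_trans _ low)// lte_fin mulr_gt0// invr_gt0 mulr_gt0.
Qed.

End Fejer1b.

Section FejerTuple.
Context {R : realType}.
Local Notation mR := (measurableTypeR R).

Lemma measurable_tri_tuple n (a : 'I_n -> R) (th K : R) :
  measurable_fun setT (fun t : n.-tuple mR =>
    \prod_(i < n) tri (tnth t i) * (1 + K * cos (th + \sum_(i < n) a i * tnth t i))).
Proof.
apply: measurable_funM.
  apply: measurable_prod => i _; apply: measurableT_comp (measurable_tnth i).
  by apply: continuous_measurable_fun; exact: continuous_tri.
apply: measurable_funD => //; apply: measurable_funM => //.
apply: measurableT_comp.
  by apply: continuous_measurable_fun; exact: continuous_cos.
apply: measurable_funD => //; apply: measurable_sum => i.
by apply: measurable_funM => //; exact: measurable_tnth.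
Qed.

Lemma tri_tuple_ge0 n (t : n.-tuple mR) (x K : R) : `|K| <= 1 ->
  0 <= \prod_(i < n) tri (tnth t i) * (1 + K * cos x).
Proof.
move=> K1; rewrite mulr_ge0//; first by rewrite prodr_ge0// => i _; exact: tri_ge0.
have : `|K * cos x| <= 1 by rewrite normrM mulr_ile1// norm_cos_le1.
by rewrite ler_norml; lra.
Qed.

(** Integrating the last [n] coordinates multiplies the amplitude [K] of the
cosine by the Fejer factors, which are at most one, and leaves an integral of the
same form in the first coordinate. *)
Lemma integral_tri_tuple n (a : 'I_n -> R) (th K : R) : `|K| <= 1 ->
  (\int[lebesgue_tuple n]_t (\prod_(i < n) tri (tnth t i) *
     (1 + K * cos (th + \sum_(i < n) a i * tnth t i)))%:E =
   (1 + K * (cos th * \prod_(i < n) fejer (a i)))%:E)%E.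
Proof.
elim: n a th K => [|n IH] a th K K1.
  rewrite big_ord0; under eq_integral do rewrite !big_ord0.
  by rewrite /= integral_dirac// diracT mul1e mul1r addr0 mulr1.
rewrite leb_cons_tonelli; last 2 first.
- by apply/measurable_EFinP; exact: measurable_tri_tuple.
- by move=> t; rewrite lee_fin tri_tuple_ge0.
pose P := \prod_(i < n) fejer (a (lift ord0 i)).
have P1 : `|P| <= 1.
  rewrite normr_prod numdomain.Num.Theory.prodr_ile1// => i _.
  by rewrite normr_ge0 /= ger0_norm ?fejer_ge0 ?fejer_le1.
have KP : `|K * P| <= 1 by rewrite normrM mulr_ile1.
transitivity (\int[lebesgue_measure]_x (tri x * (1 + K * P * cos (th + a ord0 * x)))%:E)%E.
  apply: eq_integral => x _.
  have e : (1 + K * P * cos (th + a ord0 * x))%:E = (1 + K * (cos (th + a ord0 * x) * P))%:E.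
    by congr _%:E; ring.
  rewrite EFinM e -(IH (fun i => a (lift ord0 i)) (th + a ord0 * x) K K1).
  rewrite -ge0_integralZl//; last 3 first.
  - by apply/measurable_EFinP; exact: measurable_tri_tuple.
  - by move=> t _; rewrite lee_fin tri_tuple_ge0.
  - by rewrite lee_fin tri_ge0.
  apply: eq_integral => t _; rewrite -EFinM; congr _%:E.
  rewrite !big_ord_recl tnth0 !addrA mulrA.
  congr (_ * _ * (1 + K * cos (_ + _))).
    by apply: eq_bigr => i _; rewrite tnthS.
  by apply: eq_bigr => i _; rewrite tnthS.
rewrite integral_tri// big_ord_recl -/P; congr _%:E; ring.
Qed.

End FejerTuple.

Section FejerRow.
Context {R : realType} {d : nat}.
Local Notation mR := (measurableTypeR R).
Local Notation E := 'rV[R]_d.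
Local Notation T := (d.-tuple mR).
Local Notation lam := (@lebesgue_tuple R d).
Local Notation rt := (@row_of_tuple R d).

Definition tent (x : E) : R := \prod_(i < d) tri (x ord0 i).
Definition fejer_kernel (x : E) : R := \prod_(i < d) fejerpi (x ord0 i).

Lemma tent_ge0 x : 0 <= tent x.
Proof. by rewrite prodr_ge0// => i _; exact: tri_ge0. Qed.

Lemma tent_le1 x : tent x <= 1.
Proof. by rewrite numdomain.Num.Theory.prodr_ile1// => i _; rewrite tri_ge0 tri_le1. Qed.

Lemma summ_tent : summ tent.
Proof.
suff [] : summ tent /\ rint tent = \prod_(i < d) 1 by [].
apply: (@summ_prod R d (fun=> @tri R) (fun=> 1)) => [i|i x|i].
- by apply: continuous_measurable_fun; exact: continuous_tri.
- exact: tri_ge0.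
have := @integral_tri R 0 0 0; rewrite normr0 => /(_ ler01).
rewrite mul0r addr0 => <-; apply: eq_integral => x _.
by rewrite mul0r addr0 mulr1.
Qed.

Lemma meas_tent : meas tent.
Proof. exact: summ_meas summ_tent. Qed.

Lemma fejer_kernel_ge0 x : 0 <= fejer_kernel x.
Proof. by rewrite prodr_ge0// => i _; exact: fejerpi_ge0. Qed.

Lemma fejer_kernel_summ : summ fejer_kernel /\ 0 < rint fejer_kernel.
Proof.
have [c c0 cE] := @fejerpi_mass R.
have [sf ->] : summ fejer_kernel /\ rint fejer_kernel = \prod_(i < d) c.
  apply: (@summ_prod R d (fun=> @fejerpi R) (fun=> c)) => // i.
    exact: measurable_fejerpi.
  exact: fejerpi_ge0.
by split => //; rewrite prodr_gt0.
Qed.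

(** The constant is removed by comparing the amplitudes [0] and [1]. *)
Lemma rint_tent_cos (th : R) xi :
  summ (fun x => tent x * cos (th + phase x xi)) /\
  rint (fun x => tent x * cos (th + phase x xi)) = cos th * fejer_kernel xi.
Proof.
have ms : meas (fun x => cos (th + phase x xi)).
  apply: meas_comp; first by apply: continuous_measurable_fun; exact: continuous_cos.
  apply: measD; first exact: meas_cst.
  have := meas_phase xi; congr meas; apply/funext => x.
  by rewrite /phase dotC.
have s1 : summ (fun x => tent x * cos (th + phase x xi)).
  have := summM ms (fun x => norm_cos_le1 _) summ_tent.
  by congr summ; apply/funext => x; rewrite mulrC.
split => //.
have H (K : R) : `|K| <= 1 -> rint (fun x => tent x + K * (tent x * cos (th + phase x xi))) =
    1 + K * (cos th * fejer_kernel xi).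
  move=> K1; have := integral_tri_tuple (fun i => 2 * pi * xi ord0 i) th K1.
  rewrite (_ : integral _ _ _ = eint (fun x => tent x + K * (tent x * cos (th + phase x xi)))).
    rewrite eint_rint; last by apply: summD; [exact: summ_tent|exact: summZ].
    by move=> [->].
  apply: eq_integral => t _; congr _%:E.
  rewrite mulrDr mulr1 mulrCA /tent.
  rewrite (eq_bigr (fun i => tri (rt t ord0 i))) => [|i _]; last by rewrite row_of_tupleE.
  congr (_ + _ * (_ * cos (_ + _))); rewrite /phase /dot mulr_sumr; apply: eq_bigr => i _.
  by rewrite row_of_tupleE -!mulrA; congr (_ * (_ * _)); rewrite mulrC.
have := H 1; have := H 0; rewrite normr0 normr1 => /(_ ler01) h0 /(_ (lexx _)).
rewrite rintD//; [|exact: summ_tent|exact: summZ].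
move: h0; rewrite rintD//; [|exact: summ_tent|exact: summZ].
rewrite !rintZ//; lra.
Qed.

Lemma row_of_tupleK (x : E) : rt [tuple x ord0 i | i < d] = x.
Proof. by apply/rowP => i; rewrite mxE tnth_mktuple. Qed.

Lemma rint_fubini (H : E -> E -> R) (A B : E -> R) : jmeas H ->
  summ A -> summ B -> (forall x y, `|H x y| <= A x * B y) ->
  rint (fun x => rint (H x)) = rint (fun y => rint (fun x => H x y)).
Proof.
move=> mH sA sB HAB.
pose h z := (H (rt z.1) (rt z.2))%:E.
have mh : measurable_fun [set: T * T] h by exact/measurable_EFinP.
have A0 x y : `|H x y| <= `|A x| * `|B y|.
  by apply: le_trans (HAB _ _) _; rewrite -normrM ler_norm.
have sH x : summ (H x).
  have sAB : summ (fun y => `|A x| * `|B y|) by apply: summZ; exact: summ_norm.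
  apply: (summ_le _ (A0 x) sAB).
  by rewrite -(row_of_tupleK x); exact: (measurableT_comp mH (measurable_pair1 _)).
have sH' y : summ (fun x => H x y).
  have sAB : summ (fun x => `|A x| * `|B y|).
    have := summZ `|B y| (summ_norm sA); congr summ; apply/funext => x; exact: mulrC.
  apply: (summ_le _ (fun x => A0 x y) sAB).
  by rewrite -(row_of_tupleK y); exact: (measurableT_comp mH (measurable_pair2 _)).
have sC : summ (fun x => `|A x| * rint (fun y => `|B y|)).
  have := summZ (rint (fun y => `|B y|)) (summ_norm sA).
  by congr summ; apply/funext => x; exact: mulrC.
have ih : (lam \x lam)%E.-integrable setT h.
  apply/integrable12ltyP => //.
  apply: (@le_lt_trans _ _ (eint (fun x => (`|A x| * rint (fun y => `|B y|))%R))).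
    apply: ge0_le_integral => //.
    - by move=> t _; apply: integral_ge0.
    - have mah : measurable_fun setT (fun z => `|h z|)%E by exact: measurableT_comp.
      exact: (measurable_fun_fubini_tonelli_F (m2 := lam) (fun z => `|h z|)%E mah
        (fun z => abse_ge0 _)).
    - by apply/measurable_EFinP; exact: (summ_meas sC).
    move=> t _; rewrite -rintZ; last exact: summ_norm.
    rewrite -eint_rint; last by apply: summZ; exact: summ_norm.
    apply: ge0_le_integral => //.
    - apply/measurable_EFinP/measurableT_comp => //; exact: (summ_meas (sH (rt t))).
    - by apply/measurable_EFinP; exact: (summ_meas (summZ `|A (rt t)| (summ_norm sB))).
    - by move=> s _ /=; rewrite lee_fin.
  by rewrite eint_rint ?ltry.
have := Fubini ih.
rewrite {1}/rint /Rintegral => e.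
have e1 : (\int[lam]_x \int[lam]_y h (x, y) = \int[lam]_x (rint (H (rt x)))%:E)%E.
  by apply: eq_integral => x _; rewrite -eint_rint.
have e2 : (\int[lam]_y \int[lam]_x h (x, y) = \int[lam]_y (rint (fun x => H x (rt y)))%:E)%E.
  by apply: eq_integral => y _; rewrite -eint_rint.
by rewrite -e1 e e2.
Qed.

End FejerRow.

Section KernelMass.
Context {R : realType} {d : nat}.
Local Notation mR := (measurableTypeR R).
Local Notation E := 'rV[R]_d.
Local Notation T := (d.-tuple mR).
Local Notation lam := (@lebesgue_tuple R d).
Local Notation rt := (@row_of_tuple R d).

Lemma one_sub_prod (I : Type) (s : seq I) (a : I -> R) :
  (forall i, 0 <= a i <= 1) -> 1 - \prod_(i <- s) a i <= \sum_(i <- s) (1 - a i).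
Proof.
move=> a01; elim: s => [|i s IH]; first by rewrite !big_nil subrr.
rewrite !big_cons; have /andP[a0 a1] := a01 i.
have p0 : 0 <= \prod_(j <- s) a j.
  by apply: prodr_ge0 => j _; case/andP: (a01 j).
have p1 : \prod_(j <- s) a j <= 1 by apply: numdomain.Num.Theory.prodr_ile1.
move: IH; move: (\prod_(j <- s) _) (\sum_(j <- s) _) p0 p1 => p q p0 p1 h; nra.
Qed.

Lemma tent_near1 (y : E) : 1 - tent y <= d%:R * `|y|.
Proof.
apply: le_trans (one_sub_prod _ _) _.
  by move=> i; rewrite tri_ge0 tri_le1.
rewrite -[X in X%:R]card_ord mulr_natl -sumr_const; apply: ler_sum => i _.
have := coord_le_norm y i; have : 1 - `|y ord0 i| <= tri (y ord0 i) by rewrite /tri le_max lexx.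
by lra.
Qed.

Lemma rint_tent_scale (n th : R) xi : 0 < n ->
  summ (fun x : E => tent (n^-1 *: x) * cos (th + phase x xi)) /\
  rint (fun x : E => tent (n^-1 *: x) * cos (th + phase x xi)) =
    n ^+ d * (cos th * fejer_kernel (n *: xi)).
Proof.
move=> n0; have [s1 r1] := rint_tent_cos th (n *: xi).
have e (c : R) x : phase (c *: x) xi = phase x (c *: xi).
  by rewrite /phase dotZr dotC dotZr dotC.
have s2 : summ (fun x : E => tent (n^-1 *: x) * cos (th + phase x xi)).
  have := summ_affine 0 (invr_neq0 (lt0r_neq0 n0)) s1.
  congr summ; apply/funext => x; rewrite addr0 -e scalerA divff ?gt_eqF// scale1r//.
split=> //; rewrite (rint_affine 0 (lt0r_neq0 n0) s2) gtr0_norm// -r1.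
congr (_ * _); apply: eq_rint => x.
by rewrite addr0 scalerA mulVf ?gt_eqF// scale1r e.
Qed.

Lemma jmeas_phase (g : R -> R) : continuous g -> jmeas (fun x xi : E => g (phase x xi)).
Proof.
move=> cg; apply: measurableT_comp; first exact: continuous_measurable_fun.
rewrite (_ : (fun z : T * T => phase (rt z.1) (rt z.2)) =
   (fun z : T * T => 2 * pi * \sum_(i < d) (tnth z.1 i * tnth z.2 i : R))); last first.
  by apply/funext => z; rewrite /phase /dot; congr (_ * _); apply: eq_bigr => i _; rewrite !row_of_tupleE.
apply: measurable_funM; first exact: measurable_cst.
apply: measurable_sum => i; apply: measurable_funM.
  exact: (measurableT_comp (measurable_tnth i) measurable_fst).
exact: (measurableT_comp (measurable_tnth i) measurable_snd).
Qed.

(** Fubini: pairing a transform with a tent is pairing the density with the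
transform of the tent, and dilating the tent concentrates the latter at the origin;
the sine part drops out since tents are even. *)
Lemma trig_tent (f g : E -> R) (n : R) : 0 < n -> summ f -> summ g ->
  (exists M, forall x, `|f x| <= M) ->
  rint (fun x => trig f g x * tent (n^-1 *: x)) =
  rint (fun xi => f (n^-1 *: xi) * fejer_kernel xi).
Proof.
move=> n0 sf sg [M bM].
pose H (x xi : E) := tent (n^-1 *: x) * (f xi * cos (phase x xi) + g xi * sin (phase x xi)).
have mt : meas (fun x : E => tent (n^-1 *: x)).
  have := meas_affine n^-1 0 (@meas_tent R d); congr meas; apply/funext => x; by rewrite addr0.
have st : summ (fun x : E => tent (n^-1 *: x)).
  have := summ_affine 0 (invr_neq0 (lt0r_neq0 n0)) (@summ_tent R d).
  by congr summ; apply/funext => x; rewrite addr0.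
have mH : jmeas H.
  apply: measurable_funM; first exact: (measurableT_comp mt measurable_fst).
  apply: measurable_funD; apply: measurable_funM.
  - exact: (jmeas_snd (summ_meas sf)).
  - by apply: jmeas_phase; exact: continuous_cos.
  - exact: (jmeas_snd (summ_meas sg)).
  - by apply: jmeas_phase; exact: continuous_sin.
have sfg : summ (fun xi => `|f xi| + `|g xi|) by apply: summD; exact: summ_norm.
have bH x xi : `|H x xi| <= tent (n^-1 *: x) * (`|f xi| + `|g xi|).
  rewrite normrM ger0_norm ?tent_ge0// ler_wpM2l ?tent_ge0//.
  apply: le_trans (ler_normD _ _) _; rewrite !normrM.
  by apply: lerD; rewrite ler_piMr// ?norm_cos_le1 ?norm_sin_le1.
transitivity (rint (fun x => rint (H x))).
  apply: eq_rint => x; rewrite /H rintZ; first exact: mulrC.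
  by apply: summD; [exact: summ_cos|exact: summ_sin].
rewrite (rint_fubini mH st sfg bH).
have sF : summ (fun xi => f (n^-1 *: xi) * fejer_kernel xi).
  apply: summM; [|by move=> xi; exact: bM|by have [] := @fejer_kernel_summ R d].
  have := meas_affine n^-1 0 (summ_meas sf); congr meas; apply/funext => x; by rewrite addr0.
rewrite (rint_affine 0 (lt0r_neq0 n0) sF) gtr0_norm// -rintZ; last first.
  by have := summ_affine 0 (lt0r_neq0 n0) sF; congr summ.
apply: eq_rint => xi; rewrite /H addr0 scalerA mulVf ?gt_eqF// scale1r.
have [s1 r1] := rint_tent_scale 0 xi n0.
have [s2 r2] := rint_tent_scale (- (pi / 2)) xi n0.
transitivity (rint (fun x => f xi * (tent (n^-1 *: x) * cos (0 + phase x xi)) +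
   g xi * (tent (n^-1 *: x) * cos (- (pi / 2) + phase x xi)))).
  apply: eq_rint => x; rewrite add0r (_ : cos (- (pi / 2) + _) = sin (phase x xi)); first ring.
  by rewrite cosD cosN sinN cos_pihalf sin_pihalf; ring.
rewrite rintD; [|exact: summZ|exact: summZ].
rewrite !rintZ// r1 r2 cosN cos_pihalf cos0; ring.
Qed.

Variable phi : E -> R[i].
Hypothesis hphi : lp_generator phi.

Lemma kernel_mass_tent (n : R) : 0 < n ->
  `|rint (kernel_re phi) - rint (fun x => kernel_re phi x * tent (n^-1 *: x))| <=
  n^-1 * (d%:R * rint (fun x => `|kernel_re phi x| * (1 + `|x|))).
Proof.
move=> n0; have rk := kernel_re_rapid hphi; have sk := rapid_summ rk.
have s1 := rapid_moment1 rk.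
have mt : meas (fun x : E => tent (n^-1 *: x)).
  have := meas_affine n^-1 0 (@meas_tent R d); congr meas; apply/funext => x; by rewrite addr0.
have bt (x : E) : `|tent (n^-1 *: x)| <= 1 by rewrite ger0_norm ?tent_ge0 ?tent_le1.
have s2 : summ (fun x => kernel_re phi x * tent (n^-1 *: x)).
  have := summM mt bt sk; congr summ; apply/funext => x; exact: mulrC.
rewrite -rintB// mulrA -rintZ//; apply: rint_bound.
- by apply: summ_meas; apply: summB.
- exact: summZ.
move=> x; rewrite -[X in X - _]mulr1 -mulrBr normrM mulrC -mulrA.
rewrite [leRHS]mulrCA [leRHS]mulrA [leRHS]mulrC mulrC.
rewrite -[X in _ <= X]mulrA ler_wpM2l//.
have t1 := tent_le1 (n^-1 *: x); rewrite ger0_norm ?subr_ge0//.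
apply: le_trans (tent_near1 _) _.
have n1 : 0 <= n^-1 by rewrite invr_ge0 ltW.
rewrite normrZ (ger0_norm n1) mulrCA; have := n1.
have : 0 <= d%:R :> R by [].
have : 0 <= `|x| by [].
move: `|x| n^-1 (d%:R : R) => a b c c0 b0 a0; nra.
Qed.

(** Both sides of [trig_tent] converge as [n] tends to infinity: the left one to
the mass of the kernel, since a wide tent is close to one; the right one to the
mass of the Fejer kernel by dominated convergence, since [phi = 1] near the
origin. *)
Lemma kernel_mass_gt0 : 0 < rint (kernel_re phi).
Proof.
have [sfk fk0] := @fejer_kernel_summ R d.
suff -> : rint (kernel_re phi) = rint (@fejer_kernel R d) by [].
have [t1 t2] := generator_testfun hphi.
pose f x := complex.Re (phi x).
have sf : summ f by exact: testfun_summ.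
have sg : summ (fun x => -1 * complex.Im (phi x)) by apply: summZ; exact: testfun_summ.
have [M bM] : exists M, forall x, `|f x| <= M.
  by case: t1 => _ _ /(_ [::]).
pose u (n : nat) : R := rint (fun xi => f (n.+1%:R^-1 *: xi) * fejer_kernel xi).
have uE n : u n = rint (fun x => kernel_re phi x * tent (n.+1%:R^-1 *: x)).
  by rewrite /u -(@trig_tent f _ n.+1%:R _ sf sg)//; exists M.
have inv0 : (fun n => n.+1%:R^-1) @ \oo --> (0 : R) by exact: cvg_harmonic.
have inv0M C : (fun n : nat => n.+1%:R^-1 * C) @ \oo --> (0 : R).
  have -> : (0 : R) = 0 * C by rewrite mul0r.
  by apply: cvgM; [exact: inv0|exact: cvg_cst].
have c1 : u @ \oo --> rint (kernel_re phi).
  apply/cvgrPdist_le => e e0.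
  set C := d%:R * rint (fun x => `|kernel_re phi x| * (1 + `|x|)).
  have /cvgrPdist_le /(_ e e0) := inv0M C.
  apply: filterS => n h; rewrite uE; apply: le_trans (kernel_mass_tent _) _ => //.
  by move: h; rewrite sub0r normrN; apply: le_trans; exact: ler_norm.
have sfn n : summ (fun xi => f (n.+1%:R^-1 *: xi) * fejer_kernel xi).
  apply: summM; [|by move=> xi; exact: bM|by []].
  have := meas_affine n.+1%:R^-1 0 (summ_meas sf).
  by congr meas; apply/funext => x; rewrite addr0.
have c2 : u @ \oo --> rint (@fejer_kernel R d).
  suff /fine_cvgP[_] : (fun n => eint (fun xi => f (n.+1%:R^-1 *: xi) * fejer_kernel xi)) @ \oo
      --> (rint (@fejer_kernel R d))%:E by [].
  rewrite -eint_rint//.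
  apply: (@dominated_cvg _ _ _ lam setT measurableT _ _ (fun t => (M * fejer_kernel (rt t))%:E)).
  - by move=> n; apply/measurable_EFinP; exact: (summ_meas (sfn n)).
  - move=> t _; apply: cvg_near_cst.
    have /cvgrPdist_le /(_ 1 ltr01) := inv0M (eucl_norm (rt t)).
    apply: filterS => n h; congr _%:E.
    rewrite -[RHS]mul1r; congr (_ * _); rewrite /f.
    have [_ p1 _] := hphi; rewrite p1//.
    move: h; rewrite sub0r normrN; apply: le_trans; apply: le_trans (ler_norm _).
    by rewrite /eucl_norm dotZr dotC dotZr mulrA -expr2 sqrtrM ?sqr_ge0// sqrtr_sqr ger0_norm.
  - by [].
  - exact: (summZ M sfk).
  - move=> n t _; rewrite /= lee_fin normrM (ger0_norm (fejer_kernel_ge0 _)).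
    by rewrite ler_wpM2r ?fejer_kernel_ge0.
exact: cvg_unique c1 c2.
Qed.

End KernelMass.

(** * The mass of the kernel on half spaces *)

Section HalfSpaceMass.
Context {R : realType} {d : nat}.
Local Notation mR := (measurableTypeR R).
Local Notation E := 'rV[R]_d.
Variable i0 : 'I_d.

Lemma measurable_itv_nat (i : interval R) :
  measurable_fun setT (fun r : R => (r \in i)%:R : R).
Proof.
have := @measurable_indic _ mR R [set: mR] [set` i] (measurable_itv i).
by congr measurable_fun; apply/funext => r; rewrite indicE mem_setE.
Qed.

Lemma meas_coord_itv (j : 'I_d) (i : interval R) :
  meas (fun z : E => (z ord0 j \in i)%:R).
Proof. exact: meas_comp (measurable_itv_nat i) (meas_coord j). Qed.

(** The profile of the blocks of the cube in the direction orthogonal to a face. *)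
Definition halfmass (K : E -> R) (t : R) : R :=
  rint (fun z => K z * (z ord0 i0 \in `]-oo, t])%:R).

Lemma norm_natb (b : bool) : `|b%:R : R| <= 1.
Proof. by case: b; rewrite ?normr1 ?normr0. Qed.

Lemma summ_indM (K : E -> R) (j : 'I_d) (i : interval R) : summ K ->
  summ (fun z => K z * (z ord0 j \in i)%:R).
Proof.
move=> sK; have := summM (meas_coord_itv j i) (fun z => norm_natb _) sK.
by congr summ; apply/funext => z; rewrite mulrC.
Qed.

Variable K : E -> R.
Hypothesis rK : rapid K.
Let sK := rapid_summ rK.
Let M0 := rint (fun z => `|K z| * (1 + `|z|)).

Let sK1 := rapid_moment1 rK.

Lemma halfmass_right t : 0 < t -> t * `|rint K - halfmass K t| <= M0.
Proof.
move=> t0; rewrite /halfmass -rintB//; last exact: summ_indM.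
rewrite -ler_pdivlMl// -rintZ//; apply: rint_bound.
- by apply: summ_meas; apply: summB => //; exact: summ_indM.
- exact: summZ.
move=> z; rewrite in_itv /= ler_pdivlMl//; case: (leP (z ord0 i0) t) => h.
  by rewrite /= mulr1 subrr normr0 mulr0 mulr_ge0// addr_ge0.
rewrite /= mulr0 subr0 mulrC ler_wpM2l//.
by apply: ltW; apply: lt_le_trans h _; have := coord_le_norm z i0; have := ler_norm (z ord0 i0); lra.
Qed.

Lemma halfmass_left t : t < 0 -> - t * `|halfmass K t| <= M0.
Proof.
move=> t0; have nt : 0 < - t by lra.
rewrite -ler_pdivlMl// -rintZ//; apply: rint_bound.
- by apply: summ_meas; exact: summ_indM.
- exact: summZ.
move=> z; rewrite in_itv /= ler_pdivlMl//; case: (leP (z ord0 i0) t) => h; last first.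
  by rewrite /= mulr0 normr0 mulr0 mulr_ge0// addr_ge0.
rewrite /= mulr1 mulrC ler_wpM2l//.
by have := coord_le_norm z i0; have := ler_norm (- z ord0 i0); rewrite normrN; lra.
Qed.

(** The weight has mass proportional to the width on a slab orthogonal to a
coordinate axis, by comparison with a product function. *)
Lemma summ_slab (s t : R) : s <= t ->
  summ (fun z : E => wt z * (z ord0 i0 \in `]s, t])%:R) /\
  rint (fun z : E => wt z * (z ord0 i0 \in `]s, t])%:R) <= (t - s) * pi ^+ d.-1.
Proof.
move=> st; have s1 := summ_indM i0 `]s, t] (@summ_wt R d); split => //.
pose f (i : 'I_d) (r : R) : R := if i == i0 then (r \in `]s, t])%:R else (oneDsqr r)^-1.
pose c (i : 'I_d) : R := if i == i0 then t - s else pi.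
have [||| sf rf] := @summ_prod R d f c.
- move=> i; rewrite /f; case: eqP => _; first exact: measurable_itv_nat.
  by apply: continuous_measurable_fun; exact: continuous_oneDsqrV.
- by move=> i x; rewrite /f; case: eqP => _ //; rewrite invr_ge0 addr_ge0// sqr_ge0.
- move=> i; rewrite /f /c; case: eqP => _; last exact: integral_oneDsqrV.
  transitivity (\int[lebesgue_measure]_x (\1_[set` `]s, t]] x)%:E : \bar R)%E.
    by apply: eq_integral => x _; rewrite indicE mem_setE.
  rewrite integral_indic//= setIT lebesgue_measure_itv/= lte_fin.
  by move: st; rewrite le_eqVlt => /orP[/eqP ->|->]; rewrite ?ltxx ?subrr// -EFinD.
have -> : (t - s) * pi ^+ d.-1 = \prod_i c i.
  rewrite (bigD1 i0)//= {1}/c eqxx; congr (_ * _).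
  rewrite (eq_bigr (fun=> pi)) => [|i /negbTE]; last by rewrite /c => ->.
  by rewrite prodr_const cardC1 card_ord.
rewrite -rf; apply: le_rint => // z.
case: (boolP (z ord0 i0 \in _)) => h; last first.
  rewrite /= mulr0; apply: prodr_ge0 => i _; rewrite /f; case: eqP => _.
    exact: ler0n.
  by rewrite invr_ge0 addr_ge0// sqr_ge0.
rewrite /= mulr1; apply: le_trans (wt_le_prod z) _; apply: ler_prod => i _.
have p : 0 <= (oneDsqr (z ord0 i))^-1 by rewrite invr_ge0 addr_ge0// sqr_ge0.
rewrite p /= /f; case: eqP => [->|//]; rewrite h.
exact: oneDsqrV_le1.
Qed.

Lemma halfmass_lip : exists2 L, 0 <= L &
  forall s t, `|halfmass K t - halfmass K s| <= L * `|t - s|.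
Proof.
have [M M_ge0 bM] := rapid_wt 0 rK.
exists (M * pi ^+ d.-1); first by rewrite mulr_ge0// exprn_ge0// pi_ge0.
move=> s t; wlog st : s t / s <= t.
  move=> H; case/orP: (le_total s t) => h; first exact: H.
  by rewrite distrC [X in _ * X]distrC; exact: H.
have [s1 r1] := summ_slab st.
rewrite /halfmass -rintB; [|exact: summ_indM..].
rewrite (ger0_norm (_ : 0 <= t - s)) ?subr_ge0//.
apply: (@le_trans _ _ (rint (fun z : E => M * (wt z * (z ord0 i0 \in `]s, t])%:R)))).
  apply: rint_bound; last first.
  - move=> z; rewrite -mulrBr normrM.
    have -> : `|(z ord0 i0 \in `]-oo, t])%:R - (z ord0 i0 \in `]-oo, s])%:R| =
        (z ord0 i0 \in `]s, t])%:R :> R.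
      rewrite !in_itv /=; case: (leP _ t) => h1; case: (leP _ s) => h2 /=;
        rewrite ?subrr ?subr0 ?normr0 ?normr1//; lra.
    by rewrite mulrA ler_wpM2r//; have := bM z; rewrite mulr1.
  - exact: summZ.
  - by apply: summ_meas; apply: summB; exact: summ_indM.
rewrite rintZ// -mulrA ler_wpM2l// mulrC; exact: r1.
Qed.

(** The function [t |-> Gamma(t) - Gamma(t/2)] is Lipschitz, so it is enough that
it is nonzero somewhere.  Otherwise [Gamma(1) = Gamma(2^n) = Gamma(2^-n)] and
likewise at [-1]: the limits at infinity and the continuity at [0] force the mass
of [K] to be [O(2^-n)] for every [n]. *)
Lemma halfmass_jump : 0 < rint K -> exists t0 c e, [/\ 0 < c, 0 < e &
  forall t, `|t - t0| <= e -> c <= `|halfmass K t - halfmass K (t / 2)|].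
Proof.
move=> K0; have [L L0 lip] := halfmass_lip.
have [t0 ht0] : exists t0, halfmass K t0 != halfmass K (t0 / 2).
  apply: contrapT => nex.
  have inv t : halfmass K t = halfmass K (t / 2).
    by apply/eqP/negPn/negP => h; apply: nex; exists t.
  have invn n t : halfmass K t = halfmass K (t / 2 ^+ n).
    elim: n => [|n IH]; first by rewrite divr1.
    by rewrite IH inv exprSr invfM mulrA.
  have M00 : 0 <= M0 by exact: moment_ge0.
  (* moving from +-1 to +-2^n costs M0 / 2^n, and from 2^-n to -2^-n costs 2 L / 2^n *)
have bound n : 2 ^+ n * rint K <= 2 * M0 + 2 * L.
    have p : 0 < 2 ^+ n :> R by rewrite exprn_gt0.
    have h1 := halfmass_right p.
    have np : - 2 ^+ n < 0 :> R by lra.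
    have h2 := halfmass_left np; rewrite opprK in h2.
    rewrite (invn n) mulNr divff ?gt_eqF// in h2.
    rewrite (invn n (2 ^+ n)) divff ?gt_eqF// in h1.
    have h3 := lip (- 1 / 2 ^+ n) (1 / 2 ^+ n).
    have e2 : 1 / 2 ^+ n - -1 / 2 ^+ n = 2 / 2 ^+ n :> R by rewrite -mulrBl; congr (_ / _); ring.
    have p2 : 0 <= 2 / 2 ^+ n :> R by rewrite divr_ge0// ltW.
    rewrite -!invn e2 (ger0_norm p2) in h3.
    have h3' : 2 ^+ n * `|halfmass K 1 - halfmass K (-1)| <= 2 * L.
      have := ler_wpM2l (ltW p) h3; move/le_trans; apply.
      by rewrite mulrCA [2 ^+ n * _]mulrC divfK ?gt_eqF// mulrC.
    move=> {h3 e2 p2}.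
    have := ler_norm (rint K - halfmass K 1).
    have := ler_norm (halfmass K 1 - halfmass K (-1)).
    have := ler_norm (halfmass K (-1)).
    move: h1 h2 h3' p; move: `|rint K - _| `|_ - halfmass K (-1)| `|halfmass K (-1)|.
    move: (2 ^+ n) (halfmass K 1) (halfmass K (-1)) => q g1 g2 a b c h1 h2 h4 p c1 b1 a1.
    nra.
  have [n hn] : exists n, (2 * M0 + 2 * L) / rint K < n%:R.
    by exists (Num.truncn ((2 * M0 + 2 * L) / rint K)).+1; exact: truncnS_gt.
  have := bound n; rewrite -ler_pdivlMr// => /(le_lt_trans)/(_ hn).
  by rewrite -natrX ltr_nat ltnNge ltnW// ltn_expl.
pose g t := halfmass K t - halfmass K (t / 2).
have g0 : 0 < `|g t0| by rewrite normr_gt0 subr_eq0.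
exists t0, (`|g t0| / 2), (`|g t0| / (4 * (L + 1))); split.
- by rewrite divr_gt0.
- by rewrite divr_gt0// mulr_gt0//; lra.
move=> t ht; rewrite -/(g t).
have h1 := lip t0 t; have h2 := lip (t0 / 2) (t / 2).
rewrite -mulrBl normrM (ger0_norm (_ : 0 <= 2^-1))// in h2.
have L1 : 0 < 4 * (L + 1) by lra.
rewrite ler_pdivlMr// in ht.
have : `|g t0| <= `|g t| + `|halfmass K t - halfmass K t0| +
     `|halfmass K (t / 2) - halfmass K (t0 / 2)|.
  have -> : g t0 = g t - (halfmass K t - halfmass K t0)
      + (halfmass K (t / 2) - halfmass K (t0 / 2)) by rewrite /g; ring.
  by apply: le_trans (ler_normD _ _) _; rewrite lerD2r ler_normB.
move: ht h1 h2; have : 0 <= `|t - t0| by [].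
move: `|t - t0| `|g t0| `|g t| `|halfmass K t - _| `|halfmass K (t / 2) - _| => a b c x y.
move=> a0 ht h1 h2 h3; nra.
Qed.

End HalfSpaceMass.

(** * The blocks of the unit cube *)

Section CubeBlocks.
Context {R : realType} {d : nat}.
Local Notation mR := (measurableTypeR R).
Local Notation E := 'rV[R]_d.
Local Notation C := R[i].
Local Notation T := (d.-tuple mR).
Local Notation lam := (@lebesgue_tuple R d).
Local Notation rt := (@row_of_tuple R d).

Lemma prod_natb (b : 'I_d -> bool) :
  \prod_i (b i)%:R = [forall i, b i]%:R :> R.
Proof.
case: (boolP [forall i, b i]) => [/forallP h|/forallPn[i h]].
  by rewrite big1// => i _; rewrite h.
by rewrite (bigD1 i)//= (negbTE h) mul0r.
Qed.

(** A Chebyshev bound: the modulus of [f] is compared with a multiple of an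
indicator, so that only the latter has to be measurable. *)
Lemma cLnorm_ge p (f : E -> C) (b : E -> bool) (c : R) : (1 < p)%E -> 0 < c ->
  summ (fun x => (b x)%:R) -> 0 < rint (fun x => (b x)%:R : R) ->
  (forall x, b x -> c <= Normc.normc (f x)) ->
  ((theta p c (c * rint (fun x => (b x)%:R)))%:E <= cLnorm p f)%E.
Proof.
move=> p1 c0 sb b0 bf; case: p p1 => [r| |//].
  rewrite lte_fin => r1; have r0 : 0 < r by lra.
  rewrite cLnormE /theta.
  have -> : c `^ (r - 1) * (c * rint (fun x => (b x)%:R)) = rint (fun x => c `^ r * (b x)%:R).
    rewrite rintZ// mulrA; congr (_ * _).
    rewrite -[X in _ * X](powRr1 (ltW c0)) -powRD ?subrK//.
    by apply/implyP => _; rewrite gt_eqF.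
  have X0 : 0 <= rint (fun x => c `^ r * (b x)%:R).
    by apply: rint_ge0 => x; rewrite mulr_ge0// powR_ge0.
  have le : ((rint (fun x => c `^ r * (b x)%:R))%:E <=
      \int[lam]_t (Normc.normc (f (rt t)) `^ r)%:E)%E.
    rewrite -eint_rint; last exact: summZ.
    apply: le_integral_nonmeas => t; first by rewrite lee_fin mulr_ge0// powR_ge0.
    rewrite lee_fin; case: (boolP (b (rt t))) => [/bf h|_].
      rewrite mulr1; apply: ge0_ler_powR => //; [exact: ltW| |].
        by rewrite nnegrE ltW.
      by rewrite nnegrE normc_ge0.
    by rewrite mulr0 powR_ge0.
  rewrite -poweR_EFin; apply: gt0_ler_poweR => //; first by rewrite invr_ge0 ltW.
  - by rewrite in_itv /= lee_fin X0 leey.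
  - rewrite in_itv /= leey andbT; apply: le_trans le; by rewrite lee_fin.
move=> _; rewrite leNgt; apply/negP => h.
have := lexx (cLnorm +oo%E f); move/cLnorm_oo => [N [mN N0 sub]].
suff : (eint (fun x => (b x)%:R)%R <= 0)%E.
  by rewrite eint_rint// lee_fin leNgt b0.
rewrite -N0 -[N]setIT -(integral_indic lam)//.
apply: le_integral_nonmeas => t; rewrite lee_fin// indicE.
case: (boolP (b (rt t))) => // bt.
rewrite mem_set//; apply: sub => /=; apply/negP; rewrite -ltNge.
by apply: lt_le_trans h _; rewrite lee_fin; exact: bf.
Qed.

Lemma theta_pos (p : \bar R) a b : (1 < p)%E -> 0 < a -> 0 < b -> 0 < theta p a b.
Proof. by case: p => //= r _ a0 b0; rewrite powR_gt0// mulr_gt0// powR_gt0. Qed.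

Definition cube01 (x : E) : R := [forall i, Num.floor (x ord0 i) == 0]%:R.

Lemma haar_cube01 : haar (fun=> false) 0 (fun=> 0) = (fun x : E => (cube01 x)%:C%C) :> (E -> C).
Proof.
apply/funext => x; rewrite haar_cellE /cube01.
by congr (nat_of_bool _)%:R%:C%C; apply: eq_forallb => i; rewrite expr0 mul1r.
Qed.

Lemma cube01_bound x : `|cube01 x| <= 1. Proof. exact: norm_natb. Qed.

Lemma floor0 (x : R) : (Num.floor x == 0) = (0 <= x < 1).
Proof. by rewrite floor_eq add0r. Qed.

Variable i0 : 'I_d.

(** A thin slab along the face [x_i0 = 0] of the unit cube, at a distance from the
other faces. *)
Definition slab_box (l u : R) (x : E) : bool :=
  [forall i, x ord0 i \in (if i == i0 then `[l, u] else `[4^-1, 3/4])].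

Lemma slab_box_mass (l u : R) : l <= u ->
  summ (fun x : E => (slab_box l u x)%:R) /\
  rint (fun x : E => (slab_box l u x)%:R : R) = (u - l) * 2^-1 ^+ d.-1.
Proof.
move=> lu; pose I (i : 'I_d) : interval R := if i == i0 then `[l, u] else `[4^-1, 3/4].
pose c (i : 'I_d) : R := if i == i0 then u - l else 2^-1.
have [||| sf rf] := @summ_prod R d (fun i r => (r \in I i)%:R) c.
- by move=> i; exact: measurable_itv_nat.
- by move=> i x; exact: ler0n.
- move=> i; transitivity (\int[lebesgue_measure]_x (\1_[set` I i] x)%:E : \bar R)%E.
    by apply: eq_integral => x _; rewrite indicE mem_setE.
  rewrite integral_indic//= setIT lebesgue_measure_itv/= /I /c.
  case: eqP => _; rewrite /= lte_fin.
    by move: lu; rewrite le_eqVlt => /orP[/eqP ->|->]; rewrite ?ltxx ?subrr// -EFinD.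
  have -> : (4^-1 < 3 / 4 :> R) by lra.
  by rewrite -EFinD; congr _%:E; lra.
have e : (fun x : E => \prod_i (x ord0 i \in I i)%:R) = (fun x => (slab_box l u x)%:R : R).
  by apply/funext => x; rewrite prod_natb.
rewrite e in sf rf; split => //; rewrite rf.
rewrite (bigD1 i0)//= {1}/c eqxx; congr (_ * _).
rewrite (eq_bigr (fun=> 2^-1)) => [|i /negbTE]; last by rewrite /c => ->.
by rewrite prodr_const cardC1 card_ord.
Qed.

Variable K : E -> R.
Hypothesis rK : rapid K.
Let sK := rapid_summ rK.
Let M0 := rint (fun z => `|K z| * (1 + `|z|)).

Let sK1 := rapid_moment1 rK.

Lemma cube01_meas : meas cube01.
Proof.
have := @meas_grid R d cube01 0; congr meas; apply/funext => x /=.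
rewrite /cube01; congr (nat_of_bool _)%:R; apply: eq_forallb => i.
by rewrite mxE expr0 mul1r divr1 intrKfloor.
Qed.

(** At scale [2^-k] only the face nearby is visible: for [2^-k |z| <= 1/16] the
point [x - 2^-k z] is in the cube exactly when [z_i0 <= s], and the remaining [z]
contribute [O(2^-k)] by the first moment of [K]. *)
Lemma smear_cube k s (x : E) : x ord0 i0 = 2 ^- k * s -> `|x ord0 i0| <= 16^-1 ->
  (forall i, i != i0 -> 4^-1 <= x ord0 i <= 3/4) ->
  `|smear cube01 K k x - halfmass i0 K s| <= 2 ^- k * (16 * M0).
Proof.
move=> xi0 xsmall xmid; have bF : bdd 1 cube01 by split; [exact: cube01_meas|exact: cube01_bound].
have s1 := summ_smear k x bF sK.
rewrite /smear /halfmass -rintB//; last exact: summ_indM.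
rewrite mulrA -rintZ//; apply: rint_bound.
- by apply: summ_meas; apply: summB => //; exact: summ_indM.
- exact: summZ.
move=> z; rewrite -mulrBr normrM [leRHS]mulrCA ler_wpM2l//.
have p : 0 < 2 ^- k :> R by rewrite invr_gt0 exprn_gt0.
have h1 : `|cube01 (x - 2 ^- k *: z) - (z ord0 i0 \in `]-oo, s])%:R| <= 1.
  by rewrite /cube01; case: [forall i, _]; case: (_ \in _);
    rewrite ?subrr ?subr0 ?sub0r ?normrN ?normr0 ?normr1.
have [zs|zl] := leP (2 ^- k * `|z|) 16^-1; last first.
  apply: le_trans h1 _; move: zl p; move: (2 ^- k) `|z| => a b; nra.
suff -> : cube01 (x - 2 ^- k *: z) = (z ord0 i0 \in `]-oo, s])%:R.
  by rewrite subrr normr0 !mulr_ge0// ?addr_ge0// ltW.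
have zi i : `|2 ^- k * z ord0 i| <= 16^-1.
  apply: le_trans zs; rewrite normrM (gtr0_norm p) ler_wpM2l ?(ltW p)//.
  exact: coord_le_norm.
have xz i : (x - 2 ^- k *: z) ord0 i = x ord0 i - 2 ^- k * z ord0 i by rewrite !mxE.
have e0 : (0 <= x ord0 i0 - 2 ^- k * z ord0 i0) = (z ord0 i0 <= s).
  by rewrite xi0 -mulrBr pmulr_rge0// subr_ge0.
rewrite /cube01 in_itv /=; congr (nat_of_bool _)%:R.
apply/forallP/idP => [/(_ i0)|zs' i].
  by rewrite floor0 xz e0 => /andP[].
rewrite floor0 xz; have := zi i; rewrite ler_norml => /andP[z1 z2].
have [->|/xmid/andP[x1 x2]] := eqVneq i i0; last by apply/andP; split; lra.
rewrite e0 zs' /=; have := zi i0; move: xsmall; rewrite !ler_norml.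
by move=> /andP[y1 y2] /andP[y3 y4]; lra.
Qed.

Lemma block_cube j t (x : E) : x ord0 i0 = 2 ^- j.+1 * t -> `|x ord0 i0| <= 16^-1 ->
  (forall i, i != i0 -> 4^-1 <= x ord0 i <= 3/4) ->
  `|block cube01 K j.+1 x - (halfmass i0 K t - halfmass i0 K (t / 2))| <=
    2 ^- j.+1 * (48 * M0).
Proof.
move=> xi0 xs xm; have h1 := smear_cube xi0 xs xm.
have xi0' : x ord0 i0 = 2 ^- j * (t / 2).
  by rewrite xi0 exprS invfM; ring.
have h2 := smear_cube xi0' xs xm.
move: h1 h2; rewrite /=.
move: (smear _ _ _ _) (smear _ _ _ _) (halfmass _ _ _) (halfmass _ _ _) => b a h g h1 h2.
have -> : a - b - (g - h) = (a - g) - (b - h) by ring.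
apply: le_trans (ler_normB _ _) _; apply: le_trans (lerD h1 h2) _.
rewrite (_ : 2 ^- j = 2 * 2 ^- j.+1); last by rewrite exprS invfM; field.
move: (2 ^- j.+1) => w; lra.
Qed.

Lemma block_lip a L F j (x : E) : bdd a F -> 0 <= L ->
  (forall x y, `|F x - F y| <= L * `|x - y|) -> `|block F K j.+1 x| <= 2 ^- j.+1 * (L * M0).
Proof.
move=> bF L0 lF; have p : 0 < 2 ^- j.+1 :> R by rewrite invr_gt0 exprn_gt0.
have s1 := summ_smear j.+1 x bF sK; have s2 := summ_smear j x bF sK.
rewrite /= /smear -rintB// mulrA -rintZ//; apply: rint_bound.
- by apply: summ_meas; exact: summB.
- exact: summZ.
move=> z; rewrite -mulrBr normrM [leRHS]mulrCA ler_wpM2l//.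
apply: le_trans (lF _ _) _.
have -> : x - 2 ^- j.+1 *: z - (x - 2 ^- j *: z) = 2 ^- j.+1 *: z.
  rewrite opprB addrC addrA subrK -scalerBl; congr (_ *: _).
  by rewrite exprS invfM; move: ((2 ^+ j)^-1) => q; lra.
rewrite normrZ (gtr0_norm p).
have : 0 <= `|z| by []. move: (2 ^- j.+1) `|z| p => u v u0 v0; nra.
Qed.

End CubeBlocks.

Section Strictness.
Context {R : realType} {d : nat}.
Local Notation E := 'rV[R]_d.
Local Notation C := R[i].

Lemma wlip_lip a (F : E -> R) x y : wlip a F -> `|F x - F y| <= 2 * a * `|x - y|.
Proof.
move=> [mF a0 bF lF].
have b z : `|F z| <= a by apply: le_trans (bF z) _; rewrite ler_piMr// wt_le1.
have [h|h] := leP `|x - y| 1.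
  have := lF y (x - y) h; rewrite [y + _]addrC subrK => /le_trans; apply.
  apply: le_trans (_ : a * `|x - y| <= _); first by rewrite ler_piMr ?mulr_ge0// wt_le1.
  by rewrite ler_wpM2r//; lra.
apply: le_trans (ler_normB _ _) _; apply: le_trans (lerD (b x) (b y)) _.
by move: h; move: `|x - y| => u; nra.
Qed.

Lemma wlip_bdd a (F : E -> R) : wlip a F -> bdd a F.
Proof.
move=> [mF a0 bF _]; split => // z.
by apply: le_trans (bF z) _; rewrite ler_piMr// wt_le1.
Qed.

(** A Lipschitz function that is [1] at the origin and vanishes at all other integer
points, so that its step approximation is the indicator of the unit cube. *)
Definition cone (x : E) : R := Num.max (1 - `|x|) 0.

Lemma cone_lip x y : `|cone x - cone y| <= `|x - y|.
Proof.
have := ler_dist_dist x y; rewrite /cone !ler_norml => /andP[h1 h2].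
by case: (leP (1 - `|x|) 0) => h3; case: (leP (1 - `|y|) 0) => h4; apply/andP; split; lra.
Qed.

Lemma cone_wlip : wlip (3 ^+ (2 * d)) cone.
Proof.
have w (x : E) : `|x| <= 2 -> 1 <= 3 ^+ (2 * d) * wt x.
  move=> x2; rewrite /wt ler_pdivlMr ?exprn_gt0 ?norm1_gt0// mul1r.
  by rewrite lerXn2r ?nnegrE ?addr_ge0//; lra.
have out x : 1 <= `|x| -> cone x = 0 by move=> x1; rewrite /cone max_r// subr_le0.
split.
- apply: (meas_comp (h := fun r => Num.max (1 - r) 0) _ meas_normx).
  apply: measurable_maxr => //; exact: measurable_funB.
- by rewrite exprn_ge0.
- move=> x; have [x1|x1] := leP 1 `|x|.
    by rewrite out// normr0 mulr_ge0 ?wt_ge0// exprn_ge0.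
  apply: le_trans (w x _); last by lra.
  by rewrite /cone ger0_norm ?le_max ?lexx ?orbT// ge_max ler01 gerBl normr_ge0.
move=> x v v1; have [x2|x2] := leP `|x| 2.
  have := cone_lip (x + v) x; rewrite [x + v]addrC addrK => /le_trans; apply.
  rewrite -mulrA mulrCA ler_peMr//; exact: w.
have xv : 1 <= `|x + v|.
  have : `|x| <= `|x + v| + `|v| by rewrite -{1}(addrK v x) ler_normB.
  lra.
rewrite !out ?subrr ?normr0//; last by lra.
by rewrite !mulr_ge0 ?wt_ge0// exprn_ge0.
Qed.

Lemma cube01_cone : cube01 = cone \o grid 0 :> (E -> R).
Proof.
apply/funext => x /=; rewrite /cube01.
have e i : grid 0 x ord0 i = (Num.floor (x ord0 i))%:~R by rewrite mxE expr0 mul1r divr1.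
case: (boolP [forall i, _]) => [/forallP h|/forallPn[i h]].
  have -> : grid 0 x = 0 by apply/rowP => i; rewrite e (eqP (h i)) mxE.
  by rewrite /cone normr0 subr0 max_l// ler01.
rewrite /cone max_r// subr_le0; apply: le_trans (coord_le_norm _ i); rewrite e.
by rewrite -intr_norm ler1z; move: h; rewrite -normr_gt0 gtz0_ge1.
Qed.

Lemma small_pow2S (A c : R) : 0 < c -> exists n : nat, 2 ^- n.+1 * A <= c.
Proof.
move=> c0; exists (Num.truncn (`|A| / c)).+1.
set n := (Num.truncn _).+1.
have h : `|A| / c < n%:R by exact: truncnS_gt.
rewrite ler_pdivrMl ?exprn_gt0//; apply: le_trans (ler_norm _) _.
rewrite ltr_pdivrMr// in h; apply: ltW; apply: lt_le_trans h _.
rewrite ler_pM2r// -natrX ler_nat ltnW// ltnW// ltn_expl//.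
Qed.

Lemma small_pow2 (A c : R) : 0 < c -> exists n : nat, 2 ^- n * A <= c.
Proof. by move=> /small_pow2S -/(_ A)[n h]; exists n.+1. Qed.

Variables (p : \bar R) (phi : E -> C).
Hypothesis p1 : (1 < p)%E.
Hypothesis hphi : lp_generator phi.
Let s := fine (p^-1)%E.

(** Three error terms of total size [c/2] cannot cancel a quantity of size [c]. *)
Lemma far_arith (B J g1 g2 c q m1 m2 m3 : R) : `|B - J| <= q * m1 -> c <= `|J| ->
  `|g1| <= q * m2 -> `|g2| <= q * m3 -> q * (m1 + (m2 + m3)) <= c / 2 ->
  c / 2 <= `|B - (g1 - g2)|.
Proof.
move=> h1 h2 h3 h4 h5.
have : `|J| <= `|B - (g1 - g2)| + (`|B - J| + (`|g1| + `|g2|)).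
  have {1}-> : J = (B - (g1 - g2)) - (B - J) + (g1 - g2) by ring.
  apply: le_trans (ler_normD _ _) _; rewrite addrA lerD ?ler_normB//.
rewrite !mulrDr in h5; lra.
Qed.

Lemma block0 (K : E -> R) k x : block (fun=> 0) K k x = 0.
Proof.
have z j : smear (fun=> 0) K j x = 0.
  transitivity (rint (fun _ : E => 0 : R)); last exact: (@rint0 R d).
  by apply: eq_rint => z; rewrite mulr0.
by case: k => [|k] /=; rewrite !z ?subrr.
Qed.

(** For [k] large, depending on [g], the error in [block_cube] and the blocks of
[g] amount together to at most half of the jump of the profile, whereas the resulting
bound from below does not involve [k]. *)
Lemma cube_far_from_schwartz (i0 : 'I_d) : exists2 e : R, 0 < e & forall g, schwartz g ->
  (e%:E <= besov_norm phi s p +oo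
     (dist_of (haar (fun=> false) 0 (fun=> 0%Z) : E -> C) \- dist_of g)%R)%E.
Proof.
have rr := kernel_re_rapid hphi; have ri := kernel_im_rapid hphi.
have [t0 [c [e [c0 e0 jump]]]] := halfmass_jump i0 rr (kernel_mass_gt0 hphi).
(* half of the jump times the measure of the slab, rescaled by 2^k *)
pose b : R := c / 2 * (2 * e * 2^-1 ^+ d.-1).
have c2 : 0 < c / 2 by rewrite divr_gt0.
have b0 : 0 < b by rewrite mulr_gt0// mulr_gt0 ?exprn_gt0//; lra.
exists (theta p (c / 2) b); first exact: theta_pos.
move=> g /schwartz_rapidP[/rapid_wlip[L1 w1] /rapid_wlip[L2 w2]].
rewrite haar_cube01.
set u := (fun x : E => (cube01 x)%:C%C : C).
pose M1 := rint (fun z => `|kernel_re phi z| * (1 + `|z|)).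
pose M2 := rint (fun z => `|kernel_im phi z| * (1 + `|z|)).
have [M10 M20] : 0 <= M1 /\ 0 <= M2 by split; exact: moment_ge0.
have [L10 L20] : 0 <= L1 /\ 0 <= L2 by case: w1 => _ ? _ _; case: w2.
pose A := 48 * M1 + (2 * L1 * M1 + 2 * L2 * M2).
have A0 : 0 <= A.
  have nn n : 0 <= n%:R :> R by exact: ler0n.
  exact: (addr_ge0 (mulr_ge0 (nn 48) M10) (addr_ge0 (mulr_ge0 (mulr_ge0 (nn 2) L10) M10)
    (mulr_ge0 (mulr_ge0 (nn 2) L20) M20))).
have [n hn] := small_pow2S (2 * A / c + 16 * (`|t0| + e)) ltr01.
set k := n.+1 in hn.
have p0 : 0 < 2 ^- k :> R by rewrite invr_gt0 exprn_gt0.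
have hA : 2 ^- k * A <= c / 2.
  have : 2 ^- k * (2 * A / c) <= 1.
    apply: le_trans hn; rewrite ler_pM2l// lerDl; apply: mulr_ge0 => //.
    by apply: addr_ge0 => //; exact: ltW.
  rewrite mulrA ler_pdivrMr// mul1r mulrCA; move: (2 ^- k * A) => q; lra.
have ht : 2 ^- k * (`|t0| + e) <= 16^-1.
  have : 2 ^- k * (16 * (`|t0| + e)) <= 1.
    apply: le_trans hn; rewrite ler_pM2l// lerDr; apply: divr_ge0 (ltW c0).
    exact: mulr_ge0.
  rewrite mulrCA; move: (2 ^- k * _) => q; lra.
have lu : 2 ^- k * (t0 - e) <= 2 ^- k * (t0 + e) by rewrite ler_pM2l//; lra.
have [sb rb] := slab_box_mass i0 lu.
have rbE : rint (fun x : E => (slab_box i0 (2 ^- k * (t0 - e)) (2 ^- k * (t0 + e)) x)%:R) =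
    2 ^- k * (2 * e * 2^-1 ^+ d.-1).
  by rewrite rb; move: (2 ^- k) (2^-1 ^+ d.-1) => q q'; ring.
have bu : bdd 1 (fun x => complex.Re (u x)) by split; [exact: cube01_meas|exact: cube01_bound].
have bu' : bdd 1 (fun x => complex.Im (u x)).
  by split=> [|x]; [exact: meas_cst|rewrite normr0].
have mx1 : L1 <= L1 + L2 by rewrite lerDl.
have mx2 : L2 <= L1 + L2 by rewrite lerDr.
have bg1 : bdd (L1 + L2) (fun x => complex.Re (g x)).
  by have [m h] := wlip_bdd w1; split => // x; apply: le_trans (h x) _.
have bg2 : bdd (L1 + L2) (fun x => complex.Im (g x)).
  by have [m h] := wlip_bdd w2; split => // x; apply: le_trans (h x) _.
have low x : slab_box i0 (2 ^- k * (t0 - e)) (2 ^- k * (t0 + e)) x ->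
    c / 2 <= Normc.normc (lp_block phi k (dist_of u \- dist_of g)%R x).
  move=> /forallP bx.
  pose t := 2 ^+ k * x ord0 i0.
  have xt : x ord0 i0 = 2 ^- k * t by rewrite /t mulKf// gt_eqF// exprn_gt0.
  have := bx i0; rewrite eqxx in_itv /= xt !ler_pM2l// => /andP[t1 t2].
  have tt : `|t - t0| <= e by rewrite ler_distl t1 t2.
  have xs : `|x ord0 i0| <= 16^-1.
    rewrite xt normrM (gtr0_norm p0); apply: le_trans ht; rewrite ler_pM2l//.
    have -> : t = t0 + (t - t0) by ring.
    by apply: le_trans (ler_normD _ _) _; rewrite lerD2l.
  have xm i : i != i0 -> 4^-1 <= x ord0 i <= 3/4.
    by move=> /negbTE ii; have := bx i; rewrite ii in_itv.
  have hb : `|block cube01 (kernel_re phi) k x - (halfmass i0 (kernel_re phi) t - halfmass i0 (kernel_re phi) (t / 2))|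
      <= 2 ^- k * (48 * M1) := block_cube rr xt xs xm.
  have hj := jump t tt.
  have -> : lp_block phi k (dist_of u \- dist_of g)%R x =
    lp_block phi k (dist_of u) x - lp_block phi k (dist_of g) x by [].
  rewrite (lp_blockE hphi k x bu bu') (lp_blockE hphi k x bg1 bg2).
  have re (y z : R) : complex.Re (Complex y z) = y by [].
  apply: le_trans (Re_le_normc _); rewrite cReB !re.
  have -> : block (fun x => complex.Im (u x)) (kernel_im phi) k x = 0 by exact: block0.
  rewrite subr0.
  have L12 : 0 <= 2 * L1 by exact: mulr_ge0.
  have L22 : 0 <= 2 * L2 by exact: mulr_ge0.
  have g1 : `|block (fun x => complex.Re (g x)) (kernel_re phi) k x| <= 2 ^- k * (2 * L1 * M1) :=
    block_lip rr n x bg1 L12 (fun y z => wlip_lip y z w1).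
  have g2 : `|block (fun x => complex.Im (g x)) (kernel_im phi) k x| <= 2 ^- k * (2 * L2 * M2) :=
    block_lip ri n x bg2 L22 (fun y z => wlip_lip y z w2).
  exact: far_arith hb hj g1 g2 hA.
apply: le_trans (_ : (bterm phi s p (dist_of u \- dist_of g)%R k <= _)%E); last first.
  by have := lexx (besov_norm phi s p +oo (dist_of u \- dist_of g)%R); move/besov_norm_leP; apply.
have bx0 : 0 < rint (fun x : E => (slab_box i0 (2 ^- k * (t0 - e)) (2 ^- k * (t0 + e)) x)%:R : R).
  by rewrite rbE mulr_gt0// mulr_gt0 ?exprn_gt0// mulr_gt0.
have := cLnorm_ge p1 c2 sb bx0 low.
rewrite rbE mulrCA -/b /bterm => cl.
rewrite -(theta_scale (c / 2) k p1 (ltW b0)) -/s EFinM.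
by rewrite lee_wpmul2l// lee_fin powR_ge0.
Qed.

End Strictness.

(** * Functions as tempered distributions *)

Section Tempered.
Context {R : realType} {d : nat}.
Local Notation E := 'rV[R]_d.
Local Notation C := R[i].

Lemma cReD (x y : C) : complex.Re (x + y) = complex.Re x + complex.Re y.
Proof. by case: x; case: y. Qed.

Lemma cImD (x y : C) : complex.Im (x + y) = complex.Im x + complex.Im y.
Proof. by case: x; case: y. Qed.

Lemma cintegral_lin (c : C) (f g : E -> C) :
  summ (fun x => complex.Re (f x)) -> summ (fun x => complex.Im (f x)) ->
  summ (fun x => complex.Re (g x)) -> summ (fun x => complex.Im (g x)) ->
  cintegral (fun x => c * f x + g x) = c * cintegral f + cintegral g.
Proof.
move=> f1 f2 g1 g2; rewrite !cintegralE.
apply/eqP; rewrite eq_complex; apply/andP; split; apply/eqP.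
  rewrite cReD cReM /=.
  transitivity (rint (fun x => complex.Re c * complex.Re (f x) -
      complex.Im c * complex.Im (f x) + complex.Re (g x))).
    by apply: eq_rint => x; rewrite cReD cReM.
  rewrite rintD//; last by apply: summB; exact: summZ.
  by rewrite rintB ?rintZ//; exact: summZ.
rewrite cImD cImM /=.
transitivity (rint (fun x => complex.Re c * complex.Im (f x) +
    complex.Im c * complex.Re (f x) + complex.Im (g x))).
  by apply: eq_rint => x; rewrite cImD cImM.
rewrite rintD//; last by apply: summD; exact: summZ.
by rewrite rintD ?rintZ//; exact: summZ.
Qed.

Lemma schwartz_lin (c : C) (f g : E -> C) : schwartz f -> schwartz g ->
  schwartz (fun x => c * f x + g x).
Proof.
move=> /schwartz_rapidP[f1 f2] /schwartz_rapidP[g1 g2]; apply/schwartz_rapidP; split.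
  have := rapidD (rapidB (rapidZ (complex.Re c) f1) (rapidZ (complex.Im c) f2)) g1.
  by congr rapid; apply/funext => x; rewrite cReD cReM.
have := rapidD (rapidD (rapidZ (complex.Re c) f2) (rapidZ (complex.Im c) f1)) g2.
by congr rapid; apply/funext => x; rewrite cImD cImM.
Qed.

(** The supremum in the Schwartz seminorm runs over finitely many derivatives. *)
Lemma bounded_on_short_words (M : seq 'I_d -> R) n :
  exists B, forall s, (size s <= n)%N -> M s <= B.
Proof.
elim: n M => [|n IH] M; first by exists (M [::]) => -[].
have /choice[B bB] := fun j => IH (fun s => M (j :: s)).
exists (`|M [::]| + \sum_j `|B j|) => -[_|j s sn].
  by apply: le_trans (ler_norm _) _; rewrite lerDl sumr_ge0.
apply: le_trans (bB j s sn) _; apply: le_trans (ler_norm _) _.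
by rewrite (bigD1 j)//= addrCA lerDl addr_ge0// sumr_ge0.
Qed.

Lemma schwartz_le_seminorm N (psi : E -> C) x : schwartz psi ->
  (1 + `|x|) ^+ N * Normc.normc (psi x) <= schwartz_seminorm N psi.
Proof.
move=> [_ _ b]; rewrite /schwartz_seminorm.
have /choice[M bM] := b N; have [B hB] := bounded_on_short_words M N.
apply: sup_upper_bound.
  split; first by exists (schwartz_weight N [::] psi 0), [::], 0.
  by exists B => _ [s [y [sN ->]]]; apply: le_trans (bM s y) (hB s sN).
exists [::], x; split => //; rewrite /schwartz_weight; congr (_ * Normc.normc _).
by rewrite /cpartials /=; case: (psi x).
Qed.

(** A bounded function pairs continuously with the Schwartz class through the
integrable weight. *)
Lemma dist_of_tempered a (g : E -> C) :
  bdd a (fun x => complex.Re (g x)) -> bdd a (fun x => complex.Im (g x)) ->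
  tempered (dist_of g).
Proof.
move=> g1 g2.
have S psi : schwartz psi -> summ (fun x => complex.Re (g x * psi x)) /\
    summ (fun x => complex.Im (g x * psi x)).
  by move=> /schwartz_rapidP[/rapid_summ s1 /rapid_summ s2]; exact: (summ_cmul g1 g2 s1 s2).
split.
- move=> c f h sf sh; rewrite /dist_of !asboolT//; last exact: schwartz_lin.
  have [f1 f2] := S f sf; have [h1 h2] := S h sh.
  rewrite -cintegral_lin//; congr cintegral; apply/funext => x.
  by rewrite mulrDr mulrCA.
- exists (2 * d)%N, (4 * a * @wmass R d) => f sf.
  rewrite /dist_of asboolT// cintegralE; have [f1 f2] := S f sf.
  set s := schwartz_seminorm _ _.
  have a0 : 0 <= a by case: g1 => _ b; apply: le_trans (b 0).
  have fw x : Normc.normc (f x) <= s * wt x.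
    by rewrite /wt ler_pdivlMr ?exprn_gt0 ?norm1_gt0// mulrC; exact: schwartz_le_seminorm.
  have b x : `|complex.Re (g x * f x)| <= 2 * a * s * wt x /\
             `|complex.Im (g x * f x)| <= 2 * a * s * wt x.
    have [[_ b1] [_ b2]] := (g1, g2).
    have h1 : `|complex.Re (f x)| <= s * wt x by apply: le_trans (Re_le_normc _) (fw x).
    have h2 : `|complex.Im (f x)| <= s * wt x by apply: le_trans (Im_le_normc _) (fw x).
    have m u v : `|u| <= a -> `|v| <= s * wt x -> `|u * v| <= a * (s * wt x).
      by move=> ua vs; rewrite normrM ler_pM.
    have -> : 2 * a * s * wt x = a * (s * wt x) + a * (s * wt x) by ring.
    rewrite cReM cImM; split.
      by apply: le_trans (ler_normB _ _) _; apply: lerD; apply: m.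
    by apply: le_trans (ler_normD _ _) _; apply: lerD; apply: m.
  have Sw : summ (fun x : E => 2 * a * s * wt x) by exact: summZ summ_wt.
  apply: le_trans (normc_le _) _ => /=.
  have -> : 4 * a * @wmass R d * s = 2 * a * s * @wmass R d + 2 * a * s * @wmass R d by ring.
  rewrite /wmass -rintZ; last exact: summ_wt.
  by apply: lerD; apply: rint_bound => //; [exact: summ_meas|move=> x; case: (b x)|exact: summ_meas|move=> x; case: (b x)].
- by move=> f sf; rewrite /dist_of asboolF.
Qed.

End Tempered.

(** * The inclusion and its strictness *)

Section Main.
Context {R : realType} {d : nat}.
Local Notation E := 'rV[R]_d.
Local Notation C := R[i].

Lemma wlip_weaken a b (F : E -> R) : a <= b -> wlip a F -> wlip b F.
Proof.
move=> ab [mF a0 bF lF]; split => //; first exact: le_trans ab.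
  by move=> x; apply: le_trans (bF x) _; rewrite ler_wpM2r// wt_ge0.
by move=> x v v1; apply: le_trans (lF x v v1) _; rewrite !ler_wpM2r// wt_ge0.
Qed.

Lemma bdd_grid a N (F : E -> R) : bdd a F -> bdd a (F \o grid N).
Proof. by move=> [_ bF]; split => [|x]; [exact: meas_grid|exact: bF]. Qed.

(** A function bounded by a multiple of a weight that tends to zero is below
the threshold outside a large ball; in dimension zero the weight is constant. *)
Lemma wlip_soft_supported a (F : E -> R) e : (0 < d)%N -> 0 < e -> wlip a F ->
  supported (a / e) (fun x => soft e (F x)).
Proof.
move=> d0 e0 [_ a0 bF _] x xr; apply: soft_small; apply: le_trans (bF x) _.
have h : wt x <= (1 + `|x|)^-1.
  rewrite /wt lef_pV2 ?posrE ?exprn_gt0 ?norm1_gt0//.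
  by rewrite -[leLHS]expr1 ler_weXn2l ?lerDl// muln_gt0.
apply: le_trans (ler_wpM2l a0 h) _.
rewrite ler_pdivrMr ?norm1_gt0// ltW//.
rewrite ltr_pdivrMr// in xr; apply: lt_trans xr _.
by rewrite mulrC ltr_pM2l// ltrDr.
Qed.

Definition haar_approx N (g : E -> C) : E -> C := fun x =>
  Complex (soft (2 ^- N) (complex.Re (g (grid N x))))
          (soft (2 ^- N) (complex.Im (g (grid N x)))).

Lemma approx_span N a (g : E -> C) : (0 < d)%N ->
  wlip a (fun x => complex.Re (g x)) -> wlip a (fun x => complex.Im (g x)) ->
  lin_span haar_system (haar_approx N g).
Proof.
move=> d0 w1 w2; have p : 0 < 2 ^- N :> R by rewrite invr_gt0 exprn_gt0.
have s1 := step_span N (wlip_soft_supported d0 p w1).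
have s2 := step_span N (wlip_soft_supported d0 p w2).
have := spanD s1 (spanZ (Complex 0 1) s2); congr lin_span; apply/funext => x.
apply/eqP; rewrite eq_complex /= !mul0r !mul1r !subr0 ?sub0r ?oppr0 ?addr0 ?add0r.
by rewrite !eqxx.
Qed.

Lemma approx_part N a (F : E -> R) : wlip a F ->
  bdd (2 ^- N * (1 + a)) (fun x => F x - soft (2 ^- N) (F (grid N x))) /\
  bv (2 * (a * @wmass R d) + @stepK R d * a) (fun x => F x - soft (2 ^- N) (F (grid N x))).
Proof.
move=> w; have p : 0 <= 2 ^- N :> R by rewrite invr_ge0 exprn_ge0.
have ws := wlip_soft p w; split; last exact: bvB (wlip_bv w) (wlip_step N ws).
split.
  case: (w) => mF _ _ _; apply: measB => //.
  exact: (@meas_grid _ _ (fun x => soft (2 ^- N) (F x)) N).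
move=> x.
have -> : F x - soft (2 ^- N) (F (grid N x)) = F x - soft (2 ^- N) (F x) +
    (soft (2 ^- N) (F x) - soft (2 ^- N) (F (grid N x))) by ring.
apply: le_trans (ler_normD _ _) _; rewrite mulrDr mulr1 (mulrC _ a).
by apply: lerD; [exact: soft_dist|exact: wlip_grid_dist ws].
Qed.

Variables (p : \bar R) (phi : E -> C).
Hypothesis p1 : (1 < p)%E.
Hypothesis hphi : lp_generator phi.
Let s := fine (p^-1)%E.

Lemma besov_bddbv (f : E -> C) a V :
  bdd a (fun x => complex.Re (f x)) -> bdd a (fun x => complex.Im (f x)) ->
  bv V (fun x => complex.Re (f x)) -> bv V (fun x => complex.Im (f x)) ->
  besov phi s p +oo (dist_of f).
Proof.
move=> b1 b2 v1 v2; split; first exact: dist_of_tempered b1 b2.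
exact: le_lt_trans (besov_norm_bound hphi p1 b1 b2 v1 v2) (ltry _).
Qed.

(** Thresholding and sampling at level [N] give a step function whose distance
to [g] is [O(2^-N)], with variation bounded independently of [N]; [theta_small]
then chooses [N]. *)
Lemma schwartz_haar_approx (hd : (0 < d)%N) (g : E -> C) (e : R) : schwartz g -> 0 < e ->
  exists h, [/\ lin_span haar_system h, besov phi s p +oo (dist_of h) &
    forall T, (besov_norm phi s p +oo (T \- dist_of g)%R <= e%:E)%E ->
      (besov_norm phi s p +oo (T \- dist_of h)%R <= (4 * e)%:E)%E].
Proof.
move=> /schwartz_rapidP[/rapid_wlip[a1 w1] /rapid_wlip[a2 w2]] e0.
have [p1' p2'] : 0 <= a1 /\ 0 <= a2 by case: w1 => _ ? _ _; case: w2.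
have {}w1 : wlip (a1 + a2) (fun x => complex.Re (g x)).
  by apply: wlip_weaken w1; rewrite lerDl.
have {}w2 : wlip (a1 + a2) (fun x => complex.Im (g x)).
  by apply: wlip_weaken w2; rewrite lerDr.
set a := a1 + a2 in w1 w2; have a0 : 0 <= a by exact: addr_ge0.
pose V := 2 * (a * @wmass R d) + @stepK R d * a.
have V0 : 0 <= V by have [_ [_ ? _ _]] := approx_part 0 w1.
have kV : 0 <= 4 * kmass phi * V by rewrite !mulr_ge0// kmass_ge0.
have [c c0 hc] := theta_small p1 kV e0.
have [N hN] := small_pow2 (8 * kmass phi * (1 + a)) c0.
pose b := 2 ^- N * (1 + a).
have [b1 v1] := approx_part N w1; have [b2 v2] := approx_part N w2.
have pN : 0 <= 2 ^- N :> R by rewrite invr_ge0 exprn_ge0.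
have ws1 := wlip_soft pN w1; have ws2 := wlip_soft pN w2.
have bh1 : bdd a (fun x => complex.Re (haar_approx N g x)) := bdd_grid N (wlip_bdd ws1).
have bh2 : bdd a (fun x => complex.Im (haar_approx N g x)) := bdd_grid N (wlip_bdd ws2).
exists (haar_approx N g); split.
- exact: approx_span w1 w2.
- have vh1 : bv (@stepK R d * a) (fun x => complex.Re (haar_approx N g x)) := wlip_step N ws1.
  have vh2 : bv (@stepK R d * a) (fun x => complex.Im (haar_approx N g x)) := wlip_step N ws2.
  exact: besov_bddbv bh1 bh2 vh1 vh2.
move=> T hT.
have diff : (dist_of g \- dist_of (haar_approx N g))%R = dist_of (fun x => g x - haar_approx N g x).
  exact: dist_ofB (wlip_bdd w1) (wlip_bdd w2) bh1 bh2.
apply: (besov_norm_perturb (f := fun x => g x - haar_approx N g x) (a := b) (V := V) hphi p1 _ _ _ _ _ hT).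
- by under eq_fun do rewrite cReB.
- by under eq_fun do rewrite cImB.
- by under eq_fun do rewrite cReB.
- by under eq_fun do rewrite cImB.
- apply: hc; apply/andP; split; first by rewrite !mulr_ge0 ?kmass_ge0// addr_ge0.
  by rewrite /b mulrCA.
move=> k x; rewrite -diff /lp_block /=; ring.
Qed.

Lemma cube_besov : bdd 1 (@cube01 R d) /\ exists V, bv V (@cube01 R d) /\ bv V (fun _ : E => 0 : R).
Proof.
split; first by split; [exact: cube01_meas|exact: cube01_bound].
exists (@stepK R d * 3 ^+ (2 * d)).
have h : bv (@stepK R d * 3 ^+ (2 * d)) (@cube01 R d).
  by rewrite cube01_cone; apply: wlip_step; exact: cone_wlip.
split => //; case: h => _ V0 _ _; split => //.
- exact: summ0.
- by rewrite normr0 rint0.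
- by move=> v; rewrite subrr normr0 rint0 mulr_ge0.
Qed.

(** The factor [5] absorbs the constant [4] of the perturbation lemma and
keeps the inequality strict. *)
Lemma little_besov_sub_haar (hd : (0 < d)%N) :
  little_besov phi s p +oo `<=` besov_closure phi s p +oo (dist_of @` lin_span haar_system).
Proof.
move=> T [bT hT]; split => // e e0; have e5 : 0 < e / 5 by rewrite divr_gt0.
have [_ [[g sg <-] _ ng]] := hT _ e5.
have [h [sh bh nh]] := schwartz_haar_approx hd sg e5.
exists (dist_of h); split => //.
apply: le_lt_trans (nh T (ltW ng)) _; rewrite lte_fin.
have -> : 4 * (e / 5) = e - e / 5 by field.
by rewrite gtrBl.
Qed.

Lemma cube_in_haar_closure :
  besov_closure phi s p +oo (dist_of @` lin_span haar_system)
    (dist_of (haar (fun=> false) 0 (fun=> 0%Z) : E -> C)).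
Proof.
have [b [V [v v0]]] := cube_besov.
have b0 : bdd 1 (fun _ : E => 0 : R) by split=> [|x]; [exact: meas_cst|rewrite normr0].
have bu : besov phi s p +oo (dist_of (haar (fun=> false) 0 (fun=> 0%Z) : E -> C)).
  by rewrite haar_cube01; exact: (@besov_bddbv (fun x : E => (cube01 x)%:C%C) 1 V b b0 v v0).
split => // e e0; exists (dist_of (haar (fun=> false) 0 (fun=> 0%Z))); split => //.
  by exists (haar (fun=> false) 0 (fun=> 0%Z)) => //; exact: haar_cell.
have -> : (dist_of (haar (fun=> false) 0 (fun=> 0%Z) : E -> C) \-
    dist_of (haar (fun=> false) 0 (fun=> 0%Z) : E -> C))%R = dist_of (fun _ : E => 0 : C).
  apply/funext => psi; rewrite /= subrr /dist_of; case: asboolP => // _.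
  rewrite cintegralE; under eq_rint do rewrite mul0r.
  by under [in X in Complex _ X]eq_rint do rewrite mul0r; rewrite rint0.
have z : bdd 0 (fun _ : E => 0 : R) by split=> [|x]; [exact: meas_cst|rewrite normr0].
have V0 : 0 <= V by case: v.
have kV : 0 <= 4 * kmass phi * V by rewrite !mulr_ge0// kmass_ge0.
have e2 : 0 < e / 2 by rewrite divr_gt0.
have [c c0 hc] := theta_small p1 kV e2.
have -> := le_lt_trans (besov_norm_bound (f := fun _ : E => 0 : C) hphi p1 z z v0 v0) _ => //.
rewrite mulr0 lte_fin; apply: le_lt_trans (hc 0 _) _; first by rewrite lexx ltW.
by rewrite ltr_pdivrMr// ltr_pMr// ltr1n.
Qed.

End Main.

Theorem proposition8p6 (R : realType) (d : nat) (p : \bar R)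
    (phi : 'rV[R]_d -> R[i]) (hd : (1 <= d)%N) (hp : (1 < p)%E)
    (hphi : lp_generator phi) :
  little_besov phi (fine (p^-1)%E) p +oo%E `<`
  besov_closure phi (fine (p^-1)%E) p +oo%E (dist_of @` lin_span haar_system).
Proof.
split; first exact: little_besov_sub_haar.
move=> /(_ _ (cube_in_haar_closure hp hphi)) [_ far].
have [e e0 low] := cube_far_from_schwartz hp hphi (Ordinal hd).
have [_ [[g sg <-] _]] := far e e0.
by rewrite ltNge low.
Qed.
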